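(* Let $\{b_n\}$ be a positive sequence with $b_n\to\infty$ and $b_n=o(n)$. Then for any $\lambda>0$, $$\limsup_{\epsilon\to0}\;\limsup_{n\to\infty}\;\sup_{y\in\mathbb{Z}^2}\;\frac{1}{b_n}\log\mathbb{E}\left(\exp\left\{\lambda\left|\frac{I_n(y)-I_{n,\epsilon}(y)}{b_n^{-1}n}\right|^{1/2}\right\}\right)=0.$$
   Context: Let $\{S_1(n)\}$ and $\{S_2(n)\}$ be independent copies of a random walk $\{S_n\}$ on $\mathbb{Z}^2$ started at $0$, with i.i.d. symmetric increments ($S_1\stackrel{d}{=}-S_1$) having finite second moments. Standing assumptions: the smallest group which supports $\{S_n\}$ is $\mathbb{Z}^2$ (i.e. the smallest subgroup of $\mathbb{Z}^2$ containing $\{x:\mathbb{P}(S_1=x)>0\}$ is $\mathbb{Z}^2$), and the walk is strongly aperiodic (for each $x\in\mathbb{Z}^2$, the smallest subgroup containing $\{x+z:\mathbb{P}(S_1=z)>0\}$ is $\mathbb{Z}^2$). Let $f$ be a positive symmetric function in the Schwartz space $\mathcal{S}(\mathbb{R}^2)$ with $\int f\,dx=1$ and with Fourier transform $\widehat f(\lambda)=\int_{\mathbb{R}^2} e^{-i\lambda\cdot x}f(x)\,dx$ supported in $(-\pi,\pi)^2$. For $r>0$ put $f_r(x)=r^{-2}f(r^{-1}x)$, and for a function $g$ on $\mathbb{R}^2$ put $(g\circledast g)(y)=\sum_{x\in\mathbb{Z}^2}g(x)g(y-x)$. With $\delta(x,y)=1$ if $x=y$ and $0$ otherwise, define for $y\in\mathbb{Z}^2$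 and $\epsilon>0$ $$I_n(y)=\sum_{n_1,n_2=1}^n\delta\big(S_1(n_1),S_2(n_2)+y\big),$$ $$I_{n,\epsilon}(y)=\sum_{n_1,n_2=1}^n\big(f_{(b_n^{-1}n)^{1/2}\epsilon}\circledast f_{(b_n^{-1}n)^{1/2}\epsilon}\big)\big(S_2(n_2)-S_1(n_1)+y\big).$$ *)

(* Defs.v *)
From HB Require Import structures.
From mathcomp Require Import all_boot all_order all_algebra.
From mathcomp Require Import finmap complex.
From mathcomp Require Import all_classical all_reals all_analysis.

Set Implicit Arguments.
Unset Strict Implicit.
Unset Printing Implicit Defensive.

Import Order.TTheory GRing.Theory Num.Theory.
Import numFieldNormedType.Exports.

Local Open Scope classical_set_scope.
Local Open Scope ring_scope.

Definition is_subgroup (V : zmodType) (H : set V) : Prop :=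
  H 0 /\ forall x y, H x -> H y -> H (x - y).

Definition generates_Z2 (A : set (int * int)) : Prop :=
  smallest (@is_subgroup (int * int)%type) A = setT.

Definition sqnorm (R : realType) (z : int * int) : R :=
  z.1%:~R ^+ 2 + z.2%:~R ^+ 2.

Section RandomWalk.
Context (R : realType) (d : measure_display) (T : measurableType d)
        (P : probability T R).
Implicit Types (X S : nat -> T -> int * int) (A : nat -> set (int * int)).

(* Z^2 carries the discrete
   sigma-algebra, so arbitrary sets of values are allowed. *)
Definition cylinder X (J : {fset nat}) A : set T :=
  \bigcap_(k in [set` J]) (X k @^-1` A k).

Definition mutually_independent X : Prop :=
  forall (J : {fset nat}) A,
    P (cylinder X J A) = (\prod_(k <- J) P (X k @^-1` A k))%E.

Definition identically_distributed X : Prop :=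
  forall k (A : set (int * int)), P (X k @^-1` A) = P (X 0%N @^-1` A).

Definition increment S (k : nat) (w : T) : int * int := S k.+1 w - S k w.

Record random_walk S : Prop := RandomWalk {
  rw_measurable : forall k (A : set (int * int)), measurable (S k @^-1` A) ;
  rw_start : forall w, S 0%N w = 0 ;
  rw_independent : mutually_independent (increment S) ;
  rw_identical : identically_distributed (increment S) }.

Definition same_law S S' : Prop :=
  forall (J : {fset nat}) A, P (cylinder S J A) = P (cylinder S' J A).

Definition independent_processes S S' : Prop :=
  forall (J J' : {fset nat}) A A',
    P (cylinder S J A `&` cylinder S' J' A') =
    (P (cylinder S J A) * P (cylinder S' J' A'))%E.

Definition symmetric_step S : Prop :=
  forall A : set (int * int),
    P [set w | A (S 1%N w)] = P [set w | A (- S 1%N w)].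

Definition finite_second_moment S : Prop :=
  ('E_P[fun w => sqnorm R (S 1%N w)] < +oo)%E.

Definition step_support S : set (int * int) :=
  [set z | (0 < P (S 1%N @^-1` [set z]))%E].

Definition strongly_aperiodic S : Prop :=
  forall x : int * int, generates_Z2 [set x + z | z in step_support S].

End RandomWalk.

Section Plane.
Context (R : realType).
Implicit Types (f g : R * R -> R).

Definition basis_vector (i : bool) : R * R := if i then (0, 1) else (1, 0).

(* The iterated partial derivative along the word s in the coordinate
   directions, the last letter being applied first. *)
Fixpoint iterated_partial (s : seq bool) f : R * R -> R :=
  if s is i :: s' then 'D_(basis_vector i) (iterated_partial s' f) else f.

Definition smooth f : Prop :=
  forall (s : seq bool) (x : R * R), differentiable (iterated_partial s f) x.

Definition rapidly_decreasing f : Prop :=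
  forall (a b : nat) (s : seq bool), exists M : R,
    forall x : R * R, `|x.1 ^+ a * x.2 ^+ b * iterated_partial s f x| <= M.

Definition schwartz f : Prop := smooth f /\ rapidly_decreasing f.

Definition lebesgue2 :=
  ((@lebesgue_measure R) \x (@lebesgue_measure R))%E.

Definition dotp (l x : R * R) : R := l.1 * x.1 + l.2 * x.2.

(* \int exp(- i l.x) f(x) dx, for a real-valued f. *)
Definition fourier f (l : R * R) : R[i] :=
  Complex (Rintegral lebesgue2 setT (fun x => cos (dotp l x) * f x))
          (- Rintegral lebesgue2 setT (fun x => sin (dotp l x) * f x)).

Definition fourier_support f : set (R * R) :=
  closure [set l | fourier f l != 0].

Definition rescale f (r : R) (x : R * R) : R := r ^- 2 * f (r^-1 *: x).

Definition Z2_to_R2 (z : int * int) : R * R := (z.1%:~R, z.2%:~R).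

(* \esum is a supremum of finite sums: this is the intended series because
   it is only used for positive g. *)
Definition lattice_conv g (y : int * int) : R :=
  fine (\esum_(x in [set: int * int])
          (g (Z2_to_R2 x) * g (Z2_to_R2 (y - x)))%:E).

Section IntersectionLocalTimes.
Context (T : Type) (S1 S2 : nat -> T -> int * int).

Definition intersection_lt (n : nat) (y : int * int) (w : T) : R :=
  \sum_(1 <= n1 < n.+1) \sum_(1 <= n2 < n.+1)
    (S1 n1 w == S2 n2 w + y)%:R.

Definition smoothed_intersection_lt f (b : nat -> R) (eps : R)
    (n : nat) (y : int * int) (w : T) : R :=
  \sum_(1 <= n1 < n.+1) \sum_(1 <= n2 < n.+1)
    lattice_conv (rescale f (Num.sqrt ((b n)^-1 * n%:R) * eps))
                 (S2 n2 w - S1 n1 w + y).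

End IntersectionLocalTimes.
End Plane.

(* Main.v *)
Require Import Defs.
From HB Require Import structures.
From mathcomp Require Import all_boot all_order all_algebra.
From mathcomp Require Import finmap complex.
From mathcomp Require Import all_classical all_reals all_analysis.
From mathcomp Require Import measurable_realfun.
From mathcomp Require Import zify ring lra.

Set Implicit Arguments.
Unset Strict Implicit.
Unset Printing Implicit Defensive.

Import Order.TTheory GRing.Theory Num.Theory.
Import numFieldNormedType.Exports.

Local Open Scope classical_set_scope.
Local Open Scope ring_scope.

(** The difference of the two functionals is the sum over all pairs of times
    of [D (S2 j - S1 i + y)], where [D = delta - K] and [K = g * g] is the
    self-convolution of the bump [g] restricted to the lattice. The kernel [K]
    is nonnegative and even, and its total mass [kappa] is the square of a
    Riemann sum of [f], hence tends to 1 ([riemann_sum_cvg]). So [D] is the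
    kernel [kappa delta - K], which is positive definite since its diagonal
    dominates ([posdef_diagonally_dominant]), plus a small multiple of [delta].

    Consider a positive definite [Q] such that [rho delta - Q] is also positive
    definite. In the [m]-th moment of the pair functional of [Q] the
    Cauchy-Schwarz inequality in the [m]-th tensor power of the Hilbert space
    of [Q] separates the two walks and removes the shift [y]
    ([expect2_prod_le]). What remains is, for each list of times, an
    expectation over two copies of the walk observed at the same times; the
    order of the times does not matter, so they may be sorted, at the cost of
    a factor [m!] ([sum_words_le_sorted]). At every second time [Q] is replaced
    by the larger [rho delta], which brings the difference of the two copies
    back to 0: the expectation becomes a product of independent factors, called
    bridges, each depending on two successive gaps ([tensor_norm_le_bridges]).
    A geometric weight of ratio [1 / (1 + s)] decouples the gaps
    ([sum_sorted_bridges_le]), and the sum of the weighted square roots of the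
    bridges bounds the absolute moment of order [k] by [(2k)!] times its [k]-th
    power times [(1 + s)^n]. The even terms of the exponential series of
    [theta] times the square root of the functional then add up to at most [4 (1 + s)^n], provided
    [theta^2] times the weighted sum is at most 1/2 ([exp_moment_le]).

    The bridges are estimated through the law [h k] of the difference walk.
    It is positive definite, and [h k 0 - h k x] is half the squared distance
    between the law of the walk and its translate by [x]; hence the square root
    of this defect is subadditive in [x]. Strong aperiodicity compares it, for
    every [x], with the drop [h k 0 - h k.+1 0] ([uniform_heat_bounds]), and
    averaging over squares yields a Nash inequality, so that [h k 0 <= C / k]
    and [h k 0 - h k x <= C |x|^2 / k^2] ([heat0_le], [heat_defect_le]). If [r]
    is the range of the bump [g], the bridges of [kappa delta - K] are
    therefore smaller than those of [delta] as soon as both gaps are longer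
    than [r^2] ([sqrt_bridge_le]).

    With [s] a small multiple [c] of [b_n / n], the relevant gaps are of order
    [n / b_n], whereas [r] is [eps sqrt (n / b_n)]. For [eps] small enough in
    terms of [c] the gain makes the condition on [theta] true, and the
    exponential moment is at most [4 (1 + s)^n <= 4 exp (c b_n)]
    ([smoothing_moment_le]). As [c] is arbitrary, this is the claim; the lower
    bound holds because the expectation is at least 1.

    The moment estimates are carried out for walks with finitely many steps,
    whose expectations are finite sums. An arbitrary walk is reached by
    sending the steps outside a large finite set to 0, with constants that do
    not depend on this set ([expectation_le_truncated]). *)

(** * Positive semidefinite kernels *)

Lemma cauchy_schwarz_sum (R : realFieldType) (I : Type) (s : seq I)
    (f g : I -> R) :
  (\sum_(i <- s) f i * g i) ^+ 2
    <= (\sum_(i <- s) f i ^+ 2) * (\sum_(i <- s) g i ^+ 2).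
Proof.
elim: s => [|a s IH]; first by rewrite !big_nil mul0r expr0n.
rewrite !big_cons.
set x := \sum_(i <- s) f i * g i in IH *.
set F := \sum_(i <- s) f i ^+ 2 in IH *.
set G := \sum_(i <- s) g i ^+ 2 in IH *.
have F0 : 0 <= F by apply: sumr_ge0 => i _; exact: sqr_ge0.
have G0 : 0 <= G by apply: sumr_ge0 => i _; exact: sqr_ge0.
suff : 2 * (f a * g a * x) <= f a ^+ 2 * G + g a ^+ 2 * F.
  move=> cross; rewrite sqrrD mulrDl !mulrDr; move: cross IH; rewrite exprMn.
  lra.
have [F_eq0|F_neq0] := eqVneq F 0.
  have -> : x = 0.
    apply/eqP; rewrite -sqrf_eq0 eq_le sqr_ge0 andbT.
    by apply: le_trans IH _; rewrite F_eq0 mul0r.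
  by rewrite !mulr0 addr_ge0 // mulr_ge0 ?sqr_ge0.
have {}F0 : 0 < F by rewrite lt_def F_neq0.
(* with F > 0, complete the square in g a *)
rewrite -(ler_pM2l F0).
have sq := sqr_ge0 (g a * F - f a * x).
have fFG : f a ^+ 2 * x ^+ 2 <= f a ^+ 2 * (F * G).
  by apply: ler_wpM2l => //; exact: sqr_ge0.
by rewrite -subr_ge0; move: sq fFG; rewrite sqrrB !exprMn; lra.
Qed.

Section Kernels.
Variable R : rcfType.

(** A kernel is positive semidefinite on the finite set [s] when its matrix
    is a finite sum of rank one matrices. With this explicit form the Schur
    product theorem [psd_mul] needs no spectral theory: the entrywise product
    of two rank one matrices has rank one. *)
Definition psd (X : eqType) (s : seq X) (M : X -> X -> R) : Prop :=
  exists l : seq (X -> R),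
    {in s &, forall x y, M x y = \sum_(phi <- l) phi x * phi y}.

Section Psd.
Variables (X : eqType) (s : seq X).
Implicit Types M N : X -> X -> R.

Lemma eq_psd M N : {in s &, forall x y, M x y = N x y} -> psd s M -> psd s N.
Proof. by move=> e [l h]; exists l => x y xs ys; rewrite -e // h. Qed.

Lemma psd_add M N : psd s M -> psd s N -> psd s (fun x y => M x y + N x y).
Proof.
move=> [l hl] [k hk]; exists (l ++ k) => x y xs ys.
by rewrite big_cat /= hl ?hk.
Qed.

Lemma psd_mul M N : psd s M -> psd s N -> psd s (fun x y => M x y * N x y).
Proof.
move=> [l hl] [k hk].
exists [seq (fun x => phi x * psi x) | phi <- l, psi <- k] => x y xs ys.
rewrite hl ?hk // big_allpairs_dep /= big_distrlr /=.
by apply: eq_bigr => phi _; apply: eq_bigr => psi _; rewrite mulrACA.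
Qed.

Lemma psd_scale c M : 0 <= c -> psd s M -> psd s (fun x y => c * M x y).
Proof.
move=> c0 [l hl]; exists [seq (fun x => Num.sqrt c * phi x) | phi <- l].
move=> x y xs ys; rewrite hl // big_map mulr_sumr; apply: eq_bigr => phi _.
by rewrite mulrACA -expr2 sqr_sqrtr.
Qed.

Lemma psd_prod (J : Type) (t : seq J) (M : J -> X -> X -> R) :
  (forall j, psd s (M j)) -> psd s (fun x y => \prod_(j <- t) M j x y).
Proof.
move=> hM; elim: t => [|j t IH].
  by exists [:: fun=> 1] => x y _ _; rewrite big_nil big_seq1 mulr1.
apply: eq_psd (psd_mul (hM j) IH) => x y _ _.
by rewrite big_cons.
Qed.

Definition quadratic (c d : X -> R) M : R :=
  \sum_(x <- s) \sum_(y <- s) c x * d y * M x y.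

(** The quadratic form is an inner product of vectors indexed by the rank one
    terms, to which the Cauchy-Schwarz inequality applies. *)
Lemma quadratic_psd c d M l :
  {in s &, forall x y, M x y = \sum_(phi <- l) phi x * phi y} ->
  quadratic c d M = \sum_(phi <- l)
    (\sum_(x <- s) c x * phi x) * (\sum_(x <- s) d x * phi x).
Proof.
move=> hl; under [RHS]eq_bigr do rewrite big_distrlr /=.
rewrite exchange_big /quadratic /= big_seq [RHS]big_seq.
apply: eq_bigr => x xs; rewrite exchange_big /= big_seq [RHS]big_seq.
apply: eq_bigr => y ys; rewrite hl // mulr_sumr; apply: eq_bigr => phi _.
by rewrite mulrACA.
Qed.

Lemma quadratic_ge0 c M : psd s M -> 0 <= quadratic c c M.
Proof.
move=> [l hl]; rewrite (quadratic_psd _ _ hl); apply: sumr_ge0 => phi _.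
by rewrite -expr2 sqr_ge0.
Qed.

Lemma quadratic_cauchy_schwarz c d M : psd s M ->
  quadratic c d M ^+ 2 <= quadratic c c M * quadratic d d M.
Proof.
move=> [l hl]; rewrite !(quadratic_psd _ _ hl).
exact: cauchy_schwarz_sum.
Qed.

End Psd.

Lemma psd_map (X Y : eqType) (s : seq Y) (f : Y -> X) (M : X -> X -> R) :
  psd [seq f y | y <- s] M -> psd s (fun x y => M (f x) (f y)).
Proof.
move=> [l hl]; exists [seq (fun y => phi (f y)) | phi <- l] => x y xs ys.
by rewrite hl ?map_f // big_map.
Qed.

End Kernels.

(** * Positive definite functions on an abelian group *)

Section PositiveDefinite.
Variables (R : rcfType) (V : zmodType).
Implicit Types (Q K : V -> R) (x y : V).

Definition posdef Q : Prop := forall s : seq V, psd s (fun x y => Q (x - y)).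

Lemma posdef_ext Q Q' : Q =1 Q' -> posdef Q -> posdef Q'.
Proof. by move=> e h s; apply: eq_psd (h s) => x y _ _; rewrite e. Qed.

Lemma posdef_add Q Q' : posdef Q -> posdef Q' -> posdef (fun x => Q x + Q' x).
Proof. by move=> h h' s; exact: psd_add. Qed.

Lemma posdef_scale c Q : 0 <= c -> posdef Q -> posdef (fun x => c * Q x).
Proof. by move=> c0 h s; exact: psd_scale. Qed.

Lemma posdef_psd (X : eqType) (s : seq X) (f : X -> V) Q :
  posdef Q -> psd s (fun i j : X => Q (f i - f j)).
Proof. by move=> h; exact: psd_map (h _). Qed.

Lemma posdef_sum (J : Type) (t : seq J) (Q : J -> V -> R) :
  (forall j, posdef (Q j)) -> posdef (fun x => \sum_(j <- t) Q j x).
Proof.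
move=> h; elim: t => [|j t IH].
  by move=> s; exists [::] => x y _ _; rewrite !big_nil.
by apply: posdef_ext (posdef_add (h j) IH) => x; rewrite big_cons.
Qed.

(** If the vectors [phi x] represent [Q], then the differences
    [phi x - phi (x + v)] represent its second difference. *)
Lemma posdef_second_difference Q v :
  posdef Q -> posdef (fun x => 2 * Q x - Q (x + v) - Q (x - v)).
Proof.
move=> hQ s; have [l hl] := hQ (s ++ [seq x + v | x <- s]).
exists [seq (fun x => phi x - phi (x + v)) | phi <- l] => x y xs ys.
rewrite big_map.
have mem z : z \in s -> z \in s ++ [seq x + v | x <- s].
  by rewrite mem_cat => ->.
have memv z : z \in s -> z + v \in s ++ [seq x + v | x <- s].
  by move=> zs; rewrite mem_cat (map_f (fun x => x + v) zs) orbT.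
have -> : x - y + v = x + v - y by rewrite addrAC.
have -> : x - y - v = x - (y + v) by rewrite opprD addrA.
have -> : 2 * Q (x - y) = Q (x - y) + Q (x + v - (y + v)).
  by rewrite opprD addrACA subrr addr0 mulr_natl.
rewrite !hl; try by [exact: mem | exact: memv].
under [RHS]eq_bigr => phi _.
  rewrite (_ : _ * _ = phi x * phi y + phi (x + v) * phi (y + v)
    - phi (x + v) * phi y - phi x * phi (y + v)); last ring.
  over.
by rewrite !sumrB big_split.
Qed.

Definition delta x : R := (x == 0)%:R.

Lemma delta_sub x y : delta (x - y) = (x == y)%:R.
Proof. by rewrite /delta subr_eq0. Qed.

(** The quadratic form at [c] is a nonnegative diagonal form plus the sum of
    the [K (u - v) (c u + sigma c v)^2 / 2]. Both signs matter: [sigma = -1]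
    gives a positive definite kernel, [sigma = 1] its domination by a multiple
    of [delta]. *)
Lemma posdef_diagonally_dominant (kappa sigma : R) K :
    sigma ^+ 2 = 1 -> (forall x, 0 <= K x) -> (forall x, K (- x) = K x) ->
    (forall u : seq V, uniq u -> \sum_(x <- u) K x <= kappa) ->
  posdef (fun x => kappa * delta x + sigma * K x).
Proof.
move=> sigma2 K0 Ksym Kle s; set U := undup s.
have U_uniq : uniq U by exact: undup_uniq.
pose slack v := kappa - \sum_(u <- U) K (v - u).
have slack0 v : 0 <= slack v.
  rewrite subr_ge0; have := Kle [seq v - u | u <- U].
  by rewrite big_map; apply; rewrite map_inj_uniq // => a b /addrI /oppr_inj.
pose diag v x := Num.sqrt (slack v) * (x == v)%:R : R.
pose off u v x := Num.sqrt (K (u - v) / 2) * ((x == u)%:R + sigma * (x == v)%:R).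
exists ([seq diag v | v <- U] ++ [seq off u v | u <- U, v <- U]).
move=> x y; rewrite -![_ \in s]mem_undup -/U => xU yU.
have pick (F : V -> R) z : z \in U -> \sum_(v <- U) (z == v)%:R * F v = F z.
  move=> zU; rewrite (bigD1_seq z) //= eqxx mul1r big1 ?addr0 // => v.
  by rewrite eq_sym => /negbTE ->; rewrite mul0r.
rewrite big_cat big_map big_allpairs_dep /= delta_sub.
have -> : \sum_(v <- U) diag v x * diag v y = (x == y)%:R * slack x.
  transitivity (\sum_(v <- U) (x == v)%:R * ((y == v)%:R * slack v)).
    apply: eq_bigr => v _; rewrite /diag mulrACA -expr2 sqr_sqrtr //.
    by rewrite mulrC -mulrA.
  by rewrite pick // eq_sym.
have -> : \sum_(u <- U) \sum_(v <- U) off u v x * off u v y =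
    (x == y)%:R * (\sum_(v <- U) K (x - v)) + sigma * K (x - y).
  transitivity (\sum_(u <- U) \sum_(v <- U)
     ((x == u)%:R * ((y == u)%:R * (K (u - v) / 2))
      + (y == v)%:R * ((x == v)%:R * (K (v - u) / 2))
      + sigma * ((x == u)%:R * ((y == v)%:R * (K (u - v) / 2)))
      + sigma * ((y == u)%:R * ((x == v)%:R * (K (u - v) / 2))))).
    apply: eq_bigr => u _; apply: eq_bigr => v _.
    rewrite /off mulrACA -expr2 sqr_sqrtr ?divr_ge0 ?ler0n //.
    rewrite -(Ksym (v - u)) opprB.
    move: sigma2; rewrite expr2 => s2.
    set a := (x == u)%:R; set b := (x == v)%:R; set c := (y == u)%:R.
    set d := (y == v)%:R; set k := K _ / 2.
    transitivity (k * (a * c) + (sigma * sigma) * (k * (b * d))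
       + sigma * (a * (d * k)) + sigma * (c * (b * k))); first by ring.
    by rewrite s2; ring.
  under eq_bigr do rewrite !big_split /=.
  rewrite !big_split /=.
  have -> : \sum_(u <- U) \sum_(v <- U) (x == u)%:R * ((y == u)%:R * (K (u - v) / 2))
      = (x == y)%:R * \sum_(v <- U) K (x - v) / 2.
    under eq_bigr do under eq_bigr do rewrite mulrA.
    under eq_bigr do rewrite -mulr_sumr -mulrA.
    by rewrite pick // eq_sym.
  have -> : \sum_(u <- U) \sum_(v <- U) (y == v)%:R * ((x == v)%:R * (K (v - u) / 2))
      = (x == y)%:R * \sum_(v <- U) K (x - v) / 2.
    under eq_bigr do rewrite pick //.
    rewrite -mulr_sumr; case: eqVneq => [->//|_]; by rewrite !mul0r.
  have -> : \sum_(u <- U) \sum_(v <- U) sigma * ((x == u)%:R * ((y == v)%:R * (K (u - v) / 2)))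
      = sigma * (K (x - y) / 2).
    under eq_bigr do rewrite -mulr_sumr -mulr_sumr pick //.
    by rewrite -mulr_sumr pick.
  have -> : \sum_(u <- U) \sum_(v <- U) sigma * ((y == u)%:R * ((x == v)%:R * (K (u - v) / 2)))
      = sigma * (K (x - y) / 2).
    under eq_bigr do rewrite -mulr_sumr -mulr_sumr pick //.
    by rewrite -mulr_sumr pick // -(Ksym (y - x)) opprB.
  rewrite -mulr_suml; set A := \sum_(_ <- _) _; by field.
rewrite /slack; ring.
Qed.

Lemma posdef_delta : posdef delta.
Proof.
apply: posdef_ext (@posdef_diagonally_dominant 1 1 (fun=> 0) _ _ _ _) => //.
- by move=> x; rewrite mulr0 addr0 mul1r.
- by rewrite expr1n.
- by move=> u _; rewrite big1 ?ler01.
Qed.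

Section Bounds.
Variable Q : V -> R.
Hypotheses (Q_posdef : posdef Q) (Q_sym : forall x, Q (- x) = Q x).

Lemma posdef_ge0 (J : eqType) (t : seq J) (c : J -> R) (z : J -> V) :
  0 <= \sum_(i <- t) \sum_(j <- t) c i * c j * Q (z i - z j).
Proof. exact: (quadratic_ge0 c (posdef_psd t z Q_posdef)). Qed.

Lemma posdef_le0 x : Q x <= Q 0.
Proof.
have := @posdef_ge0 _ [:: true; false] (fun b => if b then 1 else -1)
          (fun b => if b then x else 0).
rewrite !big_cons !big_nil !subr0 !sub0r !subrr Q_sym; lra.
Qed.

Lemma posdef_ge0_at0 : 0 <= Q 0.
Proof.
have := @posdef_ge0 _ [:: true] (fun=> 1) (fun=> 0).
by rewrite !big_seq1 subrr !mul1r.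
Qed.

(** In the space of translates, [sqrt (2 (Q 0 - Q x))] is the distance from a
    vector to its translate by [x], so this is the triangle inequality. *)
Lemma posdef_sqrt_subadditive x y :
  Num.sqrt (Q 0 - Q (x + y)) <= Num.sqrt (Q 0 - Q x) + Num.sqrt (Q 0 - Q y).
Proof.
pose z (i : 'I_3) := nth 0 [:: 0; x; x + y] i.
have [l hl] := posdef_psd (enum 'I_3) z Q_posdef.
have {}hl i j : Q (z i - z j) = \sum_(phi <- l) phi i * phi j.
  by apply: hl; rewrite mem_enum.
pose o0 : 'I_3 := inord 0; pose o1 : 'I_3 := inord 1; pose o2 : 'I_3 := inord 2.
have z0 : z o0 = 0 by rewrite /z inordK.
have z1 : z o1 = x by rewrite /z inordK.
have z2 : z o2 = x + y by rewrite /z inordK.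
pose a (phi : 'I_3 -> R) := phi o1 - phi o0.
pose c (phi : 'I_3 -> R) := phi o2 - phi o1.
have dist i j : \sum_(phi <- l) (phi i - phi j) ^+ 2 = 2 * (Q 0 - Q (z i - z j)).
  under eq_bigr => phi _.
    rewrite (_ : _ ^+ 2 = phi i * phi i + phi j * phi j
      + (-2) * (phi i * phi j)); last ring.
    over.
  rewrite !big_split /= -mulr_sumr -!hl !subrr; ring.
have ea : \sum_(phi <- l) a phi ^+ 2 = 2 * (Q 0 - Q x).
  by rewrite dist z1 z0 subr0.
have ec : \sum_(phi <- l) c phi ^+ 2 = 2 * (Q 0 - Q y).
  by rewrite dist z2 z1 addrAC subrr add0r.
have eac : \sum_(phi <- l) (a phi + c phi) ^+ 2 = 2 * (Q 0 - Q (x + y)).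
  under eq_bigr do rewrite /a /c addrC addrA subrK.
  by rewrite dist z2 z0 subr0.
have := cauchy_schwarz_sum l a c; rewrite ea ec.
have : 2 * (Q 0 - Q (x + y)) = 2 * (Q 0 - Q x) + 2 * (Q 0 - Q y)
    + 2 * \sum_(phi <- l) a phi * c phi.
  rewrite -eac -ea -ec mulr_sumr -!big_split /=.
  by apply: eq_bigr => phi _; ring.
have : 0 <= Q 0 - Q x by rewrite subr_ge0 posdef_le0.
have : 0 <= Q 0 - Q y by rewrite subr_ge0 posdef_le0.
have : 0 <= Q 0 - Q (x + y) by rewrite subr_ge0 posdef_le0.
move: (Q 0 - Q x) (Q 0 - Q y) (Q 0 - Q (x + y)) (\sum_(_ <- l) _) => X Y Z T.
move=> Z0 Y0 X0 eZ hT.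
have sX := sqr_sqrtr X0; have sY := sqr_sqrtr Y0.
have rX := sqrtr_ge0 X; have rY := sqrtr_ge0 Y.
have TXY : T <= 2 * (Num.sqrt X * Num.sqrt Y).
  have [T0|T0] := leP T 0; first by nra.
  have rhs0 : 0 <= 2 * (Num.sqrt X * Num.sqrt Y) by rewrite !mulr_ge0.
  rewrite -(@ler_pXn2r _ 2) ?nnegrE ?(ltW T0) //.
  by rewrite !exprMn sX sY; nra.
rewrite -(@ler_pXn2r _ 2) ?nnegrE ?sqrtr_ge0 ?addr_ge0 //.
by rewrite sqrrD sX sY sqr_sqrtr //; nra.
Qed.

End Bounds.

End PositiveDefinite.

(** * Words and the expectation over finitely many paths *)

Definition words (T : Type) (s : seq T) (n : nat) : seq (seq T) :=
  iter n (fun ws => [seq x :: w | x <- s, w <- ws]) [:: [::]].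

Section Words.
Variables (T : eqType) (s : seq T).

Lemma mem_words n w :
  (w \in words s n) = (size w == n) && all (fun x => x \in s) w.
Proof.
elim: n w => [|n IH] [|x w] /=; rewrite ?inE //=.
  by apply/negbTE/negP => /allpairsP[[y v]] [].
rewrite eqSS; apply/allpairsP/idP => [[[y v] /= [ys vw [-> ->]]]|].
  by rewrite ys -IH.
by case/and3P => zw xs ws; exists (x, w); rewrite /= xs IH zw.
Qed.

Lemma words_uniq n : uniq s -> uniq (words s n).
Proof.
move=> us; elim: n => //= n IH.
by apply: allpairs_uniq => // -[a b] [c d] _ _ /= [-> ->].
Qed.

Lemma big_wordsS (R : nmodType) n (F : seq T -> R) :
  \sum_(w <- words s n.+1) F w = \sum_(x <- s) \sum_(w <- words s n) F (x :: w).
Proof. by rewrite /= big_allpairs_dep. Qed.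

Lemma expr_sum_words (R : comNzRingType) (F : T -> R) m :
  (\sum_(x <- s) F x) ^+ m = \sum_(w <- words s m) \prod_(x <- w) F x.
Proof.
elim: m => [|m IH]; first by rewrite /= big_seq1 big_nil.
rewrite big_wordsS exprS IH big_distrlr /=.
by apply: eq_bigr => x _; apply: eq_bigr => w _; rewrite big_cons.
Qed.

End Words.

Lemma big_words_unzip (T T' : eqType) (s : seq T) (s' : seq T') (R : nmodType) m
    (G : seq T -> seq T' -> R) :
  \sum_(w <- words [seq (x, x') | x <- s, x' <- s'] m) G (unzip1 w) (unzip2 w) =
  \sum_(w <- words s m) \sum_(w' <- words s' m) G w w'.
Proof.
elim: m G => [|m IH] G; first by rewrite /= !big_seq1.
rewrite big_wordsS big_allpairs_dep [RHS]big_wordsS.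
under [RHS]eq_bigr do under eq_bigr do rewrite big_wordsS.
apply: eq_bigr => x _. rewrite [RHS]exchange_big /=.
by apply: eq_bigr => x' _; rewrite (IH (fun w w' => G (x :: w) (x' :: w'))).
Qed.

Fixpoint sorted_words (n m lo : nat) : seq (seq nat) :=
  if m is m'.+1 then
    [seq j :: w | j <- iota lo (n.+1 - lo), w <- sorted_words n m' j]
  else [:: [::]].

Lemma mem_sorted_words n m lo w :
  (w \in sorted_words n m lo)
    = [&& size w == m, path leq lo w & all (fun j => j <= n)%N w].
Proof.
elim: m lo w => [|m IH] lo [|j w] /=; rewrite ?inE //=.
  by apply/negbTE/negP => /allpairsPdep[k [v []]].
apply/allpairsPdep/idP => [[k [v /= [klo vw [-> ->]]]]|].
  move: klo; rewrite IH mem_iota in vw *; case/andP => lok kn.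
  case/and3P: vw => /eqP -> -> ->; rewrite eqxx lok /= andbT.
  by move: kn; lia.
case/and3P => zw /andP[loj jw] /andP[jn wn]; exists j, w; split => //.
  by rewrite mem_iota loj /=; move: jn loj; lia.
by rewrite IH; move: zw; rewrite eqSS => ->; rewrite jw wn.
Qed.

Lemma count_perm_eq_words (T : eqType) (s : seq T) m (u : seq T) :
  uniq s -> (count (perm_eq u) (words s m) <= m`!)%N.
Proof.
move=> us; rewrite -size_filter.
have [->//|] := eqVneq (seq.filter (perm_eq u) (words s m)) [::].
case e : (seq.filter _ _) => [//|w ws] _; rewrite -e.
have zu : size u = m.
  have : w \in seq.filter (perm_eq u) (words s m) by rewrite e mem_head.
  by rewrite mem_filter mem_words => /and3P[/perm_size -> /eqP ->].
case: u zu {e} => [<-|x0 u zu]; first by rewrite /= /words /=.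
set u0 := x0 :: u in zu *.
have -> : m`! = size [seq map (nth x0 u0) v | v <- permutations (iota 0 m)].
  by rewrite size_map size_permutations ?iota_uniq ?size_iota.
apply: uniq_leq_size; first by rewrite filter_uniq ?words_uniq.
move=> v; rewrite mem_filter perm_sym => /andP[/(perm_iotaP x0)[I pI ->] _].
by apply/mapP; exists I => //; rewrite mem_permutations -zu.
Qed.

(** Each word is sent to its sorted rearrangement; a sorted word is reached at
    most [m!] times. *)
Lemma sum_words_le_sorted (R : realDomainType) n m (F : seq nat -> R) :
    (forall w, 0 <= F w) -> (forall w w', perm_eq w w' -> F w = F w') ->
  \sum_(w <- words (iota 1 n) m) F w
    <= m`!%:R * \sum_(u <- sorted_words n m 0) F u.
Proof.
move=> F0 Fperm.
apply: (@le_trans _ _ (\sum_(w <- words (iota 1 n) m)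
   \sum_(u <- sorted_words n m 0) (perm_eq u w)%:R * F u)).
  rewrite big_seq [leRHS]big_seq; apply: ler_sum => w.
  rewrite mem_words => /andP[/eqP zw /allP ws].
  have sw : sort leq w \in sorted_words n m 0.
    rewrite mem_sorted_words size_sort zw eqxx all_sort /=.
    apply/andP; split; last by apply/allP => j /ws; rewrite mem_iota; lia.
    have := sort_sorted leq_total w.
    by case: (sort leq w) => //= a v ->; rewrite leq0n.
  rewrite (big_rem (sort leq w)) //= perm_sort perm_refl mul1r.
  rewrite (Fperm _ w) ?perm_sort ?perm_refl // lerDl.
  by apply: sumr_ge0 => u _; rewrite mulr_ge0 ?ler0n.
rewrite exchange_big /= mulr_sumr; apply: ler_sum => u _.
rewrite -mulr_suml; apply: ler_wpM2r => //.
have -> : \sum_(w <- words (iota 1 n) m) (perm_eq u w)%:R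
    = (count (perm_eq u) (words (iota 1 n) m))%:R :> R.
  by rewrite -sum1_count natr_sum [RHS]big_mkcond; apply: eq_bigr => w _; case: perm_eq.
by rewrite ler_nat count_perm_eq_words ?iota_uniq.
Qed.

(** * The difference of two independent walks with finitely many steps *)

Section FiniteWalk.
Variables (R : rcfType) (V : zmodType) (L : seq V) (p : V -> R).
Implicit Types (Q : V -> R) (x y : V) (l : seq V).

Definition weight l : R := \prod_(s <- l) p s.

Definition expect (n : nat) (F : seq V -> R) : R :=
  \sum_(l <- words L n) weight l * F l.

Definition position (j : nat) l : V := \sum_(s <- take j l) s.

Lemma expect0 F : expect 0 F = F [::].
Proof. by rewrite /expect /= big_seq1 /weight big_nil mul1r. Qed.

Lemma expectS n F :
  expect n.+1 F = \sum_(s <- L) p s * expect n (fun l => F (s :: l)).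
Proof.
rewrite /expect big_wordsS; apply: eq_bigr => s _.
rewrite mulr_sumr; apply: eq_bigr => l _.
by rewrite /weight big_cons mulrA.
Qed.

Lemma eq_expect n F G : (forall l, l \in words L n -> F l = G l) ->
  expect n F = expect n G.
Proof.
by move=> e; rewrite /expect big_seq [RHS]big_seq; apply: eq_bigr => l /e ->.
Qed.

Lemma expect_sum (J : Type) (t : seq J) n (F : J -> seq V -> R) :
  expect n (fun l => \sum_(j <- t) F j l) = \sum_(j <- t) expect n (F j).
Proof.
rewrite /expect exchange_big /=; apply: eq_bigr => l _.
by rewrite mulr_sumr.
Qed.

Lemma expect_scale c n F : expect n (fun l => c * F l) = c * expect n F.
Proof.
by rewrite /expect mulr_sumr; apply: eq_bigr => l _; rewrite mulrCA.
Qed.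

Lemma expectD n F G : expect n (fun l => F l + G l) = expect n F + expect n G.
Proof.
by rewrite /expect -big_split; apply: eq_bigr => l _; rewrite mulrDr.
Qed.

Definition expect2 n (F : seq V -> seq V -> R) : R :=
  expect n (fun l => expect n (F l)).

Lemma expect2_quadratic n F :
  expect2 n F = quadratic (words L n) weight weight F.
Proof.
rewrite /expect2 /quadratic {1}/expect; apply: eq_bigr => l _.
by rewrite /expect mulr_sumr; apply: eq_bigr => l' _; rewrite mulrA.
Qed.

Lemma expect2_sum (J : Type) (t : seq J) n (F : J -> seq V -> seq V -> R) :
  expect2 n (fun l l' => \sum_(j <- t) F j l l') = \sum_(j <- t) expect2 n (F j).
Proof.
rewrite /expect2 -expect_sum; apply: eq_expect => l _.
by rewrite expect_sum.
Qed.

Lemma expect2_scale c n F :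
  expect2 n (fun l l' => c * F l l') = c * expect2 n F.
Proof.
by rewrite /expect2 -expect_scale; apply: eq_expect => l _; rewrite expect_scale.
Qed.

Lemma expect2D n F G :
  expect2 n (fun l l' => F l l' + G l l') = expect2 n F + expect2 n G.
Proof.
by rewrite /expect2 -expectD; apply: eq_expect => l _; rewrite expectD.
Qed.

Lemma eq_expect2 n F G :
    (forall l l', l \in words L n -> l' \in words L n -> F l l' = G l l') ->
  expect2 n F = expect2 n G.
Proof.
by move=> e; apply: eq_expect => l ln; apply: eq_expect => l' ln'; rewrite e.
Qed.

Hypothesis p_ge0 : forall x, 0 <= p x.
Hypothesis p_sum : \sum_(s <- L) p s = 1.

Lemma weight_ge0 l : 0 <= weight l.
Proof. by apply: prodr_ge0 => s _. Qed.

Lemma expect_cst n c : expect n (fun=> c) = c.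
Proof.
elim: n => [|n IH]; first by rewrite expect0.
by rewrite expectS IH -mulr_suml p_sum mul1r.
Qed.

Lemma le_expect2 n F G :
    (forall l l', l \in words L n -> l' \in words L n -> F l l' <= G l l') ->
  expect2 n F <= expect2 n G.
Proof.
move=> h; rewrite /expect2 /expect big_seq [leRHS]big_seq.
apply: ler_sum => l ln; apply: ler_wpM2l; first exact: weight_ge0.
rewrite big_seq [leRHS]big_seq.
by apply: ler_sum => l' ln'; apply: ler_wpM2l; [exact: weight_ge0|exact: h].
Qed.

Lemma expect2_cst n c : expect2 n (fun _ _ => c) = c.
Proof. by rewrite /expect2 !expect_cst. Qed.

Lemma expect2_ge0 n F : (forall l l', 0 <= F l l') -> 0 <= expect2 n F.
Proof. by move=> h; rewrite -(expect2_cst n 0); apply: le_expect2. Qed.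

Lemma expect2S n F : expect2 n.+1 F =
  \sum_(s <- L) \sum_(s' <- L)
     p s * p s' * expect2 n (fun l l' => F (s :: l) (s' :: l')).
Proof.
rewrite /expect2 expectS; apply: eq_bigr => s _.
under eq_expect do rewrite expectS.
rewrite expect_sum mulr_sumr; apply: eq_bigr => s' _.
by rewrite expect_scale mulrA.
Qed.

(** The transition operator of the difference of two independent copies of
    the walk. *)
Definition transition Q x : R :=
  \sum_(s <- L) \sum_(s' <- L) p s * p s' * Q (x + s - s').

Lemma transition_scale c Q x :
  transition (fun y => c * Q y) x = c * transition Q x.
Proof.
rewrite /transition mulr_sumr; apply: eq_bigr => s _.
by rewrite mulr_sumr; apply: eq_bigr => s' _; rewrite mulrCA.
Qed.

Lemma eq_transition Q Q' : Q =1 Q' -> transition Q =1 transition Q'.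
Proof.
by move=> e x; apply: eq_bigr => s _; apply: eq_bigr => s' _; rewrite e.
Qed.

Lemma eq_iter_transition i Q Q' :
  Q =1 Q' -> iter i transition Q =1 iter i transition Q'.
Proof. by elim: i => //= i IH e; apply: eq_transition; exact: IH. Qed.

Lemma iter_transition_scale i c Q x :
  iter i transition (fun y => c * Q y) x = c * iter i transition Q x.
Proof.
elim: i x => //= i IH x; rewrite (eq_transition IH).
exact: transition_scale.
Qed.

(** Averaging the vectors that represent [Q] over one step of the walk gives
    vectors that represent [transition Q]. *)
Lemma posdef_transition Q : posdef Q -> posdef (transition Q).
Proof.
move=> hQ s.
have [l hl] := posdef_psd [seq (x, u) | x <- s, u <- L]
                 (fun z => z.1 + z.2) hQ.
exists [seq (fun x => \sum_(u <- L) p u * phi (x, u)) | phi <- l].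
move=> x y xs ys; rewrite big_map.
under [RHS]eq_bigr do rewrite big_distrlr /=.
rewrite exchange_big /= /transition big_seq [RHS]big_seq.
apply: eq_bigr => u uL.
rewrite exchange_big /= big_seq [RHS]big_seq.
apply: eq_bigr => v vL.
rewrite (_ : x - y + u - v = x + u - (y + v)); last first.
  by rewrite opprD addrACA addrA.
rewrite (hl (x, u) (y, v)) ?allpairs_f // mulr_sumr.
by apply: eq_bigr => phi _; rewrite mulrACA.
Qed.

Lemma posdef_iter_transition i Q : posdef Q -> posdef (iter i transition Q).
Proof. by move=> h; elim: i => //= i; exact: posdef_transition. Qed.

(** The probability that the difference walk started at [x] is at 0 after [i]
    steps. By [heat_sym] this is also the law of the walk started at 0. *)
Definition heat i : V -> R := iter i transition (@delta R V).

Lemma heat_posdef i : posdef (heat i).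
Proof. exact/posdef_iter_transition/posdef_delta. Qed.

Lemma heat_ge0 i x : 0 <= heat i x.
Proof.
elim: i x => [|i IH] x; first by rewrite /heat /= /delta ler0n.
by apply: sumr_ge0 => s _; apply: sumr_ge0 => s' _; rewrite !mulr_ge0.
Qed.

Lemma transition_sym Q :
  (forall x, Q (- x) = Q x) -> forall x, transition Q (- x) = transition Q x.
Proof.
move=> Qsym x; rewrite /transition exchange_big /=.
apply: eq_bigr => s _; apply: eq_bigr => s' _.
by rewrite (mulrC (p s')) -Qsym !opprD !opprK addrAC.
Qed.

Lemma heat_sym i x : heat i (- x) = heat i x.
Proof.
elim: i x => [|i IH] x; first by rewrite /heat /= /delta oppr_eq0.
exact: transition_sym.
Qed.

Lemma heat_le0 i x : heat i x <= heat i 0.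
Proof. exact: posdef_le0 (heat_posdef i) (heat_sym i) x. Qed.

Lemma sum_pp : \sum_(s <- L) \sum_(s' <- L) p s * p s' = 1.
Proof. by rewrite -big_distrlr /= p_sum mulr1. Qed.

Lemma sum_heat_le1 i (U : seq V) : uniq U -> \sum_(u <- U) heat i u <= 1.
Proof.
elim: i U => [|i IH] U uU.
  rewrite /heat /= /delta.
  have [U0|U0] := boolP (0 \in U).
    rewrite (bigD1_seq 0) //= eqxx big1 ?addr0 // => x /negbTE -> //.
  rewrite big_seq big1 ?ler01 // => x xU.
  by case: eqP xU U0 => // -> ->.
rewrite /heat /= /transition exchange_big /= -sum_pp.
apply: ler_sum => s _; rewrite exchange_big /=; apply: ler_sum => s' _.
rewrite -mulr_sumr ler_piMr ?mulr_ge0 //.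
have := IH [seq u + s - s' | u <- U].
rewrite big_map; apply; rewrite map_inj_uniq // => u v.
by move/addIr/addIr.
Qed.

Lemma heat0_le1 i : heat i 0 <= 1.
Proof. by have := @sum_heat_le1 i [:: 0] isT; rewrite big_seq1. Qed.

(** The law is finitely supported. Any larger list is allowed for [W] so that
    the sum may be compared with sums over other finite sets. *)
Lemma iter_transition_heat i : exists U : seq V, uniq U /\
  forall (W : seq V) Q, uniq W -> {subset U <= W} ->
    iter i transition Q 0 = \sum_(u <- W) heat i u * Q u.
Proof.
pose rep i (t : seq (R * V)) := forall Q x,
  iter i transition Q x = \sum_(a <- t) a.1 * Q (x + a.2).
have [t ht] : exists t, rep i t.
  elim: i => [|i [t ht]].
    by exists [:: (1, 0)] => Q x; rewrite big_seq1 /= mul1r addr0.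
  exists [seq (p z.1 * p z.2 * a.1, z.1 - z.2 + a.2)
          | z <- [seq (s, s') | s <- L, s' <- L], a <- t] => Q x.
  rewrite big_allpairs_dep big_allpairs_dep /= /transition.
  apply: eq_bigr => s _; apply: eq_bigr => s' _ /=.
  rewrite ht mulr_sumr; apply: eq_bigr => a _.
  by rewrite mulrA !addrA.
exists (undup [seq a.2 | a <- t]); split; first exact: undup_uniq.
move=> W Q uW UW.
transitivity (\sum_(u <- W) heat i (- u) * Q u); last first.
  by apply: eq_bigr => u _; rewrite heat_sym.
rewrite /heat ht.
under [RHS]eq_bigr do rewrite ht mulr_suml.
rewrite exchange_big /= big_seq [RHS]big_seq; apply: eq_bigr => a at'.
have aW : a.2 \in W by apply: UW; rewrite mem_undup map_f.
rewrite (bigD1_seq a.2) //= addNr /delta eqxx mulr1 add0r.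
rewrite big1 ?addr0 // => u ua.
by rewrite addrC subr_eq0 eq_sym (negbTE ua) mulr0 mul0r.
Qed.

(** The expectation of a product of functions of the difference walk at the
    times listed in [t], for a walk at [x] at time [r]. *)
Fixpoint markov (r : nat) (t : seq (nat * (V -> R))) : V -> R :=
  if t is a :: t' then
    iter (a.1 - r) transition (fun x => a.2 x * markov a.1 t' x)
  else fun=> 1.

(** The Markov property: conditionally on the first step, the two walks start
    afresh at time [r.+1] with the difference moved by that step. *)
Lemma expect2_markov n r t x :
    path leq r [seq a.1 | a <- t] -> all (fun a => a.1 <= n + r)%N t ->
  expect2 n (fun l l' => \prod_(a <- t)
      a.2 (x + position (a.1 - r) l - position (a.1 - r) l')) = markov r t x.
Proof.
elim: n r t x => [|n IHn] r t x; elim: t => [|[j Q] t IHt] /=;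
  try by under eq_expect2 do rewrite big_nil; rewrite expect2_cst.
all: case/andP => rj jt /andP[jn tn].
all: have [ejr|ne] := eqVneq j r.
- subst r; rewrite subnn /= -IHt ?add0n // -expect2_scale.
  by apply: eq_expect2 => l l' _ _; rewrite big_cons /= subnn /position !take0
    !big_nil subr0 addr0.
- by move: jn rj ne; rewrite add0n; lia.
- subst r; rewrite subnn /= -IHt // -expect2_scale.
  by apply: eq_expect2 => l l' _ _; rewrite big_cons /= subnn /position !take0
    !big_nil subr0 addr0.
have rj' : (r < j)%N by lia.
rewrite expect2S (_ : (j - r)%N = (j - r.+1).+1); last by lia.
rewrite /= /transition; apply: eq_bigr => s _; apply: eq_bigr => s' _.
congr (_ * _).
have tn' : all (fun a => a.1 <= n + r.+1)%N ((j, Q) :: t).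
  by rewrite addnS -addSn /= jn.
have jt' : path leq r.+1 [seq a.1 | a <- (j, Q) :: t] by rewrite /= rj' jt.
rewrite -[RHS]/(markov r.+1 ((j, Q) :: t) (x + s - s')) -IHn //.
apply: eq_expect2 => l l' _ _.
have : all (fun a => r < a.1)%N ((j, Q) :: t).
  rewrite /= rj' /=; have := order_path_min leq_trans jt; rewrite all_map.
  by apply: sub_all => a /=; exact: leq_trans.
elim: (_ :: t) => [|a u IHu]; first by rewrite !big_nil.
case/andP => ra ur; rewrite !big_cons IHu //; congr (a.2 _ * _).
rewrite (_ : (a.1 - r)%N = (a.1 - r.+1).+1); last by lia.
rewrite /position /= !big_cons opprD !addrA; congr (_ - _).
by rewrite addrAC.
Qed.

End FiniteWalk.

(** * Heat kernel bounds *)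

Section HeatDecay.
Variables (R : rcfType) (V : zmodType) (L : seq V) (p : V -> R).
Hypothesis p_ge0 : forall x, 0 <= p x.
Hypothesis p_sum : \sum_(s <- L) p s = 1.
Local Notation hk := (heat L p).

Definition heat_drop k : R := hk k 0 - hk k.+1 0.

(** The defect [hk k 0 - hk k x] is half the squared distance between the
    law of the walk after [k] steps and its translate by [x]. *)
Definition heat_defect k x : R := hk k 0 - hk k x.

Lemma heat_defect_ge0 k x : 0 <= heat_defect k x.
Proof. by rewrite subr_ge0 heat_le0. Qed.

(** The drop is the Dirichlet form of the walk. *)
Lemma heat_drop_defect k : heat_drop k =
  \sum_(s <- L) \sum_(s' <- L) p s * p s' * heat_defect k (s - s').
Proof.
rewrite /heat_drop /heat_defect.
under [RHS]eq_bigr do under eq_bigr do rewrite mulrBr.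
under [RHS]eq_bigr do rewrite sumrB -mulr_suml.
rewrite sumrB -mulr_suml sum_pp // mul1r; congr (_ - _).
by apply: eq_bigr => s _; apply: eq_bigr => s' _; rewrite add0r.
Qed.

Lemma heat_drop_ge0 k : 0 <= heat_drop k.
Proof.
rewrite heat_drop_defect; apply: sumr_ge0 => s _; apply: sumr_ge0 => s' _.
by rewrite !mulr_ge0 // heat_defect_ge0.
Qed.

Lemma heat_defect_le_drop k s s' : s \in L -> s' \in L ->
  p s * p s' * heat_defect k (s - s') <= heat_drop k.
Proof.
move=> sL s'L; have term_ge0 u u' : 0 <= p u * p u' * heat_defect k (u - u').
  by rewrite !mulr_ge0 // heat_defect_ge0.
rewrite heat_drop_defect (big_rem s) //= (big_rem s') //= -addrA lerDl.
apply: addr_ge0; apply: sumr_ge0 => u _ //.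
by apply: sumr_ge0 => u' _.
Qed.

(** The drop is the value at [0] of [heat k - heat k.+1], which is itself
    positive definite and so is largest at [0]. *)
Lemma heat_drop_decreasing k : heat_drop k.+1 <= heat_drop k.
Proof.
pose D x := hk k x - hk k.+1 x.
have D_posdef : posdef D.
  apply: posdef_ext (posdef_scale (c := 2^-1) _ (posdef_sum
    [seq (s, s') | s <- L, s' <- L] (Q := fun z x => p z.1 * p z.2 *
      (2 * hk k x - hk k (x + (z.1 - z.2)) - hk k (x - (z.1 - z.2)))) _)).
  - move=> x; rewrite big_allpairs_dep /=.
    under eq_bigr do under eq_bigr do rewrite 2!mulrBr.
    under eq_bigr do rewrite 2!sumrB -mulr_suml.
    rewrite 2!sumrB -mulr_suml sum_pp // mul1r /D.
    have -> : \sum_(s <- L) \sum_(s' <- L) p s * p s' * hk k (x + (s - s')) =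
        hk k.+1 x.
      by apply: eq_bigr => s _; apply: eq_bigr => s' _; rewrite addrA.
    have -> : \sum_(s <- L) \sum_(s' <- L) p s * p s' * hk k (x - (s - s')) =
        hk k.+1 x.
      rewrite exchange_big; apply: eq_bigr => s _; apply: eq_bigr => s' _.
      by rewrite opprB addrA (mulrC (p s')).
    by field.
  - by rewrite invr_ge0.
  - move=> z; apply: posdef_scale; first by rewrite mulr_ge0.
    exact/posdef_second_difference/heat_posdef.
have D_sym x : D (- x) = D x by rewrite /D !heat_sym.
have -> : heat_drop k.+1 = transition L p D 0.
  rewrite /transition /D.
  under eq_bigr do under eq_bigr do rewrite mulrBr.
  by under eq_bigr do rewrite sumrB; rewrite sumrB.
rewrite -[leRHS]mul1r -(sum_pp p_sum) mulr_suml; apply: ler_sum => s _.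
rewrite mulr_suml; apply: ler_sum => s' _; rewrite ler_wpM2l ?mulr_ge0 //.
exact: posdef_le0.
Qed.

Lemma heat_defect_sub k x y :
  heat_defect k (x - y) <= 2 * heat_defect k x + 2 * heat_defect k y.
Proof.
have E0 := heat_defect_ge0 k.
have := posdef_sqrt_subadditive (heat_posdef L p k) (heat_sym L p k) x (- y).
rewrite -!/(heat_defect _ _) => h.
have ey : heat_defect k (- y) = heat_defect k y by rewrite /heat_defect heat_sym.
rewrite ey in h.
have sq := sqr_sqrtr (E0 _).
rewrite -(sq (x - y)) -(sq x) -(sq y).
have := sqrtr_ge0 (heat_defect k (x - y)); move: h.
set a := Num.sqrt (heat_defect k (x - y)).
set b := Num.sqrt (heat_defect k x); set c := Num.sqrt (heat_defect k y).
move=> h a0; have := sqr_ge0 (b - c).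
have : a ^+ 2 <= (b + c) ^+ 2 by rewrite ler_pXn2r ?nnegrE //; lra.
by rewrite sqrrB sqrrD; lra.
Qed.

End HeatDecay.

Section HeatDecayZ2.
Variables (R : archiRcfType) (L : seq (int * int)) (p : int * int -> R).
Hypothesis p_ge0 : forall x, 0 <= p x.
Hypothesis p_sum : \sum_(s <- L) p s = 1.
Local Notation hk := (heat L p).
Local Notation defect := (heat_defect L p).

Definition l1norm (x : int * int) : nat := (`|x.1| + `|x.2|)%N.

(** Translations by the unit vectors are controlled by the drop, that is by the
    Dirichlet form; the constant [C] is all that the estimates retain from the
    distribution of the steps. *)
Variable C : R.
Hypotheses (C_ge0 : 0 <= C)
  (defect_e1 : forall k, defect k (1, 0) <= C * heat_drop L p k)
  (defect_e2 : forall k, defect k (0, 1) <= C * heat_drop L p k).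

Lemma sqrt_defect_add k x y :
  Num.sqrt (defect k (x + y)) <= Num.sqrt (defect k x) + Num.sqrt (defect k y).
Proof. exact: posdef_sqrt_subadditive (heat_posdef L p k) (heat_sym L p k) x y. Qed.

Lemma sqrt_defect_line k (v : int -> int * int) (m : int) :
    (forall a b, v (a + b) = v a + v b) ->
  Num.sqrt (defect k (v m)) <= `|m|%:R * Num.sqrt (defect k (v 1)).
Proof.
move=> vD; have v0 : v 0 = 0.
  by apply: (addIr (v 0)); rewrite -vD !add0r.
have nat_case (i : nat) :
    Num.sqrt (defect k (v i)) <= i%:R * Num.sqrt (defect k (v 1)).
  elim: i => [|i IH].
    by rewrite v0 /heat_defect subrr sqrtr0 mul0r.
  rewrite -[X in X%:R]addn1 natrD mulrDl mul1r -addn1 PoszD vD.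
  by apply: le_trans (sqrt_defect_add _ _ _) _; rewrite lerD2r.
case: m => i //; have -> : v (Negz i) = - v i.+1.
  by apply: (addIr (v i.+1)); rewrite -vD NegzE !addNr.
by rewrite /heat_defect heat_sym; exact: nat_case.
Qed.

(** The square root of the defect is subadditive, and [x] is reached by
    [l1norm x] unit vectors. *)
Lemma defect_le_l1norm k x :
  defect k x <= C * (l1norm x)%:R ^+ 2 * heat_drop L p k.
Proof.
have CD0 : 0 <= C * heat_drop L p k by rewrite mulr_ge0 // heat_drop_ge0.
have E0 := heat_defect_ge0 L p k.
set r := Num.sqrt (C * heat_drop L p k).
have [x1 x2] : Num.sqrt (defect k (x.1, 0)) <= `|x.1|%:R * r /\
    Num.sqrt (defect k (0, x.2)) <= `|x.2|%:R * r.
  split.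
    apply: le_trans (@sqrt_defect_line k (fun m => (m, 0)) x.1 _) _ => //.
    by rewrite ler_wpM2l // ler_wsqrtr.
  apply: le_trans (@sqrt_defect_line k (fun m => (0, m)) x.2 _) _ => //.
  by rewrite ler_wpM2l // ler_wsqrtr.
have : Num.sqrt (defect k x) <= (l1norm x)%:R * r.
  have -> : x = (x.1, 0) + (0, x.2) by case: x {x1 x2} => a b; congr pair; rewrite /= ?addr0 ?add0r.
  apply: le_trans (sqrt_defect_add _ _ _) _.
  rewrite /l1norm /= ?addr0 ?add0r natrD mulrDl; exact: lerD.
move=> h; rewrite -(sqr_sqrtr (E0 x)) mulrAC -(sqr_sqrtr CD0) -exprMn mulrC.
by rewrite ler_pXn2r ?nnegrE ?sqrtr_ge0 ?mulr_ge0 ?sqrtr_ge0 // mulrC.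
Qed.

(** Nash's inequality. On a square of side [l] the heat kernel differs from its
    value at 0 by at most [4 C l^2] times the drop, while its values add up to
    at most 1; the best [l] is of order [1 / sqrt (h k 0)]. *)
Lemma heat_drop_ge_sqr k : hk k 0 ^+ 2 <= 64 * C * heat_drop L p k.
Proof.
set a := hk k 0; set D := heat_drop L p k.
have D0 : 0 <= D by exact: heat_drop_ge0.
have [->|a_neq0] := eqVneq a 0; first by rewrite expr0n !mulr_ge0.
have a0 : 0 < a by rewrite lt_def a_neq0 heat_ge0.
have a1 : a <= 1 by exact: heat0_le1.
have square (l : nat) : l%:R ^+ 2 * a <= 1 + 4 * C * l%:R ^+ 4 * D.
  pose box := [seq (i, j) | i <- iota 0 l, j <- iota 0 l].
  pose z (b : nat * nat) : int * int := (b.1 : int, b.2 : int).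
  have box_size : \sum_(b <- box) (1 : R) = l%:R ^+ 2.
    by rewrite big_const_seq count_predT size_allpairs !size_iota iter_addr_0
      natrM expr2.
  have ub : uniq [seq z b | b <- box].
    rewrite map_inj_uniq; last by move=> [i j] [i' j'] /= [-> ->].
    by apply: allpairs_uniq; rewrite ?iota_uniq // => -[i j] [i' j'] _ _ /= [-> ->].
  have := sum_heat_le1 p_ge0 p_sum k ub; rewrite big_map => sum1.
  rewrite -box_size mulr_suml.
  have -> : \sum_(b <- box) 1 * a
      = \sum_(b <- box) hk k (z b) + \sum_(b <- box) defect k (z b).
    by rewrite -big_split; apply: eq_bigr => b _; rewrite /= /heat_defect mul1r addrC subrK.
  apply: lerD => //.
  have -> : 4 * C * l%:R ^+ 4 * D = \sum_(b <- box) 4 * C * l%:R ^+ 2 * D.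
    under eq_bigr do rewrite -[_ * D]mul1r.
    by rewrite -mulr_suml box_size; ring.
  rewrite big_seq [leRHS]big_seq; apply: ler_sum => b.
  case/allpairsP => -[i j] /= [+ + ->]; rewrite !mem_iota !add0n /= => il jl.
  apply: le_trans (defect_le_l1norm _ _) _; rewrite -/D ler_wpM2r //.
  rewrite (mulrC 4) -mulrA ler_wpM2l // (_ : 4 * _ = (2 * l%:R) ^+ 2); last by ring.
  rewrite ler_pXn2r ?nnegrE ?mulr_ge0 // /l1norm /= -natrM ler_nat.
  by move: il jl; lia.
set r := Num.sqrt (2 / a).
have ra : r ^+ 2 = 2 / a by rewrite sqr_sqrtr // divr_ge0 // ltW.
have ra' : r ^+ 2 * a = 2 by rewrite ra divfK.
have r1 : 1 <= r.
  rewrite -(@ler_pXn2r _ 2) ?nnegrE ?sqrtr_ge0 // expr1n ra.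
  by rewrite ler_pdivlMr // mul1r; lra.
(* the side is the least integer at least sqrt (2 / a) *)
pose l := (Num.truncn r).+1.
have [l_lo l_hi] : r <= l%:R /\ l%:R <= 2 * r.
  have /andP[h1 h2] := truncn_itv (sqrtr_ge0 (2 / a)).
  rewrite -/r in h1 h2; split; first exact: ltW.
  by rewrite /l -addn1 natrD; lra.
have := square l; set x : R := l%:R in l_lo l_hi *.
have x2_lo : r ^+ 2 <= x ^+ 2 by rewrite ler_pXn2r ?nnegrE //; lra.
have x2_hi : x ^+ 2 <= 4 * r ^+ 2.
  rewrite (_ : 4 * r ^+ 2 = (2 * r) ^+ 2); last by ring.
  by rewrite ler_pXn2r ?nnegrE //; lra.
have CD0 : 0 <= C * D by rewrite mulr_ge0.
rewrite (_ : x ^+ 4 = x ^+ 2 * x ^+ 2); last by ring.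
move=> h.
have x20 : 0 < x ^+ 2 by rewrite exprn_gt0 //; lra.
have xa2 : 2 <= x ^+ 2 * a by rewrite -ra' ler_pM2r.
have h1 : x ^+ 2 * a <= x ^+ 2 * (8 * (C * D) * x ^+ 2) by lra.
rewrite ler_pM2l // in h1.
have h2 : 8 * (C * D) * x ^+ 2 <= 8 * (C * D) * (4 * r ^+ 2).
  by rewrite ler_wpM2l // mulr_ge0.
have := ler_wpM2r (ltW a0) (le_trans h1 h2).
have -> : 8 * (C * D) * (4 * r ^+ 2) * a = 32 * (C * D) * (r ^+ 2 * a) by ring.
by rewrite ra' expr2; lra.
Qed.

(** By Nash's inequality [u = h k 0] obeys [u' <= u - u^2 / B], and the
    solutions of this recursion decay like [B / k]. *)
Lemma heat0_le k : hk k 0 <= (64 * C + 2) / k.+1%:R.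
Proof.
set B := 64 * C + 2; have B2 : 2 <= B by rewrite /B; move: C_ge0; lra.
have step j : B * hk j.+1 0 <= B * hk j 0 - hk j 0 ^+ 2.
  have := heat_drop_ge_sqr j; have := heat_drop_ge0 p_ge0 p_sum j.
  by rewrite /heat_drop /B; lra.
elim: k => [|[|k] IH].
- by rewrite divr1 (_ : hk 0 0 = 1) ?(le_trans _ B2) ?ler1n // /heat /= /delta eqxx.
- have : hk 1 0 <= 1 by exact: heat0_le1.
  by move/le_trans; apply; rewrite ler_pdivlMr //; lra.
have := step k.+1; have := heat_ge0 L p_ge0 k.+1 0.
move: IH; set u := hk k.+1 0; set v := hk k.+2 0.
set t : R := k.+2%:R.
have t2 : 2 <= t by rewrite /t ler_nat.
have -> : k.+3%:R = t + 1 :> R by rewrite /t -natr1.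
rewrite !ler_pdivlMr; [|lra..] => ut u0 uv.
(* u - u^2 / B is increasing in u up to B / 2 *)
have h : 0 <= (B - u * t) * (B * (t - 1) - u * t) by rewrite mulr_ge0 ?subr_ge0 //; nra.
have : B * v * t ^+ 2 <= (B * u - u ^+ 2) * t ^+ 2 by rewrite ler_wpM2r // sqr_ge0.
have : (B * u - u ^+ 2) * t ^+ 2 <= B ^+ 2 * (t - 1) by nra.
move=> h1 h2.
have h3 : B * (v * t ^+ 2) <= B * (B * (t - 1)) by lra.
rewrite ler_pM2l in h3; last by lra.
have [v0|v0] := leP v 0; first by nra.
nra.
Qed.

(** The drops decrease, and those at the times from [k / 2] to [k] add up to at
    most [h (k / 2) 0]. *)
Lemma heat_drop_le k : heat_drop L p k <= 4 * (64 * C + 2) / k.+1%:R ^+ 2.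
Proof.
set B := 64 * C + 2; have B2 : 2 <= B by rewrite /B; move: C_ge0; lra.
have D0 := heat_drop_ge0 p_ge0 p_sum.
pose h := k./2.
have mono i : (i <= k)%N -> heat_drop L p k <= heat_drop L p i.
  elim: k {h} => [|m IH]; first by rewrite leqn0 => /eqP ->.
  rewrite leq_eqVlt => /predU1P[-> //|/IH]; apply: le_trans.
  exact: heat_drop_decreasing.
have low : (k.+1 - h)%:R * heat_drop L p k <= hk h 0.
  apply: le_trans (_ : hk h 0 - hk k.+1 0 <= _); last first.
    by rewrite gerBl heat_ge0.
  rewrite -[leRHS]opprB -(telescope_sumr (fun i => hk i 0)); last by rewrite /h; lia.
  rewrite -sumrN mulr_natl -sumr_const_nat big_nat [leRHS]big_nat.
  by apply: ler_sum => i /andP[_ ik]; rewrite opprB mono.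
have hB := heat0_le h.
have e1 : (k.+1)%:R <= 2 * (k.+1 - h)%:R :> R by rewrite -natrM ler_nat /h; lia.
have e2 : (k.+1)%:R <= 2 * h.+1%:R :> R by rewrite -natrM ler_nat /h; lia.
have k0 : (0 : R) < k.+1%:R by rewrite ltr0n.
have h0 : (0 : R) < h.+1%:R by rewrite ltr0n.
rewrite ler_pdivlMr ?exprn_gt0 //; rewrite ler_pdivlMr // -/B in hB.
have hh0 := heat_ge0 L p_ge0 h 0; have D1 := D0 k.
set D := heat_drop L p k in low D1 *; set w := hk h 0 in low hB hh0 *.
set K : R := k.+1%:R in e1 e2 k0 *.
set M : R := (k.+1 - h)%:R in e1 low *; set H : R := h.+1%:R in e2 hB h0 *.
have DK : D * K <= 2 * w.
  have := ler_wpM2l D1 e1; move: low; lra.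
have := ler_wpM2r (ltW k0) DK; have := ler_wpM2l hh0 e2.
move: hB; rewrite expr2; lra.
Qed.

Lemma heat_defect_le k x :
  defect k x <= 4 * C * (64 * C + 2) * (l1norm x)%:R ^+ 2 / k.+1%:R ^+ 2.
Proof.
apply: le_trans (defect_le_l1norm _ _) _.
have CN : 0 <= C * (l1norm x)%:R ^+ 2 by rewrite mulr_ge0 ?exprn_ge0.
apply: le_trans (ler_wpM2l CN (heat_drop_le k)) _.
rewrite le_eqVlt; apply/orP; left; apply/eqP; ring.
Qed.

End HeatDecayZ2.

(** * Moments of a pair functional of two independent walks *)

Section Moments.
Variables (R : rcfType) (V : zmodType) (L : seq V) (p : V -> R).
Hypothesis p_ge0 : forall x, 0 <= p x.
Hypothesis p_sum : \sum_(s <- L) p s = 1.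
Local Notation hk := (heat L p).
Local Notation E2 := (expect2 L p).

Lemma expect2_swap n F : E2 n F = E2 n (fun l l' => F l' l).
Proof.
rewrite !expect2_quadratic /quadratic exchange_big /=.
by apply: eq_bigr => l _; apply: eq_bigr => l' _; rewrite (mulrC (weight p l)).
Qed.

Lemma expect2_sqr_le n F : E2 n F ^+ 2 <= E2 n (fun l l' => F l l' ^+ 2).
Proof.
set c := E2 n F.
have : 0 <= E2 n (fun l l' => (F l l' - c) ^+ 2).
  by apply: expect2_ge0 => // l l'; exact: sqr_ge0.
rewrite (@eq_expect2 R V L p n _ (fun l l' => F l l' ^+ 2 + ((- 2 * c) * F l l' + c ^+ 2))).
  by rewrite !expect2D expect2_scale expect2_cst // -/c; lra.
by move=> l l' _ _; ring.
Qed.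

Variable (Q : V -> R) (rho : R).
Hypotheses (Q_posdef : posdef Q) (rho_ge0 : 0 <= rho)
  (Q_le_rho : posdef (fun x => rho * delta R x - Q x)).

(** The squared norm, in the tensor power of the Hilbert space of [Q], of the
    joint law of the walk at the times listed in [I]. *)
Definition tensor_norm n (I : seq nat) : R :=
  E2 n (fun l l' => \prod_(i <- I) Q (position i l - position i l')).

Lemma tensor_norm_ge0 n I : 0 <= tensor_norm n I.
Proof.
rewrite /tensor_norm expect2_quadratic; apply: quadratic_ge0.
by apply: psd_prod => i; exact: posdef_psd.
Qed.

Lemma tensor_norm_perm n I J : perm_eq I J -> tensor_norm n I = tensor_norm n J.
Proof.
by move=> IJ; apply: eq_expect2 => l l' _ _; exact: perm_big.
Qed.

(** Cauchy-Schwarz between the law of the first walk at the times [unzip1 t]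
    and the law of the second walk, translated by [y], at [unzip2 t]. *)
Lemma expect2_prod_le n (t : seq (nat * nat)) y :
  E2 n (fun l l' => \prod_(a <- t) Q (position a.2 l' - position a.1 l + y))
    <= Num.sqrt (tensor_norm n (unzip1 t)) * Num.sqrt (tensor_norm n (unzip2 t)).
Proof.
pose place (a : nat * nat) (z : bool * seq V) :=
  if z.1 then position a.2 z.2 + y else position a.1 z.2.
pose M z z' := \prod_(a <- t) Q (place a z - place a z').
pose s := [seq (b, l) | b <- [:: true; false], l <- words L n].
pose c b (z : bool * seq V) := (z.1 == b)%:R * weight p z.2.
have quadE b b' : quadratic s (c b) (c b') M
    = E2 n (fun l l' => M (b, l) (b', l')).
  rewrite expect2_quadratic /quadratic /s big_allpairs_dep.
  have pick (F : bool -> R) e : \sum_(i <- [:: true; false]) (i == e)%:R * F i = F e.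
    by rewrite !big_cons big_nil; case: e; rewrite /= ?mul1r ?mul0r ?addr0 ?add0r.
  transitivity (\sum_(i <- [:: true; false]) (i == b)%:R *
     (\sum_(l <- words L n) \sum_(l' <- words L n)
        weight p l * weight p l' * M (i, l) (b', l'))); last by rewrite pick.
  apply: eq_bigr => i _; rewrite mulr_sumr; apply: eq_bigr => l _.
  rewrite big_allpairs_dep.
  transitivity (\sum_(i' <- [:: true; false]) (i' == b')%:R * ((i == b)%:R *
     \sum_(l' <- words L n) weight p l * weight p l' * M (i, l) (i', l')));
    last by rewrite pick.
  apply: eq_bigr => i' _; rewrite !mulr_sumr; apply: eq_bigr => l' _.
  by rewrite /c /=; ring.
have M_psd : psd s M by apply: psd_prod => a; exact: posdef_psd.
have := quadratic_cauchy_schwarz (c true) (c false) M_psd.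
rewrite !quadE => h.
have e1 : E2 n (fun l l' => M (true, l) (false, l')) =
    E2 n (fun l l' => \prod_(a <- t) Q (position a.2 l' - position a.1 l + y)).
  rewrite expect2_swap; apply: eq_expect2 => l l' _ _; apply: eq_bigr => a _.
  by rewrite /place /= addrAC.
have e2 : E2 n (fun l l' => M (true, l) (true, l')) = tensor_norm n (unzip2 t).
  apply: eq_expect2 => l l' _ _; rewrite big_map; apply: eq_bigr => a _.
  by rewrite /place /= opprD addrACA subrr addr0.
have e3 : E2 n (fun l l' => M (false, l) (false, l')) = tensor_norm n (unzip1 t).
  by apply: eq_expect2 => l l' _ _; rewrite big_map; apply: eq_bigr => a _.
rewrite e1 e2 e3 in h.
apply: le_trans (ler_norm _) _; rewrite -sqrtr_sqr.
apply: le_trans (ler_wsqrtr h) _.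
by rewrite sqrtrM ?tensor_norm_ge0 // mulrC.
Qed.

Definition pair_functional n y (l l' : seq V) : R :=
  \sum_(i <- iota 1 n) \sum_(j <- iota 1 n) Q (position j l' - position i l + y).

(** After expansion of the power, [expect2_prod_le] makes the sum over the
    words of times of the first walk and that over those of the second walk
    independent; each may be restricted to sorted words, since the norm does
    not depend on the order of the times. *)
Lemma moment_le_sorted n m y :
  E2 n (fun l l' => pair_functional n y l l' ^+ m) <=
  (m`!%:R * \sum_(u <- sorted_words n m 0) Num.sqrt (tensor_norm n u)) ^+ 2.
Proof.
apply: (@le_trans _ _ ((\sum_(w <- words (iota 1 n) m)
    Num.sqrt (tensor_norm n w)) ^+ 2)); last first.
  rewrite ler_pXn2r ?nnegrE //.
  - apply: sum_words_le_sorted => [w|w w' ww']; first exact: sqrtr_ge0.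
    by rewrite (tensor_norm_perm n ww').
  - by apply: sumr_ge0 => w _; exact: sqrtr_ge0.
  - by apply: mulr_ge0 => //; apply: sumr_ge0 => w _; exact: sqrtr_ge0.
pose pairs := [seq (i, j) | i <- iota 1 n, j <- iota 1 n].
rewrite (@eq_expect2 R V L p n _ (fun l l' => \sum_(t <- words pairs m)
   \prod_(a <- t) Q (position a.2 l' - position a.1 l + y))); last first.
  move=> l l' _ _; rewrite -expr_sum_words /pairs big_allpairs_dep.
  by [].
rewrite expect2_sum expr2 big_distrlr /=.
rewrite -(@big_words_unzip _ _ (iota 1 n) (iota 1 n) R m
  (fun w w' => Num.sqrt (tensor_norm n w) * Num.sqrt (tensor_norm n w'))).
by apply: ler_sum => t _; exact: expect2_prod_le.
Qed.

(** The contribution of two successive gaps [i] and [i'], when the difference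
    walk goes from [0] back to [0] and [Q] is evaluated in between. *)
Definition bridge i i' : R := iter i (transition L p) (fun x => Q x * hk i' x) 0.

Fixpoint bridges (r : nat) (u : seq nat) : R :=
  if u is j :: j' :: u' then rho * bridge (j - r) (j' - j) * bridges j' u' else 1.

Fixpoint alternate (u : seq nat) : seq (nat * (V -> R)) :=
  if u is j :: j' :: u' then
    (j, Q) :: (j', fun x => rho * delta R x) :: alternate u'
  else [::].

Lemma even_seq_ind (P : seq nat -> Prop) :
  P [::] -> (forall j j' u, ~~ odd (size u) -> P u -> P (j :: j' :: u)) ->
  forall u, ~~ odd (size u) -> P u.
Proof.
move=> P0 PS u; have [k] := ubnP (size u).
elim: k u => // k IH [|j [|j' u]] //= uk; rewrite negbK => ou.
by apply: PS => //; apply: IH => //; lia.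
Qed.

(** Each [delta] forces the difference walk back to 0, from where it starts
    afresh. *)
Lemma markov_alternate r u : ~~ odd (size u) ->
  markov L p r (alternate u) 0 = bridges r u.
Proof.
move=> ou; elim/even_seq_ind: u / ou r => // j j' u _ IH r /=.
rewrite -IH /bridge -mulrA mulrCA mulrC -iter_transition_scale.
apply: eq_iter_transition => x.
rewrite mulrCA; congr (_ * _).
rewrite -(iter_transition_scale L p (j' - j)).
apply: eq_iter_transition => z; rewrite /delta.
by have [->|_] := eqVneq z 0; rewrite ?mulr1 ?mulr0 ?mul0r.
Qed.

Lemma markov_alternate_sorted n u : path leq 0 u -> all (fun j => j <= n)%N u ->
    ~~ odd (size u) ->
  E2 n (fun l l' => \prod_(a <- alternate u)
     a.2 (position a.1 l - position a.1 l')) = bridges 0 u.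
Proof.
move=> pu au ou; rewrite -markov_alternate //.
have alt1 : [seq a.1 | a <- alternate u] = u.
  by elim/even_seq_ind: u / ou {pu au} => //= j j' u _ ->.
rewrite -(@expect2_markov _ _ _ _ p_sum n).
- apply: eq_expect2 => l l' _ _; apply: eq_bigr => a _.
  by rewrite add0r subn0.
- by rewrite alt1.
- have -> : all (fun a : nat * (V -> R) => a.1 <= n + 0)%N (alternate u) =
      all (fun j => j <= n)%N [seq a.1 | a <- alternate u].
    by rewrite all_map; apply: eq_all => a /=; rewrite addn0.
  by rewrite alt1.
Qed.

(** At every second time [Q] may be replaced by [rho * delta], which dominates
    it. The comparison is one of positive definite kernels in the pair of
    paths, not of values: a product of kernels is monotone for this order, and
    the expectation over two copies of the walk is a quadratic form. *)
Lemma tensor_norm_le_bridges n u : path leq 0 u -> all (fun j => j <= n)%N u ->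
  ~~ odd (size u) -> tensor_norm n u <= bridges 0 u.
Proof.
move=> pu au ou; rewrite -(markov_alternate_sorted pu au ou) {pu au}.
pose prodQ v l l' := \prod_(i <- v) Q (position i l - position i l').
pose alt v l l' := \prod_(a <- alternate v) a.2 (position a.1 l - position a.1 l').
suff : psd (words L n) (fun l l' => alt u l l' + (-1) * prodQ u l l').
  move/(quadratic_ge0 (weight p)); rewrite -expect2_quadratic expect2D.
  by rewrite expect2_scale mulN1r subr_ge0.
elim/even_seq_ind: u / ou => [|j j' u _ IH].
  exists [::] => l l' _ _.
  by rewrite /alt /prodQ !big_nil mulr1 subrr.
have Qj i : psd (words L n) (fun l l' => Q (position i l - position i l')).
  exact: posdef_psd.
have prodQ_psd : psd (words L n) (prodQ u) by apply: psd_prod.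
have rd : psd (words L n) (fun l l' => rho * delta R (position j' l - position j' l')).
  by apply/psd_scale => //; exact/posdef_psd/posdef_delta.
have diff := posdef_psd (words L n) (position j') Q_le_rho.
apply: eq_psd (psd_mul (Qj j) (psd_add (psd_mul rd IH) (psd_mul diff prodQ_psd))).
by move=> l l' _ _; rewrite /alt /prodQ /= !big_cons /=; ring.
Qed.

Lemma bridge_ge0 i i' : 0 <= bridge i i'.
Proof.
apply/posdef_ge0_at0/posdef_iter_transition => s.
exact: psd_mul (Q_posdef s) (heat_posdef L p i' s).
Qed.

Definition bridge_sum (z : R) n : R :=
  \sum_(i <- iota 0 n.+1) \sum_(i' <- iota 0 n.+1)
     z ^+ (i + i') * Num.sqrt (rho * bridge i i').

(** The gaps of a sorted word add up to at most [n], so [z ^+ n] is at most the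
    product of the [z ^+ gap]; once it is replaced by this product, each gap
    may be summed separately over [0..n]. *)
Lemma sum_sorted_bridges_le z n k r : 0 < z -> z <= 1 -> (r <= n)%N ->
  z ^+ n * (\sum_(u <- sorted_words n k.*2 r) Num.sqrt (bridges r u))
    <= z ^+ r * bridge_sum z n ^+ k.
Proof.
move=> z0 z1; elim: k r => [|k IH] r rn.
  by rewrite /= big_seq1 /= sqrtr1 !mulr1 ler_wiXn2l // ltW.
pose g i i' := Num.sqrt (rho * bridge i i').
have g0 i i' : 0 <= g i i' by exact: sqrtr_ge0.
have zg0 i i' : 0 <= z ^+ (i + i') * g i i' by rewrite mulr_ge0 // exprn_ge0 // ltW.
have G0 : 0 <= bridge_sum z n.
  by apply: sumr_ge0 => i _; apply: sumr_ge0 => i' _; exact: zg0.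
have iota_le lo (F : nat -> R) : (lo <= n)%N -> (forall i, 0 <= F i) ->
    \sum_(i <- iota lo (n.+1 - lo)) F (i - lo)%N <= \sum_(i <- iota 0 n.+1) F i.
  move=> lon F0.
  rewrite -{1}(addn0 lo) iotaDl big_map.
  under eq_bigr do rewrite addKn.
  have -> : iota 0 n.+1 = iota 0 (n.+1 - lo) ++ iota (n.+1 - lo) lo.
    by rewrite -[in RHS](add0n (n.+1 - lo)%N) -iotaD subnK // leqW.
  by rewrite big_cat lerDl; apply: sumr_ge0 => i _.
rewrite doubleS /= big_allpairs_dep mulr_sumr.
apply: (@le_trans _ _ (\sum_(j <- iota r (n.+1 - r))
   z ^+ r * bridge_sum z n ^+ k * \sum_(i' <- iota 0 n.+1)
      z ^+ ((j - r) + i') * g (j - r)%N i')); last first.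
  rewrite -mulr_sumr exprSr mulrA ler_wpM2l ?mulr_ge0 ?exprn_ge0 ?(ltW z0) //.
  apply: (iota_le r (fun i => \sum_(i' <- iota 0 n.+1) z ^+ (i + i') * g i i')) => //.
  by move=> i; apply: sumr_ge0.
rewrite big_seq [leRHS]big_seq; apply: ler_sum => j; rewrite mem_iota => jr.
have [rj jn] : (r <= j)%N /\ (j <= n)%N by move: jr; lia.
rewrite big_allpairs_dep.
have iota_le_j := iota_le j (fun i' => z ^+ (j - r + i') * g (j - r)%N i') jn
  (fun=> zg0 _ _).
have c0 : 0 <= z ^+ r * bridge_sum z n ^+ k.
  by rewrite mulr_ge0 ?exprn_ge0 // ltW.
apply: le_trans _ (ler_wpM2l c0 iota_le_j).
rewrite [leRHS]mulr_sumr [leLHS]mulr_sumr.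
rewrite big_seq [leRHS]big_seq; apply: ler_sum => j'; rewrite mem_iota => jr'.
have [jj' jn'] : (j <= j')%N /\ (j' <= n)%N by move: jr'; lia.
have -> : \sum_(w <- sorted_words n k.*2 j') Num.sqrt (bridges r (j :: j' :: w))
    = g (j - r)%N (j' - j)%N *
      \sum_(w <- sorted_words n k.*2 j') Num.sqrt (bridges j' w).
  by rewrite mulr_sumr; apply: eq_bigr => w _; rewrite /= sqrtrM // mulr_ge0 // bridge_ge0.
rewrite mulrCA [leRHS](_ : _ =
  g (j - r)%N (j' - j)%N * (z ^+ j' * bridge_sum z n ^+ k)); last first.
  have -> : z ^+ j' = z ^+ r * z ^+ (j - r + (j' - j)).
    by rewrite -exprD; congr (_ ^+ _); lia.
  move: (z ^+ r) (z ^+ (j - r + (j' - j))) (g (j - r)%N _) (_ ^+ k) => a c e h.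
  by ring.
by rewrite ler_wpM2l // IH.
Qed.

(** By the Cauchy-Schwarz inequality the [k]-th absolute moment reduces to the
    moment of order [2k], whose words have even length and so split into
    pairs of gaps. *)
Lemma even_moment_le z n k y : 0 < z -> z <= 1 ->
  E2 n (fun l l' => `|pair_functional n y l l'| ^+ k)
    <= (k.*2)`!%:R * (z ^- n * bridge_sum z n ^+ k).
Proof.
move=> z0 z1.
set B := (k.*2)`!%:R * _.
have B0 : 0 <= B.
  rewrite !mulr_ge0 ?invr_ge0 ?exprn_ge0 ?(ltW z0) //.
  apply: sumr_ge0 => i _; apply: sumr_ge0 => i' _.
  by rewrite mulr_ge0 ?sqrtr_ge0 // exprn_ge0 // ltW.
rewrite -(@ler_pXn2r _ 2) ?nnegrE //; last first.
  by apply: expect2_ge0 => // l l'; exact: exprn_ge0.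
apply: le_trans (expect2_sqr_le _ _) _.
rewrite (@eq_expect2 R V L p n _ (fun l l' => pair_functional n y l l' ^+ k.*2)).
  apply: le_trans (moment_le_sorted _ _ _) _.
  have S0 : 0 <= \sum_(u <- sorted_words n k.*2 0) Num.sqrt (tensor_norm n u).
    by apply: sumr_ge0 => u _; exact: sqrtr_ge0.
  rewrite ler_pXn2r ?nnegrE //; last by rewrite mulr_ge0.
  rewrite /B ler_wpM2l // mulrC ler_pdivlMr ?exprn_gt0 // mulrC.
  have := sum_sorted_bridges_le k z0 z1 (leq0n n); rewrite expr0 mul1r.
  apply: le_trans; rewrite ler_wpM2l ?exprn_ge0 ?(ltW z0) //.
  rewrite big_seq [leRHS]big_seq; apply: ler_sum => u.
  rewrite mem_sorted_words => /and3P[/eqP zu pu au].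
  by apply/ler_wsqrtr/tensor_norm_le_bridges => //; rewrite zu odd_double.
move=> l l' _ _; rewrite -exprM muln2.
by rewrite -[RHS]ger0_norm ?normrX // exprn_even_ge0 // odd_double.
Qed.

End Moments.

(** * Exponential moments *)

Section ExponentialMoments.
Variable R : realType.

(** Only even powers occur: at [theta sqrt |D|] they are integer powers of
    [|D|], whose expectations are under control. *)
Definition cosh_partial (K : nat) (x : R) : R :=
  \sum_(0 <= k < K) 2 / (k.*2)`!%:R * x ^+ k.*2.

Lemma cvg_cosh_partial x :
  cosh_partial K x @[K --> \oo] --> expR x + expR (- x).
Proof.
have dbl : K.*2 @[K --> \oo] --> \oo.
  by apply/cvgnyPge => A; exists A => // m /= Am; rewrite -addnn; lia.
have -> : (fun K => cosh_partial K x) =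
    (fun K => series (exp_coeff x) K.*2 + series (exp_coeff (- x)) K.*2).
  apply/funext => K; rewrite /cosh_partial /series /=.
  elim: K => [|K IH]; first by rewrite !big_geq // addr0.
  rewrite doubleS !(big_nat_recr _ _ _ (leq0n _)) /= IH /exp_coeff /=.
  have even_pow : (- x) ^+ K.*2 = x ^+ K.*2 by rewrite -mul2n !exprM sqrrN.
  rewrite !exprS even_pow; set a := \sum_(_ <= _ < _) _; set b := \sum_(_ <= _ < _) _.
  by ring.
apply: cvgD; apply: (cvg_comp _ (series (exp_coeff _)) dbl);
  exact: is_cvg_series_exp_coeff.
Qed.

Section Moments.
Variables (V : zmodType) (L : seq V) (p : V -> R).
Hypothesis p_ge0 : forall x, 0 <= p x.
Hypothesis p_sum : \sum_(s <- L) p s = 1.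
Local Notation E2 := (expect2 L p).

Lemma cvg_expect2 n (F : nat -> seq V -> seq V -> R) G :
  (forall l l', F k l l' @[k --> \oo] --> G l l') ->
  E2 n (F k) @[k --> \oo] --> E2 n G.
Proof.
move=> FG; rewrite /expect2 /expect.
apply: cvg_big => [|l _]; first exact: add_continuous.
apply: cvgM; first exact: cvg_cst.
apply: cvg_big => [|l' _]; first exact: add_continuous.
by apply: cvgM; [exact: cvg_cst|exact: FG].
Qed.

Variable (Q : V -> R) (rho : R).
Hypotheses (Q_posdef : posdef Q) (rho_ge0 : 0 <= rho)
  (Q_le_rho : posdef (fun x => rho * delta R x - Q x)).

(** Since [E |D|^k] is at most [(2k)! z^-n S^k], the hyperbolic cosine of
    [theta sqrt |D|] is bounded by a geometric series. *)
Lemma exp_moment_le z n y theta : 0 < z -> z <= 1 -> 0 <= theta ->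
    theta ^+ 2 * bridge_sum L p Q rho z n <= 2^-1 ->
  E2 n (fun l l' => expR (theta * Num.sqrt `|pair_functional Q n y l l'|))
    <= 4 * z ^- n.
Proof.
move=> z0 z1 theta0 small.
pose X l l' := theta * Num.sqrt `|pair_functional Q n y l l'|.
apply: (@le_trans _ _ (E2 n (fun l l' => expR (X l l') + expR (- X l l')))).
  by apply: le_expect2 => // l l' _ _; rewrite lerDl expR_ge0.
have lim_cosh := @cvg_expect2 n (fun K l l' => cosh_partial K (X l l')) _
  (fun l l' => cvg_cosh_partial (x := X l l')).
rewrite -(cvg_lim _ lim_cosh) //.
apply: limr_le; first by apply/cvg_ex; eexists; exact: lim_cosh.
apply: nearW => K.
rewrite /cosh_partial expect2_sum.
set S := bridge_sum _ _ _ _ _ _ in small *.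
have zn : 0 <= z ^- n by rewrite invr_ge0 exprn_ge0 // ltW.
have S0 : 0 <= S.
  apply: sumr_ge0 => i _; apply: sumr_ge0 => i' _.
  by rewrite mulr_ge0 ?sqrtr_ge0 // exprn_ge0 // ltW.
apply: (@le_trans _ _ (\sum_(0 <= k < K) 2 * z ^- n * 2^-1 ^+ k)).
  apply: ler_sum => k _; rewrite expect2_scale.
  rewrite (@eq_expect2 R V L p n _ (fun l l' =>
    theta ^+ 2 ^+ k * `|pair_functional Q n y l l'| ^+ k)); last first.
    by move=> l l' _ _; rewrite /X -mul2n exprM [(theta * _) ^+ 2]exprMn sqr_sqrtr // exprMn.
  rewrite expect2_scale.
  have E := even_moment_le p_ge0 p_sum Q_posdef rho_ge0 Q_le_rho n k y z0 z1.
  rewrite -/S in E.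
  have f0 : (0 : R) < (k.*2)`!%:R by rewrite ltr0n fact_gt0.
  have t0 : 0 <= 2 / (k.*2)`!%:R * theta ^+ 2 ^+ k.
    by rewrite mulr_ge0 ?exprn_ge0 // divr_ge0 // ltW.
  rewrite mulrA; apply: le_trans (ler_wpM2l t0 E) _.
  rewrite [leLHS](_ : _ = 2 * z ^- n * (theta ^+ 2 * S) ^+ k); last first.
    rewrite [(_ * S) ^+ k]exprMn.
    set u := theta ^+ 2 ^+ k; set v := S ^+ k; set w := z ^- n.
    by field; rewrite gt_eqF.
  rewrite ler_wpM2l ?mulr_ge0 // lerXn2r ?nnegrE ?mulr_ge0 ?exprn_ge0 //.
rewrite -mulr_sumr (_ : \sum_(0 <= k < K) 2^-1 ^+ k = 2 - 2 * 2^-1 ^+ K :> R).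
  have : 0 <= z ^- n * 2^-1 ^+ K by rewrite mulr_ge0 // exprn_ge0.
  by lra.
elim: K => [|K IH]; first by rewrite big_geq // expr0 mulr1 subrr.
by rewrite big_nat_recr //= IH exprS; lra.
Qed.

End Moments.

End ExponentialMoments.

(** * Estimates of the bridges *)

Lemma ler_sum_subset (R : numDomainType) (I : eqType) (s t : seq I) (F : I -> R) :
    uniq s -> uniq t -> {subset s <= t} -> (forall i, 0 <= F i) ->
  \sum_(i <- s) F i <= \sum_(i <- t) F i.
Proof.
move=> us ut st F0; rewrite [leRHS](bigID (fun i => i \in s)) /=.
have -> : \sum_(i <- t | i \in s) F i = \sum_(i <- s) F i.
  rewrite -big_filter; apply: perm_big; apply: uniq_perm => [||i] //.
    exact: filter_uniq.
  by rewrite mem_filter; case: (boolP (i \in s)) => //= /st.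
by rewrite lerDl sumr_ge0.
Qed.

Section GeometricSums.
Variable R : realType.

Definition inv_sqrt (i : nat) : R := (Num.sqrt i.+1%:R)^-1.

Lemma inv_sqrt_gt0 i : 0 < inv_sqrt i.
Proof. by rewrite invr_gt0 sqrtr_gt0. Qed.

Lemma inv_sqrt_sqr i : inv_sqrt i ^+ 2 = i.+1%:R^-1.
Proof. by rewrite /inv_sqrt exprVn sqr_sqrtr. Qed.

Lemma inv_sqrt_le_telescope i :
  inv_sqrt i <= 2 * (Num.sqrt i.+1%:R - Num.sqrt i%:R).
Proof.
rewrite /inv_sqrt; set a := Num.sqrt i.+1%:R; set b := Num.sqrt i%:R.
have a0 : 0 < a by rewrite sqrtr_gt0.
have b0 : 0 <= b by exact: sqrtr_ge0.
have ab : b <= a by rewrite ler_wsqrtr // ler_nat.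
have e : a ^+ 2 = b ^+ 2 + 1 by rewrite !sqr_sqrtr // -natr1.
rewrite -(ler_pM2l a0) mulfV ?gt_eqF //.
have : a ^+ 2 - b ^+ 2 = 1 by rewrite e addrC addKr.
have : 0 <= (a - b) ^+ 2 by exact: sqr_ge0.
rewrite sqrrB; lra.
Qed.

(** Splitting the sum at [i = x]: below [x] the terms are at most
    [inv_sqrt i], above it they are at most [v] times the geometric weight. *)
Lemma geometric_sum_le (s x v : R) (u : nat -> R) N :
    0 < s -> s <= 1 -> 0 <= x -> 0 <= v ->
    (forall i, 0 <= u i <= inv_sqrt i) ->
    (forall i, x <= i.+1%:R -> u i <= v) ->
  \sum_(i <- iota 0 N) (1 + s)^-1 ^+ i * u i <= 2 * Num.sqrt x + 2 * v / s.
Proof.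
move=> s0 s1 x0 v0 ug uv; set z := (1 + s)^-1.
have s10 : 0 < 1 + s by lra.
have z0 : 0 <= z by rewrite invr_ge0 ltW.
have z1 : z <= 1 by rewrite invf_le1 //; lra.
have head : \sum_(i <- iota 0 N) (i.+1%:R < x)%R%:R * inv_sqrt i <= 2 * Num.sqrt x.
  suff : \sum_(i <- iota 0 N) (i.+1%:R < x)%R%:R * inv_sqrt i <= 2 * Num.sqrt x /\
      \sum_(i <- iota 0 N) (i.+1%:R < x)%R%:R * inv_sqrt i <= 2 * Num.sqrt N%:R by case.
  elim: N => [|N [IHx IHN]]; first by rewrite big_nil !mulr_ge0 ?sqrtr_ge0.
  rewrite -addn1 iotaD big_cat big_seq1 add0n addn1 /=.
  have tel := inv_sqrt_le_telescope N.
  have [Nx|Nx] := ltP N.+1%:R x.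
    have : Num.sqrt N.+1%:R <= Num.sqrt x by rewrite ler_wsqrtr // ltW.
    by rewrite mul1r; move: IHN tel => /=; lra.
  have : Num.sqrt N%:R <= Num.sqrt N.+1%:R :> R by rewrite ler_wsqrtr // ler_nat.
  by rewrite mul0r addr0; split => //; move: IHN => /=; lra.
have tail : \sum_(i <- iota 0 N) z ^+ i * v <= 2 * v / s.
  rewrite -mulr_suml (_ : 2 * v / s = 2 / s * v); last by ring.
  rewrite ler_wpM2r //.
  have e : \sum_(i <- iota 0 N) z ^+ i * (1 - z) = 1 - z ^+ N.
    elim: N {head} => [|N IH]; first by rewrite big_nil expr0 subrr.
    by rewrite -addn1 iotaD big_cat big_seq1 add0n addn1 /= IH exprS; ring.
  have z1' : 1 - z = s / (1 + s) by rewrite /z; field; rewrite gt_eqF.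
  rewrite -mulr_suml z1' in e.
  have es : (\sum_(i <- iota 0 N) z ^+ i) * s = (1 + s) * (1 - z ^+ N).
    by rewrite -e; field; rewrite gt_eqF.
  rewrite ler_pdivlMr // es.
  have : (1 + s) * (1 - z ^+ N) <= (1 + s) * 1.
    by rewrite ler_wpM2l ?(ltW s10) // gerBl exprn_ge0.
  by lra.
apply: le_trans (lerD head tail); rewrite -big_split; apply: ler_sum => i _.
have /andP[u0 uig] := ug i.
have zi0 : 0 <= z ^+ i by exact: exprn_ge0.
have zi1 : z ^+ i <= 1 by exact: exprn_ile1.
have [ix|ix] := ltP i.+1%:R x => /=.
  have zv : 0 <= z ^+ i * v by exact: mulr_ge0.
  rewrite mul1r; have : z ^+ i * u i <= 1 * u i by rewrite ler_wpM2r.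
  by lra.
by rewrite mul0r add0r ler_wpM2l // uv.
Qed.

(** The sum is cut at [1 / s], from where on the geometric weight takes over. *)
Lemma sum_inv_sqrt_le (s : R) N : 0 < s -> s <= 1 ->
  \sum_(i <- iota 0 N.+1) (1 + s)^-1 ^+ i * inv_sqrt i <= 4 / Num.sqrt s.
Proof.
move=> s0 s1; set q := Num.sqrt s.
have sq : q ^+ 2 = s by exact: sqr_sqrtr (ltW s0).
have q0 : 0 < q by rewrite sqrtr_gt0.
have := @geometric_sum_le s s^-1 q inv_sqrt N.+1 s0 s1 _ (ltW q0).
rewrite invr_ge0 (ltW s0) sqrtrV ?(ltW s0) // -/q => /(_ isT) h.
apply: le_trans (h _ _) _.
- by move=> i; rewrite lexx andbT ltW ?inv_sqrt_gt0.
- move=> i si; rewrite /inv_sqrt -[leRHS]invrK.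
  rewrite lef_pV2 ?posrE ?invr_gt0 ?sqrtr_gt0 //.
  by rewrite /q -sqrtrV ?(ltW s0) // ler_wsqrtr.
- rewrite le_eqVlt -sq; apply/orP; left; apply/eqP.
  by field; rewrite gt_eqF.
Qed.

End GeometricSums.

Section DiagonalBridges.
Variables (R : realType) (V : zmodType) (L : seq V) (p : V -> R).
Hypothesis p_ge0 : forall x, 0 <= p x.
Local Notation hk := (heat L p).
Variables A1 : R.
Hypotheses (A1_ge0 : 0 <= A1) (heat0_le : forall k, hk k 0 <= A1 / k.+1%:R).

Lemma bridge_delta eta i i' :
  bridge L p (fun x => eta * delta R x) i i' = eta * (hk i 0 * hk i' 0).
Proof.
rewrite /bridge (@eq_iter_transition _ _ _ _ _ _ (fun x => eta * hk i' 0 * delta R x)).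
  by rewrite iter_transition_scale -/(heat L p i) mulrAC mulrA.
move=> x; rewrite /delta; have [->|_] := eqVneq x 0; first by ring.
by rewrite !mulr0 mul0r.
Qed.

(** The bridges of a multiple of [delta] factor, so the double sum is the
    square of a simple one. *)
Lemma bridge_sum_delta_le eta s N : 0 <= eta -> 0 < s -> s <= 1 ->
  bridge_sum L p (fun x => eta * delta R x) eta (1 + s)^-1 N <= 16 * eta * A1 / s.
Proof.
move=> eta0 s0 s1; set z := (1 + s)^-1; pose g i := inv_sqrt R i.
have z0 : 0 < z by rewrite invr_gt0; lra.
have g0 j : 0 < g j by exact: inv_sqrt_gt0.
have sq := sqr_sqrtr (ltW s0).
have q0 : 0 < Num.sqrt s by rewrite sqrtr_gt0.
have Sg := sum_inv_sqrt_le N s0 s1; rewrite -/z in Sg.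
set q := Num.sqrt s in sq q0 Sg.
have Sg0 : 0 <= \sum_(i <- iota 0 N.+1) z ^+ i * g i.
  by apply: sumr_ge0 => i _; rewrite mulr_ge0 ?exprn_ge0 // ltW.
apply: (@le_trans _ _ (eta * A1 * ((\sum_(i <- iota 0 N.+1) z ^+ i * g i)
    * (\sum_(i <- iota 0 N.+1) z ^+ i * g i)))).
  rewrite big_distrlr mulr_sumr; apply: ler_sum => i _ /=.
  rewrite mulr_sumr; apply: ler_sum => i' _ /=.
  have zz0 : 0 <= z ^+ i * z ^+ i' by rewrite mulr_ge0 ?exprn_ge0 // ltW.
  rewrite exprD.
  have : Num.sqrt (eta * bridge L p (fun x => eta * delta R x) i i')
      <= eta * A1 * (g i * g i').
    have rhs0 : 0 <= eta * A1 * (g i * g i') by rewrite !mulr_ge0 // ltW.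
    rewrite -[leRHS]ger0_norm // -sqrtr_sqr; apply: ler_wsqrtr.
    rewrite bridge_delta !exprMn !inv_sqrt_sqr (mulrA eta eta) -(expr2 eta) -[leRHS]mulrA.
    rewrite ler_wpM2l ?sqr_ge0 //.
    apply: le_trans (ler_pM _ _ (heat0_le i) (heat0_le i')) _.
    - exact: heat_ge0.
    - exact: heat_ge0.
    - by rewrite expr2 mulrACA.
  move=> h; apply: le_trans (ler_wpM2l zz0 h) _.
  by rewrite le_eqVlt; apply/orP; left; apply/eqP; ring.
apply: (@le_trans _ _ (eta * A1 * (4 / q * (4 / q)))).
  by rewrite ler_wpM2l ?mulr_ge0 // ler_pM.
by rewrite le_eqVlt -sq; apply/orP; left; apply/eqP; field; rewrite gt_eqF.
Qed.

End DiagonalBridges.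

Section Bridges.
Variables (R : realType) (L : seq (int * int)) (p : int * int -> R).
Hypothesis p_ge0 : forall x, 0 <= p x.
Hypothesis p_sum : \sum_(s <- L) p s = 1.
Local Notation hk := (heat L p).

Variables A1 A2 : R.
Hypotheses (A1_ge0 : 0 <= A1) (A2_ge0 : 0 <= A2)
  (heat0_le : forall k, hk k 0 <= A1 / k.+1%:R)
  (defect_le : forall k x,
     heat_defect L p k x <= A2 * (l1norm x)%:R ^+ 2 / k.+1%:R ^+ 2).

Variables (K : int * int -> R) (kappa M2 : R).
Hypotheses (K_ge0 : forall x, 0 <= K x) (K_even : forall x, K (- x) = K x)
  (K_sum_le : forall U, uniq U -> \sum_(u <- U) K u <= kappa)
  (K_sum_ge : forall e, 0 < e -> exists2 U, uniq U & kappa - e <= \sum_(u <- U) K u)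
  (K_second : forall U, uniq U -> \sum_(u <- U) K u * (l1norm u)%:R ^+ 2 <= M2).

Definition centered_kernel (x : int * int) : R := kappa * delta R x + (-1) * K x.

Local Notation br := (bridge L p centered_kernel).

Lemma kappa_ge0 : 0 <= kappa.
Proof. by have := K_sum_le (U := [::]) isT; rewrite big_nil. Qed.

Lemma M2_ge0 : 0 <= M2.
Proof. by have := K_second (U := [::]) isT; rewrite big_nil. Qed.

Lemma bridgeE i i' : exists U : seq (int * int), forall W, uniq W ->
  {subset U <= W} ->
  br i i' = kappa * (hk i 0 * hk i' 0) - \sum_(u <- W) K u * (hk i u * hk i' u).
Proof.
have [U [_ hU]] := iter_transition_heat L p i.
exists (0 :: U) => W uW UW; rewrite /bridge (hU W) //; last first.
  by move=> x xU; apply: UW; rewrite inE xU orbT.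
rewrite (eq_bigr (fun u => kappa * (delta R u * (hk i u * hk i' u)) - K u * (hk i u * hk i' u))).
  rewrite sumrB -mulr_sumr; congr (_ * _ - _).
  rewrite (bigD1_seq 0) ?UW ?mem_head //= /delta eqxx mul1r big1 ?addr0 // => u.
  by move=> /negbTE ->; rewrite mul0r.
by move=> u _; rewrite /centered_kernel; ring.
Qed.

Lemma bridge_le_kappa i i' : br i i' <= kappa * A1 ^+ 2 / (i.+1%:R * i'.+1%:R).
Proof.
have [U hU] := bridgeE i i'.
rewrite (hU (undup U)) ?undup_uniq //; last by move=> x; rewrite mem_undup.
apply: (@le_trans _ _ (kappa * (hk i 0 * hk i' 0))).
  rewrite gerBl; apply: sumr_ge0 => u _.
  by rewrite !mulr_ge0 // heat_ge0.
rewrite -mulrA ler_wpM2l ?kappa_ge0 // (_ : A1 ^+ 2 / _ = A1 / i.+1%:R * (A1 / i'.+1%:R)).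
  by apply: ler_pM => //; exact: heat_ge0.
by rewrite expr2 invfM mulrACA.
Qed.

(** As [kappa] is the mass of [K], the bridge is the sum of the
    [K u * (hk i 0 * hk i' 0 - hk i u * hk i' u)]. Each difference is a
    combination of defects at [u], which grow at most quadratically. *)
Lemma bridge_le_M2 i i' : br i i' <=
  A1 * A2 * M2 / (i.+1%:R * i'.+1%:R) * (i.+1%:R^-1 + i'.+1%:R^-1).
Proof.
apply/ler_addgt0Pr => e e0.
(* the finite set W must support the law of the walk and carry the mass of
   K up to e *)
have [U hU] := bridgeE i i'; have [U' uU' hU'] := K_sum_ge e0.
set W := undup (U ++ U').
have uW : uniq W by exact: undup_uniq.
rewrite (hU W) //; last by move=> x xU; rewrite mem_undup mem_cat xU.
have kW : kappa <= e + \sum_(u <- W) K u.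
  rewrite -lerBlDl; apply: le_trans hU' _.
  by apply: ler_sum_subset => // x xU; rewrite mem_undup mem_cat xU orbT.
set B := _ / _ * _.
have h0 k := heat_ge0 L p_ge0 k.
have hle1 k := heat0_le1 p_ge0 p_sum k.
have term u : K u * (hk i 0 * hk i' 0 - hk i u * hk i' u) <=
    K u * (l1norm u)%:R ^+ 2 * (A1 * A2 / (i.+1%:R * i'.+1%:R)
      * (i.+1%:R^-1 + i'.+1%:R^-1)).
  rewrite -mulrA ler_wpM2l //; set N := (l1norm u)%:R ^+ 2.
  have d := defect_le i u; have d' := defect_le i' u.
  have dd0 k : 0 <= heat_defect L p k u by exact: heat_defect_ge0.
  have -> : hk i 0 * hk i' 0 - hk i u * hk i' u =
      hk i 0 * heat_defect L p i' u + hk i' u * heat_defect L p i u.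
    by rewrite /heat_defect; ring.
  have le1 : hk i 0 * heat_defect L p i' u
      <= A1 / i.+1%:R * (A2 * N / i'.+1%:R ^+ 2) by apply: ler_pM.
  have le2 : hk i' u * heat_defect L p i u
      <= A1 / i'.+1%:R * (A2 * N / i.+1%:R ^+ 2).
    by apply: ler_pM => //; apply: le_trans (heat_le0 _ _ _ _) _.
  apply: le_trans (lerD le1 le2) _.
  rewrite le_eqVlt; apply/orP; left; apply/eqP.
  have : i.+1%:R != 0 :> R by rewrite pnatr_eq0.
  have : i'.+1%:R != 0 :> R by rewrite pnatr_eq0.
  move: (i.+1%:R) (i'.+1%:R) => a a' a'0 a0.
  by field; rewrite a0 a'0.
have hh : \sum_(u <- W) K u * (hk i 0 * hk i' 0 - hk i u * hk i' u) <= B.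
  apply: le_trans (ler_sum _ (fun u _ => term u)) _.
  rewrite -mulr_suml /B.
  rewrite (_ : A1 * A2 * M2 / _ * _ = M2 * (A1 * A2 / (i.+1%:R * i'.+1%:R)
      * (i.+1%:R^-1 + i'.+1%:R^-1))); last by ring.
  rewrite ler_wpM2r ?K_second // !mulr_ge0 ?addr_ge0 ?invr_ge0 //.
apply: le_trans (_ : (e + \sum_(u <- W) K u) * (hk i 0 * hk i' 0)
    - \sum_(u <- W) K u * (hk i u * hk i' u) <= _).
  by rewrite lerD2r ler_wpM2r // mulr_ge0.
rewrite mulrDl mulr_suml -addrA -sumrB addrC.
under eq_bigr do rewrite -mulrBr.
apply: lerD => //; rewrite ler_piMr ?(ltW e0) //.
by apply: mulr_ile1.
Qed.

(** The gain in the bridges of [centered_kernel] over those of [delta]: none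
    for gaps shorter than [r^2], and [r / sqrt i] for longer ones. *)
Definition damping (r : R) i : R := Num.min 1 (r * inv_sqrt R i).

(** The bound [bridge_le_kappa] serves when one of the two gaps is short,
    [bridge_le_M2] when both are long. *)
Lemma sqrt_bridge_le r m B i i' :
    0 <= r -> 0 <= m -> 0 <= B -> kappa <= 2 -> M2 <= m * r ^+ 2 ->
    8 * A1 ^+ 2 <= B ^+ 2 -> 4 * A1 * A2 * m <= B ^+ 2 ->
  Num.sqrt (2 * kappa * br i i') <=
  B * inv_sqrt R i * inv_sqrt R i' * (damping r i + damping r i').
Proof.
move=> r0 m0 B0 k2 Mm B1 B2.
set g := inv_sqrt R i; set g' := inv_sqrt R i'.
have g0 : 0 < g by exact: inv_sqrt_gt0.
have g'0 : 0 < g' by exact: inv_sqrt_gt0.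
have v0 j : 0 <= damping r j.
  by rewrite /damping le_min ler01 mulr_ge0 // ltW // inv_sqrt_gt0.
set v := damping r i; set v' := damping r i'.
have v00 : 0 <= v by exact: v0.
have v0' : 0 <= v' by exact: v0.
have rhs0 : 0 <= B * g * g' * (v + v').
  by rewrite !mulr_ge0 ?addr_ge0 // ltW.
rewrite -[leRHS]ger0_norm // -sqrtr_sqr; apply: ler_wsqrtr.
have ki := kappa_ge0.
have G0 : 0 <= (g * g') ^+ 2 by exact: sqr_ge0.
have h1 : 2 * kappa * br i i' <= B ^+ 2 * (g * g') ^+ 2.
  apply: le_trans (_ : 2 * kappa * (kappa * A1 ^+ 2 * (g * g') ^+ 2) <= _).
    rewrite ler_wpM2l ?mulr_ge0 //; have := bridge_le_kappa i i'.
    by rewrite exprMn !inv_sqrt_sqr invfM.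
  rewrite [leLHS](_ : _ = 2 * (kappa * kappa * A1 ^+ 2) * (g * g') ^+ 2);
    last by ring.
  rewrite ler_wpM2r //; apply: le_trans _ B1.
  have : kappa * kappa * A1 ^+ 2 <= 2 * 2 * A1 ^+ 2.
    by rewrite ler_wpM2r ?sqr_ge0 // ler_pM.
  by lra.
have h2 : 2 * kappa * br i i' <= B ^+ 2 * (g * g') ^+ 2 * (r ^+ 2 * (g ^+ 2 + g' ^+ 2)).
  apply: le_trans (_ : 2 * kappa *
      (A1 * A2 * M2 * (g * g') ^+ 2 * (g ^+ 2 + g' ^+ 2)) <= _).
    rewrite ler_wpM2l ?mulr_ge0 //; have := bridge_le_M2 i i'.
    by rewrite exprMn !inv_sqrt_sqr invfM.
  have T0 : 0 <= (g * g') ^+ 2 * (g ^+ 2 + g' ^+ 2).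
    by rewrite mulr_ge0 // addr_ge0 // sqr_ge0.
  rewrite [leLHS](_ : _ = 2 * kappa * (A1 * A2 * M2) * ((g * g') ^+ 2 * (g ^+ 2 + g' ^+ 2)));
    last by ring.
  rewrite [leRHS](_ : _ = B ^+ 2 * r ^+ 2 * ((g * g') ^+ 2 * (g ^+ 2 + g' ^+ 2)));
    last by ring.
  rewrite ler_wpM2r //.
  have AA0 : 0 <= A1 * A2 by rewrite mulr_ge0.
  apply: le_trans (_ : 4 * A1 * A2 * m * r ^+ 2 <= _); last first.
    by rewrite ler_wpM2r // sqr_ge0.
  have : A1 * A2 * M2 <= A1 * A2 * (m * r ^+ 2) by rewrite ler_wpM2l.
  have AM : 0 <= A1 * A2 * M2 by rewrite mulr_ge0 // M2_ge0.
  have : kappa * (A1 * A2 * M2) <= 2 * (A1 * A2 * M2) by rewrite ler_wpM2r.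
  by lra.
rewrite !exprMn -[B ^+ 2 * _ * _]mulrA -exprMn.
have BG0 : 0 <= B ^+ 2 * (g * g') ^+ 2 by rewrite mulr_ge0 // sqr_ge0.
have : v = 1 \/ v = r * g.
  by rewrite /v /damping -/g; case: (leP 1 (r * g)) => _; [left|right].
have : v' = 1 \/ v' = r * g'.
  by rewrite /v' /damping -/g'; case: (leP 1 (r * g')) => _; [left|right].
move=> [e'|e'] [e|e].
1-3: apply: le_trans h1 _; rewrite -[leLHS]mulr1 ler_wpM2l //.
- by rewrite e e'; nra.
- by rewrite e' sqrrD expr1n; nra.
- by rewrite e sqrrD expr1n; nra.
apply: le_trans h2 _; rewrite ler_wpM2l // e e'.
have cross : 0 <= r * g * (r * g').
  by rewrite !mulr_ge0 // ltW.
by rewrite sqrrD !exprMn; lra.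
Qed.

(** The sum over the damped gap is cut at [dlt ^+ 2 / s]: the shorter gaps
    weigh little, and on the longer ones the damping is small because of
    [r * Num.sqrt s <= dlt ^+ 3]. Both parts are smaller by the factor [dlt]
    than the sum without damping. *)
Lemma bridge_sum_le r m B s dlt N :
    0 <= r -> 0 <= m -> 0 <= B -> kappa <= 2 -> M2 <= m * r ^+ 2 ->
    8 * A1 ^+ 2 <= B ^+ 2 -> 4 * A1 * A2 * m <= B ^+ 2 ->
    0 < s -> s <= 1 -> 0 < dlt -> r * Num.sqrt s <= dlt ^+ 3 ->
  bridge_sum L p centered_kernel (2 * kappa) (1 + s)^-1 N <= 32 * B * dlt / s.
Proof.
move=> r0 m0 B0 k2 Mm B1 B2 s0 s1 d0 rs.
set z := (1 + s)^-1; pose g i := inv_sqrt R i; pose v i := damping r i.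
have z0 : 0 < z by rewrite invr_gt0; lra.
have v0 j : 0 <= v j.
  by rewrite /v /damping le_min ler01 mulr_ge0 // ltW // inv_sqrt_gt0.
have g0 j : 0 < g j by exact: inv_sqrt_gt0.
have sq := sqr_sqrtr (ltW s0).
have q0 : 0 < Num.sqrt s by rewrite sqrtr_gt0.
set q := Num.sqrt s in sq q0 rs.
have Sg := sum_inv_sqrt_le N s0 s1; rewrite -/z -/q in Sg.
have Sgv : \sum_(i <- iota 0 N.+1) z ^+ i * (g i * v i) <= 4 * dlt / q.
  have x0 : 0 <= dlt ^+ 2 / s by rewrite divr_ge0 ?exprn_ge0 // ltW.
  have w0 : 0 <= r * s / dlt ^+ 2 by rewrite !mulr_ge0 ?invr_ge0 ?exprn_ge0 // ltW.
  have := @geometric_sum_le R s (dlt ^+ 2 / s) (r * s / dlt ^+ 2)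
    (fun i => g i * v i) N.+1 s0 s1 x0 w0.
  rewrite -/z sqrtrM ?sqr_ge0 // sqrtr_sqr gtr0_norm // sqrtrV ?(ltW s0) // -/q.
  move=> h; apply: le_trans (h _ _) _.
  - move=> i; rewrite mulr_ge0 ?(ltW (g0 i)) //= ler_piMr ?(ltW (g0 i)) //.
    by rewrite /v /damping ge_min lexx.
  - move=> i xi; apply: (@le_trans _ _ (g i * (r * g i))).
      by rewrite ler_wpM2l ?(ltW (g0 i)) // /v /damping ge_min lexx orbT.
    rewrite mulrCA -expr2 inv_sqrt_sqr -mulrA ler_wpM2l //.
    rewrite -[leRHS]invrK lef_pV2 ?posrE ?invr_gt0 ?divr_gt0 ?exprn_gt0 //.
    by rewrite invf_div.
  have rq : r <= dlt ^+ 3 / q by rewrite ler_pdivlMr.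
  have : 2 * (r * s / dlt ^+ 2) / s <= 2 * dlt / q.
    rewrite [leLHS](_ : _ = 2 / dlt ^+ 2 * r); last first.
      by field; rewrite !gt_eqF.
    rewrite [leRHS](_ : _ = 2 / dlt ^+ 2 * (dlt ^+ 3 / q)); last first.
      by field; rewrite !gt_eqF.
    by rewrite ler_wpM2l // divr_ge0 // exprn_ge0 // ltW.
  by lra.
have Sg0 : 0 <= \sum_(i <- iota 0 N.+1) z ^+ i * g i.
  by apply: sumr_ge0 => i _; rewrite mulr_ge0 ?exprn_ge0 // ltW.
have Sgv0 : 0 <= \sum_(i <- iota 0 N.+1) z ^+ i * (g i * v i).
  by apply: sumr_ge0 => i _; rewrite !mulr_ge0 ?exprn_ge0 // ltW.
apply: (@le_trans _ _ (2 * B * ((\sum_(i <- iota 0 N.+1) z ^+ i * (g i * v i))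
    * (\sum_(i <- iota 0 N.+1) z ^+ i * g i)))).
  rewrite (_ : 2 * B * _ = B * ((\sum_(i <- iota 0 N.+1) z ^+ i * (g i * v i))
    * (\sum_(i <- iota 0 N.+1) z ^+ i * g i)
    + (\sum_(i <- iota 0 N.+1) z ^+ i * g i)
    * (\sum_(i <- iota 0 N.+1) z ^+ i * (g i * v i)))); last by ring.
  rewrite !big_distrlr -big_split mulr_sumr; apply: ler_sum => i _ /=.
  rewrite -big_split mulr_sumr; apply: ler_sum => i' _ /=.
  have zz0 : 0 <= z ^+ i * z ^+ i' by rewrite mulr_ge0 ?exprn_ge0 // ltW.
  rewrite exprD; apply: le_trans (ler_wpM2l zz0
    (sqrt_bridge_le i i' r0 m0 B0 k2 Mm B1 B2)) _.
  rewrite -/(g i) -/(g i') -/(v i) -/(v i').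
  move: (z ^+ i) (z ^+ i') (g i) (g i') (v i) (v i') => *.
  by rewrite le_eqVlt; apply/orP; left; apply/eqP; ring.
apply: (@le_trans _ _ (2 * B * (4 * dlt / q * (4 / q)))).
  by rewrite ler_wpM2l ?mulr_ge0 // ler_pM.
by rewrite le_eqVlt -sq; apply/orP; left; apply/eqP; field; rewrite gt_eqF.
Qed.

Definition intersection_gap n y l l' : R :=
  \sum_(i <- iota 1 n) \sum_(j <- iota 1 n)
    (delta R (position j l' - position i l + y) - K (position j l' - position i l + y)).

Lemma centered_kernel_posdef : posdef centered_kernel.
Proof. by apply: posdef_diagonally_dominant => //; rewrite sqrrN expr1n. Qed.

Lemma centered_kernel_le : posdef (fun x => 2 * kappa * delta R x - centered_kernel x).
Proof.
apply: (@posdef_ext _ _ (fun x => kappa * delta R x + 1 * K x)) => [x|].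
  by rewrite /centered_kernel; ring.
by apply: posdef_diagonally_dominant => //; rewrite expr1n.
Qed.

(** [delta - K] is the positive definite [kappa delta - K] plus the multiple
    [1 - kappa] of [delta]. The square root is subadditive and the exponential
    of a sum is at most the mean of the exponentials of the doubles, so each
    part is treated by [exp_moment_le] at [2 * theta]. *)
Lemma exp_intersection_gap_le r m B s dlt theta n y :
    0 <= r -> 0 <= m -> 0 <= B -> kappa <= 2 -> M2 <= m * r ^+ 2 ->
    8 * A1 ^+ 2 <= B ^+ 2 -> 4 * A1 * A2 * m <= B ^+ 2 ->
    0 < s -> s <= 1 -> 0 < dlt -> r * Num.sqrt s <= dlt ^+ 3 -> 0 <= theta ->
    (2 * theta) ^+ 2 * (32 * B * dlt / s) <= 2^-1 ->
    (2 * theta) ^+ 2 * (16 * `|1 - kappa| * A1 / s) <= 2^-1 ->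
  expect2 L p n (fun l l' => expR (theta * Num.sqrt `|intersection_gap n y l l'|))
    <= 4 * (1 + s) ^+ n.
Proof.
move=> r0 m0 B0 k2 Mm B1 B2 s0 s1 d0 rs theta0 small1 small2.
set eta := `|1 - kappa| in small2.
pose D1 := pair_functional centered_kernel n y.
pose D2 := pair_functional (fun x => eta * delta R x) n y.
have z0 : 0 < (1 + s)^-1 by rewrite invr_gt0; lra.
have z1 : (1 + s)^-1 <= 1 by rewrite invf_le1; lra.
have t20 : 0 <= 2 * theta by lra.
have split l l' : Num.sqrt `|intersection_gap n y l l'|
    <= Num.sqrt `|D1 l l'| + Num.sqrt `|D2 l l'|.
  have -> : intersection_gap n y l l' =
      D1 l l' + pair_functional (fun x => (1 - kappa) * delta R x) n y l l'.
    rewrite /D1 /pair_functional -big_split; apply: eq_bigr => i _ /=.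
    by rewrite -big_split; apply: eq_bigr => j _ /=; rewrite /centered_kernel; ring.
  have -> : `|D2 l l'| =
      `|pair_functional (fun x => (1 - kappa) * delta R x) n y l l'|.
    rewrite /D2 /pair_functional.
    under eq_bigr do rewrite -mulr_sumr.
    under [in RHS]eq_bigr do rewrite -mulr_sumr.
    by rewrite -!mulr_sumr !normrM normr_id.
  move: (D1 l l') (pair_functional _ _ _ _ _) => a c.
  have ab0 : 0 <= `|a| by []; have c0 : 0 <= `|c| by [].
  apply: le_trans (ler_wsqrtr (ler_normD a c)) _.
  rewrite -(@ler_pXn2r _ 2) ?nnegrE ?addr_ge0 ?sqrtr_ge0 //.
  by rewrite sqrrD !sqr_sqrtr ?addr_ge0 // addrAC lerDl mulrn_wge0.
have kk0 : 0 <= 2 * kappa by rewrite mulr_ge0 ?kappa_ge0.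
have bd1 : expect2 L p n (fun l l' => expR (2 * theta * Num.sqrt `|D1 l l'|))
    <= 4 * (1 + s) ^+ n.
  have := @exp_moment_le R _ L p p_ge0 p_sum centered_kernel (2 * kappa)
    centered_kernel_posdef kk0 centered_kernel_le (1 + s)^-1 n y (2 * theta) z0 z1 t20.
  rewrite exprVn invrK; apply.
  apply: le_trans small1; rewrite ler_wpM2l ?sqr_ge0 //.
  exact: (@bridge_sum_le r m).
have bd2 : expect2 L p n (fun l l' => expR (2 * theta * Num.sqrt `|D2 l l'|))
    <= 4 * (1 + s) ^+ n.
  have dp : posdef (fun x : int * int => eta * delta R x).
    by apply: posdef_scale; [exact: normr_ge0|exact: posdef_delta].
  have dp0 : posdef (fun x : int * int => eta * delta R x - eta * delta R x).
    apply: (@posdef_ext _ _ (fun x => 0 * delta R x)) => [x|].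
      by rewrite mul0r subrr.
    by apply: posdef_scale => //; exact: posdef_delta.
  have := @exp_moment_le R _ L p p_ge0 p_sum _ eta dp (normr_ge0 _) dp0
    (1 + s)^-1 n y (2 * theta) z0 z1 t20.
  rewrite exprVn invrK; apply.
  apply: le_trans small2; rewrite ler_wpM2l ?sqr_ge0 //.
  by apply: bridge_sum_delta_le => //; exact: normr_ge0.
apply: (@le_trans _ _ (expect2 L p n (fun l l' =>
    2^-1 * (expR (2 * theta * Num.sqrt `|D1 l l'|)
            + expR (2 * theta * Num.sqrt `|D2 l l'|))))); last first.
  by rewrite expect2_scale expect2D; lra.
apply: le_expect2 => // l l' _ _.
have := ler_wpM2l theta0 (split l l'); rewrite -ler_expR => /le_trans; apply.
rewrite mulrDr expRD -![2 * theta * _]mulrA.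
have expR2 x : expR (2 * x) = expR x ^+ 2 by rewrite -expRM_natl.
move: (theta * Num.sqrt `|D1 l l'|) (theta * Num.sqrt `|D2 l l'|) => u v.
rewrite !expR2; have := sqr_ge0 (expR u - expR v); rewrite sqrrB; lra.
Qed.

End Bridges.

(** * Uniform constants for the truncated walks *)

Section Truncation.
Variables (R : realType) (p : int * int -> R).
Hypotheses (p_ge0 : forall x, 0 <= p x)
  (p_sum_le1 : forall L, uniq L -> \sum_(s <- L) p s <= 1).

(** The steps outside [L] are replaced by the null step. *)
Definition truncated (L : seq (int * int)) (x : int * int) : R :=
  p x + (x == 0)%:R * (1 - \sum_(s <- L) p s).

Lemma le_truncated L x : uniq L -> p x <= truncated L x.
Proof. by move=> uL; rewrite lerDl mulr_ge0 // subr_ge0 p_sum_le1. Qed.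

Lemma truncated_ge0 L x : uniq L -> 0 <= truncated L x.
Proof. by move=> uL; apply: le_trans (p_ge0 x) (le_truncated x uL). Qed.

Lemma truncated_sum L : uniq L -> 0 \in L -> \sum_(s <- L) truncated L s = 1.
Proof.
move=> uL L0; rewrite big_split /= -mulr_suml.
rewrite (_ : \sum_(s <- L) (s == 0)%:R = 1) ?mul1r 1?addrC ?subrK //.
rewrite (bigD1_seq 0) //= big1 ?addr0 // => s.
by case: eqP => // ->; rewrite eqxx.
Qed.

Definition admissible (L0 L : seq (int * int)) : Prop :=
  [/\ uniq L, 0 \in L & {subset L0 <= L}].

Lemma admissible_cat L1 L2 L :
  admissible (L1 ++ L2) L -> admissible L1 L /\ admissible L2 L.
Proof.
move=> [uL L0 sub]; split; split => // x xL; apply: sub;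
  by rewrite mem_cat xL ?orbT.
Qed.

(** The vectors [v] in whose direction the truncated walks spread at a uniform
    rate form a subgroup, since the defect is a squared distance. *)
Definition spreading (v : int * int) : Prop :=
  exists C L0, 0 <= C /\ forall L, admissible L0 L -> forall k,
    heat_defect L (truncated L) k v <= C * heat_drop L (truncated L) k.

Lemma spreading_subgroup : is_subgroup spreading.
Proof.
split.
  exists 0, [::]; split => // L _ k.
  by rewrite /heat_defect subrr mul0r.
move=> x y [C [L1 [C0 h1]]] [D [L2 [D0 h2]]].
exists (2 * C + 2 * D), (L1 ++ L2); split; first by rewrite addr_ge0 ?mulr_ge0.
move=> L /admissible_cat[a1 a2] k.
have [uL L0 _] := a1.
apply: le_trans (heat_defect_sub _ _ _ _ _) _.
have := h1 _ a1 k; have := h2 _ a2 k; rewrite mulrDl; lra.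
Qed.

(** The pair of steps [z], [z0] contributes [p z * p z0] times the defect at
    [z - z0] to the drop. *)
Lemma spreading_sub z z0 : 0 < p z -> 0 < p z0 -> spreading (z - z0).
Proof.
move=> pz pz0; exists (p z * p z0)^-1, [:: z; z0].
have pp : 0 < p z * p z0 by exact: mulr_gt0.
split; first by rewrite invr_ge0 ltW.
move=> L [uL L0 sub] k.
rewrite mulrC ler_pdivlMr // mulrC.
have zL : z \in L by apply: sub; rewrite mem_head.
have z0L : z0 \in L by apply: sub; rewrite !inE eqxx orbT.
apply: le_trans (heat_defect_le_drop (fun x => truncated_ge0 x uL)
  (truncated_sum uL L0) k zL z0L).
rewrite ler_wpM2r ?heat_defect_ge0 //.
by apply: ler_pM => //; apply: le_truncated.
Qed.

(** The differences [z - z0] of possible steps generate the lattice, hence the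
    walks spread in every direction, in particular along the axes. *)
Lemma uniform_heat_bounds (z0 : int * int) : 0 < p z0 ->
    generates_Z2 [set - z0 + z | z in [set z | 0 < p z]] ->
  exists A1 A2 L0, [/\ 0 <= A1, 0 <= A2 & forall L, admissible L0 L ->
    (forall k, heat L (truncated L) k 0 <= A1 / k.+1%:R) /\
    (forall k x, heat_defect L (truncated L) k x
       <= A2 * (l1norm x)%:R ^+ 2 / k.+1%:R ^+ 2)].
Proof.
move=> pz0 gen.
have all v : spreading v.
  have : (setT : set (int * int)) `<=` spreading.
    rewrite -gen; apply: smallest_sub; first exact: spreading_subgroup.
    by move=> _ [z pz <-]; rewrite addrC; exact: spreading_sub.
  exact.
have [C1 [L1 [C10 h1]]] := all (1, 0).
have [C2 [L2 [C20 h2]]] := all (0, 1).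
pose C := C1 + C2.
have C0 : 0 <= C by exact: addr_ge0.
exists (64 * C + 2), (4 * C * (64 * C + 2)), (L1 ++ L2); split.
- by rewrite addr_ge0 ?mulr_ge0.
- by rewrite !mulr_ge0 // addr_ge0 ?mulr_ge0.
move=> L /admissible_cat[a1 a2].
have [uL L0 _] := a1.
have q0 x := truncated_ge0 x uL.
have q1 := truncated_sum uL L0.
have D0 k := heat_drop_ge0 q0 q1 k.
have d1 k : heat_defect L (truncated L) k (1, 0) <= C * heat_drop L (truncated L) k.
  by apply: le_trans (h1 _ a1 k) _; rewrite ler_wpM2r // lerDl.
have d2 k : heat_defect L (truncated L) k (0, 1) <= C * heat_drop L (truncated L) k.
  by apply: le_trans (h2 _ a2 k) _; rewrite ler_wpM2r // lerDr.
by split => [k|k x]; [exact: (heat0_le q0 q1 C0 d1 d2)|exact: (heat_defect_le q0 q1 C0 d1 d2)].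
Qed.

End Truncation.

(** * From the probability space to finitely many paths *)

Section DiscreteExpectation.
Context (R : realType) (d : measure_display) (T : measurableType d)
        (P : probability T R).

Lemma measurable_fun_discrete (d' : measure_display) (U : measurableType d')
    (C : countType) (phi : T -> C) (h : C -> U) :
  (forall c, measurable (phi @^-1` [set c])) ->
  measurable_fun setT (h \o phi).
Proof.
move=> mphi _ Y mY; rewrite setTI.
have -> : (h \o phi) @^-1` Y = \bigcup_(c in h @^-1` Y) phi @^-1` [set c].
  rewrite eqEsubset; split => [w Yw|w [c Yc /= wc]].
    by exists (phi w).
  by rewrite /preimage /= wc.
rewrite bigcup_mkcond; apply: countable_bigcupT_measurable => // c.
by case: ifP => _; [exact: mphi|exact: measurable0].
Qed.

(** Numbering the values of the discrete variable makes its fibers a countable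
    partition of the space. *)
Lemma integral_discrete (mu : {measure set T -> \bar R}) (C : countType)
    (phi : T -> C) (h : C -> R) :
  (forall c, measurable (phi @^-1` [set c])) -> (forall c, 0 <= h c) ->
  (\int[mu]_w (h (phi w))%:E
    = \esum_(c in [set: C]) ((h c)%:E * mu (phi @^-1` [set c])))%E.
Proof.
move=> mphi h0.
pose F k := [set w | choice.pickle (phi w) = k].
have Fpickle c : F (choice.pickle c) = phi @^-1` [set c].
  rewrite eqEsubset; split => w; last by move=> pw; rewrite /F -[c]pw.
  exact: (pcan_inj choice.pickleK).
have Fout k : (forall c : C, choice.pickle c <> k) -> F k = set0.
  by move=> kc; rewrite eqEsubset; split => // w /kc.
have mF k : measurable (F k).
  have [[c <-]|kc] := pselect (exists c : C, choice.pickle c = k).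
    by rewrite Fpickle; exact: mphi.
  by rewrite Fout // => c ck; apply: kc; exists c.
have FT : \bigcup_k F k = setT.
  by rewrite eqEsubset; split => // w _; exists (choice.pickle (phi w)).
have mh : measurable_fun setT (fun w => (h (phi w))%:E : \bar R).
  exact: (measurable_fun_discrete (fun c => (h c)%:E : \bar R) mphi).
rewrite -FT ge0_integral_bigcup //; last 3 first.
- by rewrite FT.
- by move=> w _; rewrite lee_fin.
- apply/trivIsetP => i j _ _ /eqP ij; rewrite eqEsubset; split => // w [Fi Fj].
  by case: ij; exact: etrans (esym Fi) Fj.
rewrite nneseries_esumT; last first.
  by move=> k; apply: integral_ge0 => w _; rewrite lee_fin.
rewrite [RHS](eq_esum (b := fun c => \int[mu]_(w in F (choice.pickle c)) (h (phi w))%:E)%E);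
  last first.
  move=> c _; rewrite Fpickle (eq_integral (fun=> (h c)%:E)) => [|w]; last first.
    by rewrite inE /= => <-.
  by rewrite integral_cst.
rewrite -(@esum_image _ C _ setT choice.pickle
  (fun k => \int[mu]_(w in F k) (h (phi w))%:E)%E); last first.
  by move=> c c' _ _; exact: (pcan_inj choice.pickleK).
rewrite [RHS]esum_mkcond; apply: eq_esum => k _; case: ifPn => //.
rewrite notin_setE => kc; rewrite Fout ?integral_set0 // => c ck.
by apply: kc; exists c.
Qed.

Lemma esum_le_seq (C : choiceType) (a : C -> \bar R) (x : \bar R) :
  (forall s : seq C, uniq s -> (\sum_(c <- s) a c <= x)%E) ->
  (\esum_(c in [set: C]) a c <= x)%E.
Proof.
move=> h; apply: ge_ereal_sup => _ [A [finA _] <-].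
by rewrite fsbig_finite //=; apply: h; exact: fset_uniq.
Qed.

Lemma seq_le_esum (C : choiceType) (a : C -> \bar R) (s : seq C) :
  uniq s -> (\sum_(c <- s) a c <= \esum_(c in [set: C]) a c)%E.
Proof.
move=> us; apply: esum_ge; exists [set` s]; last by rewrite fsbig_seq.
by split.
Qed.

Lemma expectation_discrete_le (C : countType) (phi : T -> C) (h : C -> R)
    (a : R) :
  (forall c, measurable (phi @^-1` [set c])) -> (forall c, 0 <= h c) ->
  (forall s : seq C, uniq s ->
     \sum_(c <- s) h c * fine (P (phi @^-1` [set c])) <= a) ->
  ('E_P[h \o phi] <= a%:E)%E.
Proof.
move=> mphi h0 hs; rewrite unlock (integral_discrete P mphi h0).
apply: esum_le_seq => s us; have := hs s us; rewrite -lee_fin -sumEFin.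
apply: le_trans; rewrite le_eqVlt; apply/orP; left; apply/eqP.
by apply: eq_bigr => c _; rewrite EFinM fineK // fin_num_measure.
Qed.

End DiscreteExpectation.

Section WalkPaths.
Context (R : realType) (d : measure_display) (T : measurableType d)
        (P : probability T R).
Implicit Types S : nat -> T -> int * int.

Definition step_prob S (x : int * int) : R := fine (P (S 1%N @^-1` [set x])).

Definition increments S n w : seq (int * int) :=
  [seq increment S k w | k <- iota 0 n].

Lemma position_increments S n w j : random_walk P S -> (j <= n)%N ->
  position j (increments S n w) = S j w.
Proof.
move=> wS jn; rewrite /position /increments -map_take take_iota (minn_idPl jn).
rewrite big_map; elim: j jn => [|j IH] jn; first by rewrite big_nil (rw_start wS).
rewrite -addn1 iotaD big_cat big_seq1 add0n addn1 IH 1?ltnW //=.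
by rewrite /increment addrC subrK.
Qed.

Lemma increments_eq S n w l : random_walk P S -> size l = n ->
  increments S n w = l <-> forall j, (j <= n)%N -> S j w = position j l.
Proof.
move=> wS zl; split => [<- j jn|h]; first by rewrite position_increments.
apply: (@eq_from_nth _ 0); first by rewrite size_map size_iota zl.
rewrite size_map size_iota => k kn.
rewrite (nth_map 0%N) ?size_iota // nth_iota // add0n /increment !h //; last exact: ltnW.
rewrite /position (take_nth 0) ?zl // -cats1 big_cat big_seq1 /=.
by rewrite addrAC subrr add0r.
Qed.

Definition initial (m : nat) : {fset nat} := [fset j | j in iota 0 m]%fset.

Lemma mem_initial m k : (k \in initial m) = (k < m)%N.
Proof.
apply/imfsetP/idP => [[j /=]|km]; first by rewrite mem_iota => /andP[_ jm] ->.
by exists k => //=; rewrite mem_iota.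
Qed.

Lemma cylinder_position S n l : random_walk P S -> size l = n ->
  [set w | increments S n w = l] =
  cylinder S (initial n.+1) (fun j => [set position j l]).
Proof.
move=> wS zl; rewrite eqEsubset; split => w.
  move/(increments_eq w wS zl) => h j /=; rewrite mem_initial ltnS.
  exact: h.
move=> h; apply/(increments_eq w wS zl) => j jn.
by apply: (h j); rewrite /= mem_initial.
Qed.

Lemma prob_increments S n l : random_walk P S -> size l = n ->
  P [set w | increments S n w = l] = (\prod_(s <- l) step_prob S s)%:E.
Proof.
move=> wS zl.
have -> : [set w | increments S n w = l] =
    cylinder (increment S) (initial n) (fun j => [set nth 0 l j]).
  rewrite eqEsubset; split => w.
    move=> /= wl j /=; rewrite mem_initial => jn.
    by rewrite -wl (nth_map 0%N) ?size_iota // nth_iota.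
  move=> h; apply: (@eq_from_nth _ 0); first by rewrite size_map size_iota zl.
  rewrite size_map size_iota => k kn.
  rewrite (nth_map 0%N) ?size_iota // nth_iota // add0n.
  by apply: (h k); rewrite /= mem_initial.
rewrite (rw_independent wS).
have one x k : P (increment S k @^-1` [set x]) = (step_prob S x)%:E.
  rewrite (rw_identical wS) /step_prob fineK; last first.
    apply: fin_num_measure; exact: (rw_measurable wS).
  congr (P _); rewrite eqEsubset; split => w /=;
    by rewrite /increment (rw_start wS) subr0.
rewrite (eq_bigr (fun k => (step_prob S (nth 0 l k))%:E)) => [|k _]; last exact: one.
rewrite prodEFin; congr (_%:E).
rewrite (perm_big (iota 0 n)) /=.
  by rewrite -[in RHS](mkseq_nth 0 l) /mkseq big_map zl.
apply: uniq_perm; rewrite ?iota_uniq ?fset_uniq // => k.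
by rewrite mem_initial mem_iota.
Qed.

End WalkPaths.

Section Transfer.
Context (R : realType) (d : measure_display) (T : measurableType d)
        (P : probability T R) (S1 S2 : nat -> T -> int * int).
Hypotheses (S1_walk : random_walk P S1) (S2_walk : random_walk P S2)
  (S12_copies : same_law P S1 S2) (S12_independent : independent_processes P S1 S2).
Local Notation p := (step_prob P S1).

Lemma step_prob_ge0 x : 0 <= p x.
Proof. exact: fine_ge0. Qed.

Lemma step_prob_sum_le1 L : uniq L -> \sum_(s <- L) p s <= 1.
Proof.
move=> uL; rewrite -lee_fin -sumEFin.
have mS x : measurable (S1 1%N @^-1` [set x]) by exact: (rw_measurable S1_walk).
have mU M : measurable (\big[setU/set0]_(s <- M) (S1 1%N @^-1` [set s])).
  by apply: bigsetU_measurable => x _; exact: mS.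
rewrite (eq_bigr (fun s => P (S1 1%N @^-1` [set s]))); last first.
  by move=> s _; rewrite /step_prob fineK // fin_num_measure.
have <- : P (\big[setU/set0]_(s <- L) (S1 1%N @^-1` [set s])) =
    (\sum_(s <- L) P (S1 1%N @^-1` [set s]))%E.
  elim: L uL => [|x L IH] /=; first by rewrite !big_nil measure0.
  case/andP => xL uL; rewrite !big_cons.
  rewrite -(IH uL); apply: measureU; [exact: mS|exact: mU|].
  rewrite eqEsubset; split => // w [/= wx].
  rewrite -bigcup_seq => -[y /= yL wy].
  by move: xL; rewrite -wx wy yL.
exact: probability_le1.
Qed.

Lemma measurable_increments (S : nat -> T -> int * int) n l : random_walk P S ->
  measurable [set w | increments S n w = l].
Proof.
move=> wS; have [zl|zl] := eqVneq (size l) n.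
  rewrite (cylinder_position wS zl); apply: bigcap_measurable.
    by exists 0%N; rewrite /= mem_initial.
  by move=> k _; exact: (rw_measurable wS).
rewrite (_ : [set w | _] = set0) // eqEsubset; split => // w /= e.
by move: zl; rewrite -e size_map size_iota eqxx.
Qed.

Lemma prob_increments2 n l l' : size l = n -> size l' = n ->
  P [set w | increments S1 n w = l /\ increments S2 n w = l'] =
  (weight p l * weight p l')%:E.
Proof.
move=> zl zl'.
have -> : [set w | increments S1 n w = l /\ increments S2 n w = l'] =
    [set w | increments S1 n w = l] `&` [set w | increments S2 n w = l'].
  by [].
rewrite (cylinder_position S1_walk zl) (cylinder_position S2_walk zl').
rewrite S12_independent -S12_copies.
rewrite -(cylinder_position S1_walk zl) -(cylinder_position S1_walk zl').
by rewrite !prob_increments // EFinM.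
Qed.

(** A partial sum of the expectation involves finitely many pairs of paths. Once
    [L] contains all their steps, the truncated walk gives them at least the
    probability that they have for the original one. *)
Lemma expectation_le_truncated n (h : seq (int * int) -> seq (int * int) -> R) a L0 :
    (forall l l', 0 <= h l l') ->
    (forall L, admissible L0 L -> expect2 L (truncated p L) n h <= a) ->
  ('E_P[fun w => h (increments S1 n w) (increments S2 n w)] <= a%:E)%E.
Proof.
move=> h0 ha.
pose C : countType := (seq (int * int) * seq (int * int))%type.
pose phi w : C := (increments S1 n w, increments S2 n w).
have phiE (c : C) : phi @^-1` [set c] =
    [set w | increments S1 n w = c.1 /\ increments S2 n w = c.2].
  case: c => l l'; rewrite eqEsubset; split => w; [by case=> <- <-|].
  by move=> [/= e1 e2]; rewrite /preimage /phi /= e1 e2.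
apply: (@expectation_discrete_le _ _ _ P C phi (fun c : C => h c.1 c.2)) => //.
  by move=> c; rewrite phiE; apply: measurableI; exact: measurable_increments.
move=> s us.
pose L := undup (0 :: L0 ++ flatten [seq c.1 ++ c.2 | c <- s]).
have aL : admissible L0 L.
  split; first exact: undup_uniq.
    by rewrite mem_undup mem_head.
  by move=> x xL; rewrite mem_undup inE mem_cat xL orbT.
apply: le_trans (ha L aL).
have uL : uniq L by exact: undup_uniq.
have q0 x : 0 <= truncated p L x.
  exact: (truncated_ge0 step_prob_ge0 step_prob_sum_le1 x uL).
have pq x : p x <= truncated p L x.
  exact: (le_truncated step_prob_sum_le1 x uL).
have wle l : 0 <= weight p l <= weight (truncated p L) l.
  rewrite weight_ge0; last by exact: step_prob_ge0.
  by apply: ler_prod => x _; rewrite step_prob_ge0 pq.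
pose good (c : C) := (size c.1 == n) && (size c.2 == n).
rewrite (bigID good) /= [X in _ + X]big1 ?addr0; last first.
  move=> c cn; rewrite phiE (_ : [set w | _] = set0) ?measure0 ?mulr0 //.
  rewrite eqEsubset; split => // w [/= e1 e2]; move: cn.
  by rewrite /good -e1 -e2 !size_map size_iota eqxx.
pose W := words L n.
have -> : expect2 L (truncated p L) n h = \sum_(c <- [seq (l, l') | l <- W, l' <- W])
    h c.1 c.2 * (weight (truncated p L) c.1 * weight (truncated p L) c.2).
  rewrite expect2_quadratic /quadratic big_allpairs_dep; apply: eq_bigr => l _.
  by apply: eq_bigr => l' _; rewrite mulrC.
rewrite -big_filter.
apply: (@le_trans _ _ (\sum_(c <- [seq c <- s | good c])
    h c.1 c.2 * (weight (truncated p L) c.1 * weight (truncated p L) c.2))).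
  rewrite big_seq [leRHS]big_seq; apply: ler_sum => c.
  rewrite mem_filter => /andP[/andP[/eqP z1 /eqP z2] cs].
  rewrite ler_wpM2l // phiE prob_increments2 //=.
  by have /andP[? ?] := wle c.1; have /andP[? ?] := wle c.2; apply: ler_pM.
apply: ler_sum_subset.
- exact: filter_uniq.
- apply: allpairs_uniq; rewrite ?words_uniq // => -[a1 a2] [b1 b2] _ _ /= [-> ->] //.
- move=> [l l']; rewrite mem_filter => /andP[/andP[/= z1 z2] cs].
  apply: allpairs_f; rewrite mem_words ?z1 ?z2 /=; apply/allP => x xl;
    rewrite mem_undup inE mem_cat; apply/orP; right; apply/orP; right;
    apply/flattenP; exists (l ++ l'); rewrite ?mem_cat ?xl ?orbT //;
    by apply/mapP; exists (l, l').
- move=> c; have /andP[w1 w1'] := wle c.1; have /andP[w2 w2'] := wle c.2.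
  by rewrite !mulr_ge0 //; [exact: le_trans w1'|exact: le_trans w2'].
Qed.

(** Otherwise the support of the step would generate the trivial subgroup. *)
Lemma exists_step : generates_Z2 (step_support P S1) -> exists z0, 0 < p z0.
Proof.
move=> gen; apply/not_existsP => none.
have : (setT : set (int * int)) `<=` [set 0].
  rewrite -gen; apply: smallest_sub.
    by split => // x y -> ->; rewrite subr0.
  move=> z /= Pz; exfalso; apply: (none z).
  rewrite /step_prob fine_gt0 // Pz /=.
  by rewrite ltey_eq fin_num_measure //; exact: (rw_measurable S1_walk).
by move=> /(_ (1, 0) I).
Qed.

Lemma step_supportE : step_support P S1 = [set z | 0 < p z].
Proof.
rewrite eqEsubset; split => z; rewrite /step_support /= /step_prob.
  by move=> Pz; rewrite fine_gt0 // Pz ltey_eq fin_num_measure //;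
    exact: (rw_measurable S1_walk).
rewrite lt_def => /andP[Pz _]; rewrite lt_def measure_ge0 andbT.
by apply: contraNneq Pz => ->.
Qed.

End Transfer.

(** * Riemann sums over the lattice *)

Section RiemannSums.
Variable R : realType.
Local Notation mu2 := ((@lebesgue_measure R \x @lebesgue_measure R)%E).
Implicit Types (F : R * R -> R) (r : R) (u : R * R).

Definition lattice_floor r u : int * int :=
  (Num.floor (r * u.1), Num.floor (r * u.2)).

Lemma lattice_floor_fiber r (x : int * int) : 0 < r ->
  lattice_floor r @^-1` [set x] =
  `[x.1%:~R / r, (x.1 + 1)%:~R / r[%classic `*`
  `[x.2%:~R / r, (x.2 + 1)%:~R / r[%classic.
Proof.
move=> r0; have cell (t : R) (i : int) :
    (Num.floor (r * t) = i) <-> t \in `[i%:~R / r, (i + 1)%:~R / r[.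
  rewrite in_itv /= ler_pdivrMr // ltr_pdivlMr // (mulrC t).
  by split => [/eqP|h]; [|apply/eqP]; rewrite floor_eq.
case: x => i j; rewrite eqEsubset; split => -[a c] /=.
  by case=> /cell ? /cell ?.
by move=> [/= /cell ha /cell hc]; rewrite /preimage /lattice_floor /= ha hc.
Qed.

Lemma measurable_lattice_floor r (x : int * int) : 0 < r ->
  measurable (lattice_floor r @^-1` [set x]).
Proof. by move=> r0; rewrite lattice_floor_fiber //; exact: measurableX. Qed.

Lemma lattice_floor_measure r (x : int * int) : 0 < r ->
  mu2 (lattice_floor r @^-1` [set x]) = (r ^- 2)%:E.
Proof.
move=> r0; rewrite lattice_floor_fiber // product_measure1E //=.
rewrite !lebesgue_measure_itv /= !lte_fin.
have cell (i : int) : i%:~R / r < (i + 1)%:~R / r.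
  by rewrite ltr_pM2r ?invr_gt0 // ltr_int ltrDl.
rewrite !cell -!EFinB -EFinM; congr (_%:E).
by rewrite !intrD; field; rewrite gt_eqF.
Qed.

Definition lattice_point r (x : int * int) : R * R := r^-1 *: Z2_to_R2 R x.

(** The integrand is constant on the cells of the lattice of mesh [1 / r],
    whose area is [r ^- 2]. *)
Lemma riemann_sum_integral F r : 0 < r -> (forall u, 0 <= F u) ->
  (\esum_(x in [set: int * int]) (r ^- 2 * F (lattice_point r x))%:E =
   \int[mu2]_u (F (lattice_point r (lattice_floor r u)))%:E)%E.
Proof.
move=> r0 F0.
rewrite (@integral_discrete _ _ _ (mu2) _ (lattice_floor r)
  (fun x => F (lattice_point r x))) //; last first.
  by move=> x; exact: measurable_lattice_floor.
apply: eq_esum => x _; rewrite mulrC EFinM; congr (_ * _)%E.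
by apply/esym; exact: lattice_floor_measure.
Qed.

Lemma oneDsqrV_ge0 (t : R) : 0 <= (oneDsqr t)^-1.
Proof. by rewrite invr_ge0 (le_trans ler01) ?oneDsqr_ge1. Qed.

(** An integrable majorant, in product form so that its integral is a product
    of two arctangent integrals. *)
Definition envelope u : R := (oneDsqr u.1)^-1 * (oneDsqr u.2)^-1.

Lemma envelope_ge0 u : 0 <= envelope u.
Proof. by rewrite mulr_ge0 ?oneDsqrV_ge0. Qed.

Lemma integral_oneDsqrV : (\int[@lebesgue_measure R]_t ((oneDsqr t)^-1)%:E = pi%:E)%E.
Proof.
rewrite (@ge0_symfun_integralT R (fun t => (oneDsqr t)^-1)).
- rewrite (_ : [set x | _] = `[0, +oo[%classic); last first.
    by apply/seteqP; split => x /=; rewrite in_itv /= andbT.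
  by rewrite integral0y_oneDsqr -EFinM mulrCA divff ?mulr1.
- by move=> t; exact: oneDsqrV_ge0.
- exact: continuous_oneDsqrV.
- by move=> t /=; rewrite /oneDsqr sqrrN.
Qed.

Lemma measurable_envelope : measurable_fun setT (fun u => (envelope u)%:E).
Proof.
have mw : measurable_fun setT (fun t : R => (oneDsqr t)^-1).
  by apply: continuous_measurable_fun; exact: continuous_oneDsqrV.
apply/measurable_EFinP; apply: measurable_funM.
  exact: (measurableT_comp mw measurable_fst).
exact: (measurableT_comp mw measurable_snd).
Qed.

Lemma integral_envelope :
  (\int[mu2]_u (envelope u)%:E = (pi * pi)%:E)%E.
Proof.
have w0 := oneDsqrV_ge0.
have mw : measurable_fun setT (fun t : R => ((oneDsqr t)^-1)%:E).
  apply/measurable_EFinP; apply: continuous_measurable_fun.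
  exact: continuous_oneDsqrV.
rewrite fubini_tonelli1 /fubini_F //=; last 2 first.
- exact: measurable_envelope.
- by move=> u; rewrite lee_fin envelope_ge0.
transitivity (\int[@lebesgue_measure R]_t (pi%:E * ((oneDsqr t)^-1)%:E))%E.
  apply: eq_integral => t _; rewrite muleC -integral_oneDsqrV -ge0_integralZl //.
rewrite ge0_integralZl //; first by rewrite integral_oneDsqrV EFinM.
by rewrite lee_fin pi_ge0.
Qed.

(** On a cell of side at most 1 the envelope varies by a bounded factor. *)
Lemma envelope_lattice_floor r u : 1 <= r ->
  envelope (lattice_point r (lattice_floor r u)) <= 9 * envelope u.
Proof.
move=> r1; have r0 : 0 < r by lra.
have one (t : R) :
    (oneDsqr (r^-1 * (Num.floor (r * t))%:~R))^-1 <= 3 * (oneDsqr t)^-1.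
  set v := r^-1 * _.
  have fl := floor_le (r * t); have fu := floorD1_gt (r * t).
  have vt : v <= t by rewrite /v ler_pdivrMl.
  have tv : t <= v + 1.
    rewrite -(ler_pM2l r0) mulrDr /v mulVKf ?gt_eqF // mulr1.
    apply: le_trans (ltW fu) _; by rewrite intrD lerD2l.
  rewrite /oneDsqr ler_pdivlMr ?(lt_le_trans ltr01) ?lerDl ?sqr_ge0 //.
  rewrite mulrC -ler_pdivlMr ?invr_gt0 ?(lt_le_trans ltr01) ?lerDl ?sqr_ge0 //.
  by rewrite invrK; have := sqr_ge0 (v - 1); have := sqr_ge0 (2 * v - t);
    have := sqr_ge0 (t - v - 1); nra.
have -> : 9 * envelope u = 3 * (oneDsqr u.1)^-1 * (3 * (oneDsqr u.2)^-1).
  by rewrite /envelope; ring.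
by apply: ler_pM; rewrite ?oneDsqrV_ge0 //; exact: one.
Qed.

End RiemannSums.

Section RiemannSumLimits.
Variables (R : realType) (F : R * R -> R) (M : R).
Hypotheses (M_ge0 : 0 <= M) (F_ge0 : forall u, 0 <= F u)
  (F_le : forall u, F u <= M * envelope u).
Local Notation mu2 := ((@lebesgue_measure R \x @lebesgue_measure R)%E).

Definition riemann_sum (r : R) : \bar R :=
  (\esum_(x in [set: int * int]) (r ^- 2 * F (lattice_point r x))%:E)%E.

Let step_function r u := F (lattice_point r (lattice_floor r u)).

Lemma measurable_step_function r : 0 < r ->
  measurable_fun setT (fun u => (step_function r u)%:E : \bar R).
Proof.
move=> r0; apply: (measurable_fun_discrete
  (fun x => (F (lattice_point r x))%:E : \bar R) (phi := lattice_floor r)).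
by move=> x; exact: measurable_lattice_floor.
Qed.

Lemma step_function_le r u : 1 <= r -> step_function r u <= 9 * M * envelope u.
Proof.
move=> r1; apply: le_trans (F_le _) _.
rewrite (mulrC 9) -mulrA ler_wpM2l //; exact: envelope_lattice_floor.
Qed.

Lemma integral_scaled_envelope :
  (\int[mu2]_u (9 * M * envelope u)%:E = (9 * M * (pi * pi))%:E)%E.
Proof.
under eq_integral do rewrite EFinM.
rewrite ge0_integralZl //.
- by rewrite integral_envelope.
- exact: measurable_envelope.
- by move=> u _; rewrite lee_fin envelope_ge0.
- by rewrite lee_fin mulr_ge0.
Qed.

Lemma measurable_scaled_envelope :
  measurable_fun setT (fun u => (9 * M * envelope u)%:E : \bar R).
Proof.
under eq_fun do rewrite EFinM.
by apply: measurable_funeM; exact: measurable_envelope.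
Qed.

Lemma riemann_sum_le r : 1 <= r -> (riemann_sum r <= (9 * M * (pi * pi))%:E)%E.
Proof.
move=> r1; have r0 : 0 < r by lra.
rewrite /riemann_sum riemann_sum_integral // -integral_scaled_envelope.
apply: ge0_le_integral => //.
- by move=> u _; rewrite lee_fin.
- exact: measurable_step_function.
- exact: measurable_scaled_envelope.
- by move=> u _; rewrite lee_fin step_function_le.
Qed.

(** The step functions converge pointwise to [F], as the cells shrink, and the
    multiple [9 * M] of the envelope dominates them all. *)
Lemma riemann_sum_cvg (r : nat -> R) :
    (forall u, {for u, continuous F}) -> (forall n, 1 <= r n) ->
    r n @[n --> \oo] --> +oo ->
  riemann_sum (r n) @[n --> \oo] --> (\int[mu2]_u (F u)%:E)%E.
Proof.
move=> F_cont r1 roo.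
have r0 n : 0 < r n by apply: lt_le_trans (r1 n).
under eq_fun do rewrite /riemann_sum riemann_sum_integral //.
have point_cvg u : lattice_point (r n) (lattice_floor (r n) u) @[n --> \oo] --> u.
  have coord (t : R) : (r n)^-1 * (Num.floor (r n * t))%:~R @[n --> \oo] --> t.
    apply: (@squeeze_cvgr _ _ _ _ (fun n => t - (r n)^-1) (fun=> t)).
    - apply: nearW => n.
      have fl := floor_le (r n * t); have := floorD1_gt (r n * t).
      rewrite intrD => fu; rewrite ler_pdivrMl // fl andbT.
      rewrite ler_pdivlMl // mulrBr mulfV ?gt_eqF //; lra.
    - rewrite -[X in _ --> X]subr0; apply: cvgB; first exact: cvg_cst.
      by apply/gtr0_cvgV0 => //; exact: nearW.
    - exact: cvg_cst.
  case: u => a c; exact: cvg_pair (coord a) (coord c).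
have ptw u : (step_function (r n) u)%:E @[n --> \oo] --> (F u)%:E.
  apply: cvg_EFin; first by apply: nearW.
  exact: (cvg_comp _ _ (point_cvg u) (F_cont u)).
have mstep n := measurable_step_function (r0 n).
have mF : measurable_fun setT (fun u => (F u)%:E).
  by apply: (emeasurable_fun_cvg (fun n u => (step_function (r n) u)%:E)) => // u _.
have [] := @dominated_convergence _ _ _ mu2 setT measurableT
  (fun n u => (step_function (r n) u)%:E) (fun u => (F u)%:E)
  (fun u => (9 * M * envelope u)%:E) mstep mF.
- by apply: aeW => u _; exact: ptw.
- apply/integrableP; split; first exact: measurable_scaled_envelope.
  under eq_integral do rewrite abse_EFin ger0_norm ?mulr_ge0 ?envelope_ge0 //.
  by rewrite integral_scaled_envelope ltry.
- apply: aeW => u n _; rewrite abse_EFin lee_fin ger0_norm ?F_ge0 //.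
  exact: step_function_le.
- by move=> _ _.
Qed.

End RiemannSumLimits.

(** * The self-convolution of a summable function on the lattice *)

Section SelfConvolution.
Variable R : realType.

Lemma esum_scale (C : choiceType) (c : R) (a : C -> \bar R) :
    0 <= c -> (forall x, (0 <= a x)%E) ->
  (\esum_(x in [set: C]) (c%:E * a x) = c%:E * \esum_(x in [set: C]) a x)%E.
Proof.
move=> c0 a0; have half (c' : R) (a' : C -> \bar R) : 0 <= c' ->
    (forall x, (0 <= a' x)%E) ->
    (\esum_(x in [set: C]) (c'%:E * a' x) <= c'%:E * \esum_(x in [set: C]) a' x)%E.
  move=> c'0 a'0; apply: esum_le_seq => s us.
  rewrite -ge0_sume_distrr => [|x _ //].
  by rewrite lee_wpmul2l ?lee_fin // seq_le_esum.
have [->|c_neq0] := eqVneq c 0.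
  by rewrite mul0e esum1 // => x _; rewrite mul0e.
have {}c0 : 0 < c by rewrite lt_def c_neq0.
apply/eqP; rewrite eq_le half ?(ltW c0) //=.
rewrite -lee_pdivlMl //; apply: le_trans (half _ _ _ _); last 2 first.
- by rewrite invr_ge0 ltW.
- by move=> x; rewrite mule_ge0 // lee_fin ltW.
by apply: le_esum => x _; rewrite muleA -EFinM mulVf ?mul1e // gt_eqF.
Qed.

Variables (g : int * int -> R) (G H : R).
Hypotheses (g_ge0 : forall x, 0 <= g x) (g_even : forall x, g (- x) = g x)
  (g_sum : (\esum_(x in [set: int * int]) (g x)%:E = G%:E)%E)
  (g_second : (\esum_(x in [set: int * int]) (g x * (l1norm x)%:R ^+ 2)%:E <= H%:E)%E).

Definition self_convolution (y : int * int) : R :=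
  fine (\esum_(x in [set: int * int]) (g x * g (y - x))%:E)%E.

Lemma G_ge0 : 0 <= G.
Proof. by rewrite -lee_fin -g_sum esum_ge0 // => x _; rewrite lee_fin. Qed.

Lemma g_le_sum x : g x <= G.
Proof.
rewrite -lee_fin -g_sum; have := @seq_le_esum R _ (fun x => (g x)%:E) [:: x] isT.
by rewrite big_seq1.
Qed.

Lemma esum_translate (a : int * int -> \bar R) (v : int * int) :
  (\esum_(y in [set: int * int]) a (y - v)%R = \esum_(y in [set: int * int]) a y)%E.
Proof.
rewrite [RHS](@reindex_esum _ _ _ setT setT (fun y => y - v)) //.
split => //; first by move=> x y _ _ /addIr.
by move=> y _; exists (y + v) => //; rewrite addrK.
Qed.

Lemma esum_opp (a : int * int -> \bar R) :
  (\esum_(y in [set: int * int]) a (- y)%R = \esum_(y in [set: int * int]) a y)%E.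
Proof.
by rewrite [RHS](@reindex_esum _ _ _ setT setT (fun y => - y)).
Qed.

Lemma esum_exchange (a : int * int -> int * int -> \bar R) :
  (forall x y, (0 <= a x y)%E) ->
  (\esum_(x in [set: int * int]) \esum_(y in [set: int * int]) a x y =
   \esum_(y in [set: int * int]) \esum_(x in [set: int * int]) a x y)%E.
Proof.
move=> a0; rewrite !esum_esum //.
rewrite (@reindex_esum _ _ _ (setT `*`` fun=> setT) _ (fun k => (k.2, k.1))) //=.
split => //=.
  by move=> [x y] [x' y'] _ _ /= [-> ->].
by move=> [x y] _; exists (y, x).
Qed.

Lemma self_convolution_fin y : ((self_convolution y)%:E =
  \esum_(x in [set: int * int]) (g x * g (y - x))%:E)%E.
Proof.
rewrite /self_convolution fineK // ge0_fin_numE; last first.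
  by apply: esum_ge0 => x _; rewrite lee_fin mulr_ge0.
apply: (@le_lt_trans _ _ (G%:E * G%:E)%E); last by rewrite -EFinM ltry.
rewrite -[X in (_ * X)%E]g_sum -esum_scale ?G_ge0 //; apply: le_esum => x _.
by rewrite -EFinM lee_fin mulrC ler_wpM2r // g_le_sum.
Qed.

Lemma self_convolution_ge0 y : 0 <= self_convolution y.
Proof. by apply/fine_ge0/esum_ge0 => x _; rewrite lee_fin mulr_ge0. Qed.

Lemma self_convolution_even y : self_convolution (- y) = self_convolution y.
Proof.
rewrite /self_convolution; congr fine; rewrite -esum_opp.
by apply: eq_esum => x _; rewrite g_even -opprD g_even.
Qed.

(** Tonelli's theorem and the invariance of the sum under translation. *)
Lemma esum_convolution (h k : int * int -> R) (A B : \bar R) :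
    (forall x, 0 <= h x) -> (forall x, 0 <= k x) ->
    (\esum_(x in [set: int * int]) (h x)%:E = A)%E ->
    (\esum_(x in [set: int * int]) (k x)%:E = B)%E -> B \is a fin_num ->
  (\esum_(y in [set: int * int]) \esum_(x in [set: int * int])
     (h x * k (y - x))%:E = B * A)%E.
Proof.
move=> h0 k0 hA kB Bfin; rewrite esum_exchange; last first.
  by move=> x y; rewrite lee_fin mulr_ge0.
have -> : (\esum_(x in [set: int * int]) \esum_(y in [set: int * int])
    (h x * k (y - x))%:E = \esum_(x in [set: int * int]) (fine B)%:E * (h x)%:E)%E.
  apply: eq_esum => x _; under eq_esum do rewrite EFinM.
  rewrite esum_scale // => [|y]; last by rewrite lee_fin.
  have -> : (\esum_(y in [set: int * int]) (k (y - x))%:E = B)%E.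
    by rewrite -kB; exact: esum_translate (fun z => (k z)%:E) x.
  by rewrite muleC fineK.
rewrite esum_scale ?hA ?fineK //.
by rewrite fine_ge0 // -kB esum_ge0 // => x _; rewrite lee_fin.
Qed.

Lemma self_convolution_sum :
  (\esum_(y in [set: int * int]) (self_convolution y)%:E = (G ^+ 2)%:E)%E.
Proof.
under eq_esum do rewrite self_convolution_fin.
by rewrite (esum_convolution _ _ g_sum g_sum) // expr2 EFinM.
Qed.

Lemma self_convolution_sum_le U : uniq U ->
  \sum_(u <- U) self_convolution u <= G ^+ 2.
Proof.
move=> uU; rewrite -lee_fin -sumEFin -self_convolution_sum.
exact: seq_le_esum.
Qed.

Lemma self_convolution_sum_ge e : 0 < e ->
  exists2 U, uniq U & G ^+ 2 - e <= \sum_(u <- U) self_convolution u.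
Proof.
move=> e0; apply: contrapT => none.
have : (\esum_(y in [set: int * int]) (self_convolution y)%:E <= (G ^+ 2 - e)%:E)%E.
  apply: esum_le_seq => U uU; rewrite sumEFin lee_fin leNgt; apply/negP => h.
  by apply: none; exists U => //; exact: ltW.
by rewrite self_convolution_sum lee_fin; lra.
Qed.

(** [|y|^2 <= 2 |x|^2 + 2 |y - x|^2] splits the second moment into two
    convolutions with a weight on one factor. *)
Lemma self_convolution_second U : uniq U ->
  \sum_(u <- U) self_convolution u * (l1norm u)%:R ^+ 2 <= 4 * G * H.
Proof.
move=> uU; rewrite -lee_fin -sumEFin; apply: le_trans (seq_le_esum _ uU) _.
pose h x : R := g x * (l1norm x)%:R ^+ 2.
have h0 x : 0 <= h x by rewrite mulr_ge0 ?exprn_ge0.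
have hfin : (\esum_(x in [set: int * int]) (h x)%:E)%E \is a fin_num.
  rewrite ge0_fin_numE; first exact: le_lt_trans g_second (ltry _).
  by apply: esum_ge0 => x _; rewrite lee_fin.
apply: (@le_trans _ _ (\esum_(y in [set: int * int]) (2%:E *
   (\esum_(x in [set: int * int]) (h x * g (y - x))%:E +
    \esum_(x in [set: int * int]) (g x * h (y - x))%:E)))%E).
  apply: le_esum => y _.
  rewrite -esumD; last 2 first.
  - by move=> x _; rewrite lee_fin mulr_ge0.
  - by move=> x _; rewrite lee_fin mulr_ge0.
  rewrite EFinM self_convolution_fin muleC.
  rewrite -[leLHS]esum_scale ?exprn_ge0 //; last by move=> x; rewrite lee_fin mulr_ge0.
  rewrite -esum_scale //; last first.
    by move=> x; rewrite -EFinD lee_fin addr_ge0 // mulr_ge0.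
  apply: le_esum => x _; rewrite -EFinD -!EFinM lee_fin /h.
  have gg0 : 0 <= g x * g (y - x) by rewrite mulr_ge0.
  rewrite [leRHS](_ : _ = 2 * ((l1norm x)%:R ^+ 2 + (l1norm (y - x))%:R ^+ 2)
      * (g x * g (y - x))); last by ring.
  rewrite ler_wpM2r //.
  have tri : (l1norm y)%:R <= (l1norm x)%:R + (l1norm (y - x))%:R :> R.
    by rewrite -natrD ler_nat /l1norm /=; lia.
  have := sqr_ge0 ((l1norm x)%:R - (l1norm (y - x))%:R : R).
  have : (l1norm y)%:R ^+ 2 <= ((l1norm x)%:R + (l1norm (y - x))%:R) ^+ 2 :> R.
    by rewrite ler_pXn2r ?nnegrE ?addr_ge0.
  by rewrite sqrrD sqrrB; lra.
rewrite esum_scale //; last first.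
  by move=> y; rewrite adde_ge0 // esum_ge0 // => x _; rewrite lee_fin mulr_ge0.
rewrite esumD; last 2 first.
- by move=> y _; apply: esum_ge0 => x _; rewrite lee_fin mulr_ge0.
- by move=> y _; apply: esum_ge0 => x _; rewrite lee_fin mulr_ge0.
rewrite (esum_convolution h0 g_ge0 erefl g_sum) //.
rewrite (esum_convolution g_ge0 h0 g_sum erefl) //.
rewrite -(fineK hfin) -!EFinM lee_fin.
have : fine (\esum_(x in [set: int * int]) (h x)%:E)%E <= H.
  by rewrite -lee_fin fineK.
by have := G_ge0 => G0 /(ler_wpM2l G0); lra.
Qed.

End SelfConvolution.

(** * Schwartz functions *)

Section SchwartzDecay.
Variables (R : realType) (f : R * R -> R).
Hypotheses (f_pos : forall x, 0 < f x) (f_schwartz : schwartz f).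

Lemma schwartz_continuous u : {for u, continuous f}.
Proof. exact/differentiable_continuous/(f_schwartz.1 [::]). Qed.

Lemma schwartz_moment a c : exists2 M, 0 <= M &
  forall u : R * R, u.1 ^+ a.*2 * u.2 ^+ c.*2 * f u <= M.
Proof.
have [M hM] := f_schwartz.2 a.*2 c.*2 [::].
exists M => [|u]; first exact: le_trans (normr_ge0 _) (hM (0, 0)).
exact: le_trans (ler_norm _) (hM u).
Qed.

Lemma le_envelope (F : R * R -> R) M u :
  F u * (1 + u.1 ^+ 2) * (1 + u.2 ^+ 2) <= M -> F u <= M * envelope u.
Proof.
have one (t : R) : 0 < 1 + t ^+ 2 by rewrite ltr_pwDl ?sqr_ge0.
by rewrite /envelope /oneDsqr mulrA !ler_pdivlMr // mulrAC.
Qed.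

Lemma schwartz_le_envelope : exists2 M, 0 <= M &
  forall u, f u <= M * envelope u.
Proof.
have [M00 p00 h00] := schwartz_moment 0 0.
have [M20 p20 h20] := schwartz_moment 1 0.
have [M02 p02 h02] := schwartz_moment 0 1.
have [M22 p22 h22] := schwartz_moment 1 1.
exists (M00 + M20 + M02 + M22); first by rewrite !addr_ge0.
move=> u; apply: le_envelope.
have := h00 u; have := h20 u; have := h02 u; have := h22 u.
rewrite /= !expr0; move: (f u) (u.1) (u.2) => v a c; lra.
Qed.

Lemma schwartz_second_le_envelope : exists2 M, 0 <= M &
  forall u, (u.1 ^+ 2 + u.2 ^+ 2) * f u <= M * envelope u.
Proof.
have [M20 p20 h20] := schwartz_moment 1 0.
have [M02 p02 h02] := schwartz_moment 0 1.
have [M22 p22 h22] := schwartz_moment 1 1.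
have [M40 p40 h40] := schwartz_moment 2 0.
have [M04 p04 h04] := schwartz_moment 0 2.
have [M42 p42 h42] := schwartz_moment 2 1.
have [M24 p24 h24] := schwartz_moment 1 2.
exists (M20 + M02 + M22 + M22 + M40 + M04 + M42 + M24).
  by rewrite !addr_ge0.
move=> u; apply: (@le_envelope (fun u => (u.1 ^+ 2 + u.2 ^+ 2) * f u)).
have := h20 u; have := h02 u; have := h22 u; have := h40 u; have := h04 u.
have := h42 u; have := h24 u.
rewrite /= !expr0; move: (f u) (u.1) (u.2) => v a c; lra.
Qed.

End SchwartzDecay.

(** * The exponential moments of the smoothing error *)

Section LimSup.
Context (R : realType) (C : choiceType) (T : filteredType C) (F : set_system T).
Implicit Type u : T -> \bar R.

Lemma limf_esup_le u (a : \bar R) : (\forall x \near F, (u x <= a)%E) ->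
  (limf_esup u F <= a)%E.
Proof.
move=> near_le; apply: ge_ereal_inf.
exists (ereal_sup (u @` [set x | (u x <= a)%E])).
  by exists [set x | (u x <= a)%E].
by apply: ge_ereal_sup => _ [x ux <-].
Qed.

Lemma limf_esup_ge0 u : ProperFilter F -> (forall x, (0 <= u x)%E) ->
  (0 <= limf_esup u F)%E.
Proof.
move=> FF u0; apply: le_ereal_inf_tmp => _ [V FV <-].
have [x Vx] := filter_ex FV.
by apply: le_trans (u0 x) _; apply: ereal_sup_ubound; exists x.
Qed.

End LimSup.

Section SmoothingKernel.
Variables (R : realType) (f : R * R -> R).
Hypotheses (f_pos : forall x, 0 < f x) (f_sym : forall x : R * R, f (- x) = f x)
  (f_schwartz : schwartz f) (f_int : (\int[@lebesgue2 R]_x (f x)%:E = 1)%E).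

Definition lattice_rescale (r : R) (x : int * int) : R :=
  rescale f r (Z2_to_R2 R x).

Definition lattice_mass (r : R) : R := fine (riemann_sum f r).

Lemma lattice_rescale_ge0 r x : 0 <= lattice_rescale r x.
Proof. by rewrite mulr_ge0 ?invr_ge0 ?sqr_ge0 // ltW. Qed.

Lemma lattice_rescale_even r x : lattice_rescale r (- x) = lattice_rescale r x.
Proof.
rewrite /lattice_rescale /rescale (_ : Z2_to_R2 R (- x) = - Z2_to_R2 R x).
  by rewrite scalerN f_sym.
by rewrite /Z2_to_R2 /= !mulrNz.
Qed.

Lemma lattice_mass_cvg (r : nat -> R) : (forall n, 1 <= r n) ->
  r n @[n --> \oo] --> +oo -> lattice_mass (r n) @[n --> \oo] --> (1 : R).
Proof.
move=> r1 roo; have [M M0 hM] := schwartz_le_envelope f_schwartz.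
apply: fine_cvg; rewrite -f_int.
apply: (riemann_sum_cvg M0 (fun u => ltW (f_pos u)) hM) => // u.
exact: schwartz_continuous.
Qed.

(** The mass and, up to the factor [r ^+ 2], the second moment are dominated by
    Riemann sums of [f] and of [|u|^2 f u], which the envelope bounds for all
    [r >= 1] at once. *)
Lemma lattice_rescale_moments : exists2 m, 0 <= m & forall r, 1 <= r ->
  [/\ lattice_mass r <= m,
   (\esum_(x in [set: int * int]) (lattice_rescale r x)%:E = (lattice_mass r)%:E)%E &
   (\esum_(x in [set: int * int]) (lattice_rescale r x * (l1norm x)%:R ^+ 2)%:E
     <= (m * r ^+ 2)%:E)%E].
Proof.
have [M M0 hM] := schwartz_le_envelope f_schwartz.
have [M' M'0 hM'] := schwartz_second_le_envelope f_schwartz.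
have pi2 : 0 <= (pi : R) * pi by rewrite mulr_ge0 ?pi_ge0.
pose m1 := 9 * M * (pi * pi); pose m2 := 2 * (9 * M' * (pi * pi)).
have m10 : 0 <= m1 by rewrite mulr_ge0 // mulr_ge0.
have m20 : 0 <= m2 by rewrite mulr_ge0 // mulr_ge0 // mulr_ge0.
exists (m1 + m2); first exact: addr_ge0.
move=> r r1; have r0 : 0 < r by lra.
have le1 := riemann_sum_le M0 (fun u => ltW (f_pos u)) hM r1.
have fin1 : riemann_sum f r \is a fin_num.
  rewrite ge0_fin_numE; first exact: le_lt_trans le1 (ltry _).
  by apply: esum_ge0 => x _; rewrite lee_fin lattice_rescale_ge0.
split.
- rewrite -lee_fin fineK //; apply: le_trans le1 _.
  by rewrite lee_fin lerDl.
- by rewrite /lattice_mass fineK.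
pose F2 (u : R * R) := (u.1 ^+ 2 + u.2 ^+ 2) * f u.
have F20 u : 0 <= F2 u by rewrite mulr_ge0 ?addr_ge0 ?sqr_ge0 // ltW.
have le2 := riemann_sum_le M'0 F20 hM' r1.
have r20 : 0 <= 2 * r ^+ 2 by rewrite mulr_ge0 // sqr_ge0.
apply: (@le_trans _ _ ((2 * r ^+ 2)%:E * riemann_sum F2 r)%E).
  rewrite /riemann_sum -esum_scale //; last first.
    by move=> x; rewrite lee_fin mulr_ge0 // invr_ge0 sqr_ge0.
  apply: le_esum => x _; rewrite -EFinM lee_fin.
  rewrite /lattice_rescale /rescale -/(lattice_point r x) /F2.
  set u := lattice_point r x.
  rewrite [leRHS](_ : _ = r ^- 2 * f u * (2 * ((r * u.1) ^+ 2 + (r * u.2) ^+ 2)));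
    last by ring.
  rewrite ler_wpM2l ?mulr_ge0 ?invr_ge0 ?sqr_ge0 ?(ltW (f_pos _)) //.
  have -> : r * u.1 = x.1%:~R by rewrite /u /= mulVKf ?gt_eqF.
  have -> : r * u.2 = x.2%:~R by rewrite /u /= mulVKf ?gt_eqF.
  have sq (i : int) : (`|i|%N%:R : R) ^+ 2 = i%:~R ^+ 2.
    by rewrite natr_absz intr_norm real_normK ?num_real.
  rewrite /l1norm natrD -!sq.
  have := sqr_ge0 (`|x.1|%N%:R - `|x.2|%N%:R : R); rewrite sqrrB sqrrD; lra.
apply: le_trans (lee_wpmul2l _ le2) _; first by rewrite lee_fin.
rewrite -EFinM lee_fin.
rewrite [leLHS](_ : _ = m2 * r ^+ 2); last by rewrite /m2; ring.
by rewrite ler_wpM2r ?sqr_ge0 // lerDr.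
Qed.

End SmoothingKernel.

Section SmoothingError.
Variables (R : realType) (d : measure_display) (T : measurableType d)
  (P : probability T R) (S1 S2 : nat -> T -> int * int).
Hypotheses (S1_walk : random_walk P S1) (S2_walk : random_walk P S2)
  (S12_copies : same_law P S1 S2) (S12_independent : independent_processes P S1 S2)
  (S1_generates : generates_Z2 (step_support P S1))
  (S1_aperiodic : strongly_aperiodic P S1).
Variable f : R * R -> R.
Hypotheses (f_pos : forall x, 0 < f x) (f_sym : forall x : R * R, f (- x) = f x)
  (f_schwartz : schwartz f) (f_int : (\int[@lebesgue2 R]_x (f x)%:E = 1)%E).
Variable b : nat -> R.
Hypotheses (b_pos : forall n, 0 < b n) (b_infty : b n @[n --> \oo] --> +oo)
  (b_small : b =o_\oo (fun n : nat => n%:R : R)).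
Variable lambda : R.
Hypothesis lambda_pos : 0 < lambda.

Definition smoothing_moment (eps : R) (n : nat) (y : int * int) : \bar R :=
  ('E_P[fun w : T =>
      expR (lambda * Num.sqrt
        `|(intersection_lt R S1 S2 n y w
           - smoothed_intersection_lt S1 S2 f b eps n y w)
          / ((b n)^-1 * n%:R)|)%R])%E.

Definition smoothing_scale (eps : R) (n : nat) : R :=
  Num.sqrt ((b n)^-1 * n%:R) * eps.

Definition smoothing_theta (n : nat) : R := lambda * Num.sqrt (b n / n%:R).

Lemma smoothing_momentE eps n y : smoothing_moment eps n y =
  ('E_P[fun w => (fun l l' => expR (smoothing_theta n * Num.sqrt
     `|intersection_gap (lattice_conv (rescale f (smoothing_scale eps n))) n y l l'|))
     (increments S1 n w) (increments S2 n w)])%E.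
Proof.
rewrite /smoothing_moment; congr expectation; apply/funext => w.
set K := lattice_conv _.
have -> : intersection_gap K n y (increments S1 n w) (increments S2 n w) =
    intersection_lt R S1 S2 n y w - smoothed_intersection_lt S1 S2 f b eps n y w.
  rewrite /intersection_gap /intersection_lt /smoothed_intersection_lt.
  rewrite /index_iota subSS subn0 -sumrB big_seq [RHS]big_seq.
  apply: eq_bigr => i; rewrite mem_iota => ii; rewrite -sumrB big_seq [RHS]big_seq.
  apply: eq_bigr => j; rewrite mem_iota => jj.
  rewrite (position_increments w S1_walk); last by move: ii; lia.
  rewrite (position_increments w S2_walk); last by move: jj; lia.
  by rewrite /delta addrAC subr_eq0 eq_sym.
congr expR; rewrite /smoothing_theta -mulrA; congr (_ * _).
rewrite normrM [X in _ * X]ger0_norm ?invr_ge0 ?mulr_ge0 ?invr_ge0 ?(ltW (b_pos n)) //.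
by rewrite sqrtrM // mulrC invfM invrK.
Qed.

Lemma smoothing_moment_ge1 eps n y : (1 <= smoothing_moment eps n y)%E.
Proof.
rewrite smoothing_momentE unlock.
have -> : (1 = \int[P]_w (1 : \bar R))%E.
  by rewrite integral_cst // mul1e; exact/esym/probability_setT.
pose C : countType := (seq (int * int) * seq (int * int))%type.
apply: ge0_le_integral => //.
- apply: (measurable_fun_discrete (C := C)
    (phi := fun w => (increments S1 n w, increments S2 n w))
    (fun c => (expR (smoothing_theta n * Num.sqrt `|intersection_gap
       (lattice_conv (rescale f (smoothing_scale eps n))) n y c.1 c.2|))%:E : \bar R)).
  move=> [l l']; rewrite (_ : _ @^-1` _ =
    [set w | increments S1 n w = l] `&` [set w | increments S2 n w = l']).
    apply: measurableI;
      [exact: (measurable_increments _ _ S1_walk)|exact: (measurable_increments _ _ S2_walk)].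
  by rewrite eqEsubset; split => w; [case=> <- <-|move=> [/= <- <-]].
- move=> w _; rewrite lee_fin -expR0 ler_expR mulr_ge0 // ?sqrtr_ge0 //.
  by rewrite mulr_ge0 ?sqrtr_ge0 // ltW.
Qed.

Lemma b_le (e : R) : 0 < e -> \forall n \near \oo, b n <= e * n%:R.
Proof.
move=> e0; have /eqoP small := b_small.
near=> n; have : `|b n| <= e * `|n%:R : R| by near: n; exact: small.
by rewrite !ger0_norm // ltW.
Unshelve. all: by end_near. Qed.

Lemma smoothing_scale_cvg eps : 0 < eps ->
  smoothing_scale eps n @[n --> \oo] --> +oo.
Proof.
move=> e0; apply/cvgryPge => A.
have A1 : 0 < `|A| + 1 by rewrite ltr_wpDl.
near=> n.
apply: (@le_trans _ _ (`|A| + 1)); first by have := ler_norm A; lra.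
have bn : b n <= (eps / (`|A| + 1)) ^+ 2 * n%:R.
  by near: n; apply: b_le; rewrite exprn_gt0 // divr_gt0.
rewrite /smoothing_scale -ler_pdivrMr //.
rewrite -[leLHS]ger0_norm ?divr_ge0 ?(ltW A1) ?(ltW e0) // -sqrtr_sqr.
apply: ler_wsqrtr; rewrite ler_pdivlMl ?b_pos //.
rewrite mulrC -ler_pdivlMl ?exprn_gt0 ?divr_gt0 //.
by rewrite -exprVn invf_div.
Unshelve. all: by end_near. Qed.

(** [exp_intersection_gap_le] at [s = c b n / n], where the bound
    [4 (1 + s) ^ n] is at most [4 exp (c b n)]. In [r = smoothing_scale eps n]
    and [s] the sequence [b] cancels: [r sqrt s = eps sqrt c]. *)
Lemma smoothing_moment_le (c : R) : 0 < c -> exists2 eps0 : R, 0 < eps0 &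
  forall eps, 0 < eps -> eps < eps0 -> \forall n \near \oo,
    forall y, (smoothing_moment eps n y <= (expR (2 * c * b n))%:E)%E.
Proof.
move=> c0.
have [z0 pz0] := exists_step S1_walk S1_generates.
have gen : generates_Z2 [set - z0 + z | z in [set z | 0 < step_prob P S1 z]].
  by rewrite -(step_supportE S1_walk); exact: S1_aperiodic.
have [A1 [A2 [L0 [A10 A20 heat]]]] := uniform_heat_bounds
  (step_prob_ge0 P S1) (step_prob_sum_le1 S1_walk) pz0 gen.
have [m m0 hm] := lattice_rescale_moments f_pos f_schwartz.
(* the mass being at most m, the second moment 4 G (m r^2) of the kernel is
   at most m' r^2 *)
pose m' := 4 * m * m; have m'0 : 0 <= m' by rewrite !mulr_ge0.
pose B := 1 + 8 * A1 ^+ 2 + 4 * A1 * A2 * m'.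
have A12 : 0 <= A1 ^+ 2 by exact: sqr_ge0.
have AAm : 0 <= A1 * A2 * m' by rewrite !mulr_ge0.
have B1 : 1 <= B by rewrite /B; lra.
have BB : B <= B ^+ 2 by rewrite expr2 ler_peMl //; lra.
(* with this dlt the condition on the bridges of the centered kernel is an
   equality *)
pose dlt := c / (256 * lambda ^+ 2 * B).
have l2 : 0 < lambda ^+ 2 by exact: exprn_gt0.
have B0 : 0 < B by lra.
have d0 : 0 < dlt by rewrite divr_gt0 // mulr_gt0 // mulr_gt0.
have qc0 : 0 < Num.sqrt c by rewrite sqrtr_gt0.
(* so that r sqrt s = eps sqrt c is at most dlt^3 *)
exists (dlt ^+ 3 / Num.sqrt c); first by rewrite divr_gt0 ?exprn_gt0.
move=> eps e0 ee.
(* the tolerance on kappa that the bridges of (1 - kappa) delta allow *)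
pose eta := c / (128 * lambda ^+ 2 * (A1 + 1)).
have eta0 : 0 < eta by rewrite divr_gt0 // mulr_gt0 ?ltr_wpDl // mulr_gt0.
pose r n := smoothing_scale eps n.
have r_large : \forall n \near \oo, 1 <= r n.
  by have /cvgryPge := smoothing_scale_cvg e0; apply.
(* the scale is at least 1 only from some n on *)
have mass_cvg : lattice_mass f (Num.max 1 (r n)) ^+ 2 @[n --> \oo] --> (1 : R).
  have one : lattice_mass f (Num.max 1 (r n)) @[n --> \oo] --> (1 : R).
    apply: (lattice_mass_cvg f_pos f_schwartz f_int).
      by move=> n; rewrite le_max lexx.
    apply/cvgryPge => A; near=> n; rewrite le_max; apply/orP; right.
    by near: n; move/cvgryPge : (smoothing_scale_cvg e0); apply.
  rewrite -[X in _ --> X]mulr1; under eq_fun do rewrite expr2.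
  exact: cvgM.
have kappa_near : \forall n \near \oo,
    `|1 - lattice_mass f (Num.max 1 (r n)) ^+ 2| <= Num.min 1 eta.
  by move/cvgrPdist_le : mass_cvg; apply; rewrite lt_min ltr01.
near=> n => y.
have r1 : 1 <= r n by near: n.
have n0 : (0 : R) < n%:R by rewrite ltr0n; near: n; exact: nbhs_infty_gt.
have bn0 := b_pos n.
set s := c * (b n / n%:R).
have s0 : 0 < s by rewrite mulr_gt0 // divr_gt0.
have s1 : s <= 1.
  rewrite /s mulrA ler_pdivrMr // mul1r -ler_pdivlMl // mulrC.
  by rewrite mulrC; near: n; apply: b_le; rewrite invr_gt0.
(* hence 4 <= 1 + c b n <= exp (c b n), which absorbs the constant 4 *)
have cb : 3 <= c * b n.
  rewrite -ler_pdivrMl //; near: n.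
  by move/cvgryPge : b_infty; apply.
have kn : `|1 - lattice_mass f (r n) ^+ 2| <= Num.min 1 eta.
  by rewrite -(max_r r1); near: n; exact: kappa_near.
move: kn; set G := lattice_mass f (r n); rewrite le_min => /andP[k1 keta].
have k2 : G ^+ 2 <= 2.
  by move: k1; rewrite ler_norml; lra.
have [Gm gsum gsecond] := hm _ r1.
have g0 := lattice_rescale_ge0 f_pos (r n).
have ge := lattice_rescale_even f_sym (r n).
have G0 := G_ge0 g0 gsum.
set theta := smoothing_theta n.
have theta0 : 0 <= theta by rewrite mulr_ge0 ?sqrtr_ge0 // ltW.
have bdn0 : 0 < b n / n%:R by rewrite divr_gt0.
have theta2 : theta ^+ 2 = lambda ^+ 2 * (b n / n%:R).
  by rewrite exprMn sqr_sqrtr // ltW.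
have rs : r n * Num.sqrt s <= dlt ^+ 3.
  have -> : r n * Num.sqrt s = eps * Num.sqrt c.
    rewrite /r /smoothing_scale /s (mulrC _ eps) -mulrA; congr (_ * _).
    rewrite [in RHS](_ : c = (b n)^-1 * n%:R * (c * (b n / n%:R))).
      by rewrite [RHS]sqrtrM // mulr_ge0 // invr_ge0 ltW.
    by field; rewrite !gt_eqF.
  by rewrite -ler_pdivlMr // ltW.
rewrite smoothing_momentE.
apply: (@le_trans _ _ (4 * (1 + s) ^+ n)%:E).
  apply: (@expectation_le_truncated _ _ _ _ S1 S2 S1_walk S2_walk S12_copies
    S12_independent n (fun l l' => expR (theta * Num.sqrt `|intersection_gap
      (lattice_conv (rescale f (r n))) n y l l'|)) _ L0); last first.
    move=> L aL; have [h1 h2] := heat L aL; have [uL L00 _] := aL.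
    have finite := @exp_intersection_gap_le R L (truncated (step_prob P S1) L)
      (fun x => truncated_ge0 (step_prob_ge0 P S1) (step_prob_sum_le1 S1_walk) x uL)
      (truncated_sum (step_prob P S1) uL L00) A1 A2 A10 A20 h1 h2
      (lattice_conv (rescale f (r n))) (G ^+ 2) (4 * G * (m * r n ^+ 2))
      (self_convolution_ge0 g0) (self_convolution_even ge)
      (self_convolution_sum_le g0 gsum) (self_convolution_sum_ge g0 gsum)
      (self_convolution_second g0 gsum gsecond) (r n) m' B s dlt
      theta n y.
    apply: finite.
    - by lra.
    - exact: m'0.
    - exact: ltW.
    - exact: k2.
    - rewrite /m' [leLHS](_ : _ = 4 * m * r n ^+ 2 * G); last by ring.
      rewrite [leRHS](_ : _ = 4 * m * r n ^+ 2 * m); last by ring.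
      by rewrite ler_wpM2l // mulr_ge0 ?sqr_ge0 // mulr_ge0.
    - by apply: le_trans _ BB; rewrite /B; lra.
    - by apply: le_trans _ BB; rewrite /B; lra.
    - exact: s0.
    - exact: s1.
    - exact: d0.
    - exact: rs.
    - exact: theta0.
    - rewrite exprMn theta2 /s /dlt le_eqVlt; apply/orP; left; apply/eqP.
      by field; rewrite !gt_eqF //; lra.
    - rewrite exprMn theta2.
      rewrite [leLHS](_ : _ = 64 * lambda ^+ 2 * A1 / c * `|1 - G ^+ 2|); last first.
        by rewrite /s; field; rewrite !gt_eqF.
      apply: (@le_trans _ _ (64 * lambda ^+ 2 * A1 / c * eta)).
        by rewrite ler_wpM2l // divr_ge0 ?(ltW c0) // !mulr_ge0 // ltW.
      rewrite [leLHS](_ : _ = 2^-1 * (A1 / (A1 + 1))); last first.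
        by rewrite /eta; field; rewrite !gt_eqF //; lra.
      by rewrite ler_piMr // ler_pdivrMr; lra.
  by move=> l l'; exact: expR_ge0.
rewrite lee_fin (_ : 2 * c * b n = c * b n + c * b n); last by ring.
rewrite expRD; apply: ler_pM => //.
- by rewrite exprn_ge0 //; lra.
- by apply: le_trans (expR_ge1Dx _); lra.
have -> : c * b n = n%:R * s by rewrite /s; field; rewrite gt_eqF.
rewrite expRM_natl lerXn2r ?nnegrE ?expR_ge0 ?expR_ge1Dx //; lra.
Unshelve. all: by end_near. Qed.

End SmoothingError.

Theorem theorem4p1 (R : realType) (d : measure_display) (T : measurableType d)
    (P : probability T R) (S1 S2 : nat -> T -> int * int)
    (S1_walk : random_walk P S1) (S2_walk : random_walk P S2)
    (S12_copies : same_law P S1 S2)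
    (S12_independent : independent_processes P S1 S2)
    (S1_symmetric : symmetric_step P S1)
    (S1_moment : finite_second_moment P S1)
    (S1_generates : generates_Z2 (step_support P S1))
    (S1_aperiodic : strongly_aperiodic P S1)
    (f : R * R -> R)
    (f_pos : forall x, 0 < f x)
    (f_sym : forall x : R * R, f (- x) = f x)
    (f_schwartz : schwartz f)
    (f_int : (\int[@lebesgue2 R]_x (f x)%:E = 1)%E)
    (f_fourier : fourier_support f `<=` `]- pi, pi[ `*` `]- pi, pi[)
    (b : nat -> R)
    (b_pos : forall n, 0 < b n)
    (b_infty : b n @[n --> \oo] --> +oo)
    (b_small : b =o_\oo (fun n : nat => n%:R : R))
    (lambda : R) (lambda_pos : 0 < lambda) :
  limf_esup (fun eps : R =>
    limn_esup (fun n : nat =>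
      ereal_sup [set
        (((b n)^-1)%:E *
         lne 'E_P[fun w : T =>
           expR (lambda * Num.sqrt
             `|(intersection_lt R S1 S2 n y w
                - smoothed_intersection_lt S1 S2 f b eps n y w)
               / ((b n)^-1 * n%:R)|)%R])%E
      | y in [set: int * int]])) 0^'+ = 0%E.
Proof.
pose L eps n := ereal_sup [set (((b n)^-1)%:E *
  lne (smoothing_moment P S1 S2 f b lambda eps n y))%E | y in [set: int * int]].
rewrite -[LHS]/(limf_esup (fun eps => limn_esup (L eps)) 0^'+).
have L0 eps n : (0 <= L eps n)%E.
  have term0 : (0 <= ((b n)^-1)%:E *
      lne (smoothing_moment P S1 S2 f b lambda eps n (0%R : int * int)))%E.
    rewrite mule_ge0 ?lee_fin ?invr_ge0 ?(ltW (b_pos n)) // lne_ge0.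
    exact: smoothing_moment_ge1.
  by apply: le_trans term0 _; apply: ereal_sup_ubound; exists (0 : int * int).
apply/eqP; rewrite eq_le; apply/andP; split; last first.
  by apply: limf_esup_ge0 => eps; apply: limf_esup_ge0.
apply/lee_addgt0Pr => e e0; rewrite add0e.
have c0 : 0 < e / 2 by rewrite divr_gt0.
have [eps0 eps0_gt0 heps] := smoothing_moment_le S1_walk S2_walk S12_copies
  S12_independent S1_generates S1_aperiodic f_pos f_sym f_schwartz f_int
  b_pos b_infty b_small lambda_pos c0.
apply: limf_esup_le; near=> eps.
apply: limf_esup_le.
have pos : 0 < eps by near: eps; exact: nbhs_right_gt.
have small : eps < eps0 by near: eps; exact: nbhs_right_lt.
apply: filterS (heps eps pos small) => n hn.
apply: ge_ereal_sup => _ [y _ <-].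
rewrite -lee_pdivlMl ?invr_gt0 // invrK.
have -> : ((b n)%:E * e%:E = lne (expR (2 * (e / 2) * b n))%:E)%E.
  rewrite lne_EFin ?expR_gt0 // expRK -EFinM; congr (_%:E); by field.
rewrite lee_lne ?hn // in_itv /= leey andbT.
  apply: (@le_trans _ _ 1%E); first by rewrite lee_fin.
  exact: smoothing_moment_ge1.
by rewrite lee_fin expR_ge0.
Unshelve. all: by end_near. Qed.
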